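(* Let $d\ge2$ and $\alpha>0$. There does not exist a non-trivial stationary solution $u$ to the fractional Navier-Stokes equations $$\mathrm{div}(u\otimes u)+(-\Delta)^\alpha u+\nabla p=0,\qquad \mathrm{div}\,u=0,\qquad \hat u(0)=0\quad\text{on }\mathbb{T}^d$$ satisfying $$\begin{cases}u\in L^2\cap B^{1-2\alpha}_{\infty,1}(\mathbb{T}^d)&\text{if }0<\alpha\le1,\\ u\in L^2\cap B^{-1}_{q,1}(\mathbb{T}^d)&\text{if }1\le\alpha\le\frac{d+2}{4},\\ u\in L^2(\mathbb{T}^d)&\text{if }\alpha>\frac{d+2}{4},\end{cases}$$ where $q=\frac{d}{2\alpha-2}$ (with $q=\infty$ when $\alpha=1$).
   Context: $\mathbb{T}^d=\mathbb{R}^d/\mathbb{Z}^d$; $\hat f(m)=\langle f,e^{-2\pi i m\cdot x}\rangle$; $(-\Delta)^\alpha f=\sum_{m\in\mathbb{Z}^d}(2\pi|m|)^{2\alpha}\hat f(m)e^{2\pi i m\cdot x}$; $(a\otimes b)_{ij}=a_ib_j$, $(\mathrm{div} A)_i=\partial_jA_{ij}$. For $u\in L^2$, a stationary solution means a weak solution: $\hat u(0)=0$, $u$ weakly divergence free, and $-\langle u\otimes u,\nabla\varphi\rangle+\langle u,(-\Delta)^\alpha\varphi\rangle=0$ for every divergence-free $\varphi\in C^\infty(\mathbb{T}^d)$. Non-trivial means not identically zero. Besov spaces: fix a radial bump function $\chi\in C_c^\infty(\mathbb{R}^d)$ supported in $B(0,1)$ and equal to $1$ on $B(0,9/10)$.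 For dyadic integers $N\ge1$ (powers of 2), $P_{\le N}f=\sum_{m}\chi(m/N)\hat f(m)e^{2\pi i m\cdot x}$, $P_1=P_{\le1}$, $P_N=P_{\le N}-P_{\le N/2}$ for $N\ge2$; $\|f\|_{B^s_{q,r}}=(\sum_NN^{sr}\|P_Nf\|_{L^q}^r)^{1/r}$. *)

(* Defs.v *)
From HB Require Import structures.
From mathcomp Require Import all_boot all_order all_algebra.
From mathcomp Require Import complex.
From mathcomp Require Import all_classical all_reals all_analysis.

Set Implicit Arguments.
Unset Strict Implicit.
Unset Printing Implicit Defensive.

Import Order.TTheory GRing.Theory Num.Theory.
Import numFieldNormedType.Exports.

Local Open Scope classical_set_scope.
Local Open Scope ring_scope.
Local Open Scope complex_scope.

Definition rV_display : measure_display -> measure_display.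
Proof. exact. Qed.

Section rV_measurable.
Context (R : realType) (d : nat).

Definition rV_coord (i : 'I_d) (x : 'rV[R]_d) : measurableTypeR R := x 0 i.

Let rV_set0 : g_sigma_preimage rV_coord set0.
Proof. exact: sigma_algebra0. Qed.

Let rV_setC A : g_sigma_preimage rV_coord A -> g_sigma_preimage rV_coord (~` A).
Proof. exact: sigma_algebraC. Qed.

Let rV_bigcup (F : (set 'rV[R]_d)^nat) :
  (forall i, g_sigma_preimage rV_coord (F i)) ->
  g_sigma_preimage rV_coord (\bigcup_i (F i)).
Proof. exact: sigma_algebra_bigcup. Qed.

HB.instance Definition _ := @isMeasurable.Build (rV_display default_measure_display)
  'rV[R]_d (g_sigma_preimage rV_coord) rV_set0 rV_setC rV_bigcup.

End rV_measurable.

Lemma measurable_rV_coord (R : realType) d (i : 'I_d) :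
  measurable_fun [set: 'rV[R]_d] (@rV_coord R d i).
Proof.
move=> _ Y mY; rewrite setTI; apply: sub_sigma_algebra => /=.
rewrite -bigcup_seq/=; exists i => /=; first by rewrite mem_index_enum.
by exists Y => //; rewrite setTI.
Qed.

Lemma measurable_fun_rV_coordP d1 (T : measurableType d1) (R : realType) n
    (f : T -> 'rV[R]_n) :
  (forall i, measurable_fun [set: T] (rV_coord i \o f)) ->
  measurable_fun [set: T] f.
Proof.
move=> mf.
suff prefS : g_sigma_preimage (fun i => @rV_coord R n i \o f) `<=` measurable.
  move=> _ A mA; apply: prefS; rewrite g_sigma_preimage_comp.
  by exists A.
apply: smallest_sub; first exact: sigma_algebra_measurable.
rewrite -bigcup_seq => A [i _] [B mB <-].
exact: mf.
Qed.

Section torus.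
Context (R : realType).

(* Prepends one coordinate: R * R^n -> R^(n+1). *)
Definition rV_cons n (p : measurableTypeR R * 'rV[R]_n) : 'rV[R]_n.+1 :=
  row_mx (const_mx p.1 : 'rV_1) p.2.

Lemma measurable_rV_cons n : measurable_fun [set: _] (@rV_cons n).
Proof.
apply: measurable_fun_rV_coordP => i.
have [j ->|j ->] := @split_ordP 1 n i.
  rewrite (_ : _ \o _ = fst)//.
  by apply/funext => p; rewrite /rV_coord/= /rV_cons (@row_mxEl _ 1 1 n) mxE.
rewrite (_ : _ \o _ = rV_coord j \o snd).
  by apply: measurableT_comp => //; exact: measurable_rV_coord.
by apply/funext => p; rewrite /rV_coord/= /rV_cons (@row_mxEr _ 1 1 n).
Qed.

HB.instance Definition _ n :=
  isMeasurableFun.Build _ _ _ _ (@rV_cons n) (@measurable_rV_cons n).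

(* The d-fold product of the uniform probability on [0, 1]. Functions on
   T^d = R^d/Z^d are the Z^d-periodic functions on R^d, and integrating such a
   function against this measure is integrating it over T^d. *)
Fixpoint torus_prob (d : nat) : probability 'rV[R]_d R :=
  match d with
  | 0 => @dirac _ 'rV[R]_0 0 R
  | n.+1 => distribution (uniform_prob (@ltr01 R) \x torus_prob n)%E (@rV_cons n)
  end.

End torus.

Section fourier.
Context (R : realType) (d : nat).
Local Notation T := (torus_prob R d).

Definition intv (m : 'rV[int]_d) : 'rV[R]_d := map_mx intr m.

(* Euclidean norm; the library norm on 'rV[R]_d is the sup norm. *)
Definition enorm (x : 'rV[R]_d) : R := Num.sqrt (\sum_i x 0 i ^+ 2).

Definition Zperiodic (V : Type) (f : 'rV[R]_d -> V) :=
  forall x (m : 'rV[int]_d), f (x + intv m) = f x.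

(* e^(2 pi i m.x) *)
Definition fexp (m : 'rV[int]_d) (x : 'rV[R]_d) : R[i] :=
  let t := 2 * pi * \sum_i intv m 0 i * x 0 i in cos t +i* sin t.

Definition cintegral (f : 'rV[R]_d -> R[i]) : R[i] :=
  (\int[T]_x complex.Re (f x)) +i* (\int[T]_x complex.Im (f x)).

Definition fcoef (f : 'rV[R]_d -> R[i]) (m : 'rV[int]_d) : R[i] :=
  cintegral (fun x => f x * fexp (- m) x).

(* Limit of the partial sums over the cubes max_i |m_i| <= n; it is applied
   below only to the absolutely convergent Fourier series of smooth functions. *)
Definition zsum (F : 'rV[int]_d -> R[i]) : R[i] :=
  let S n := \sum_(m \in [set m : 'rV[int]_d | forall i, (`|m ord0 i| <= n)%N]) F m in
  limn (fun n => complex.Re (S n)) +i* limn (fun n => complex.Im (S n)).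

Definition fraclap (alpha : R) (f : 'rV[R]_d -> R[i]) (x : 'rV[R]_d) : R[i] :=
  zsum (fun m =>
    ((2 * pi * enorm (intv m)) `^ (2 * alpha))%:C * fcoef f m * fexp m x).

Definition pderiv (i : 'I_d) (f : 'rV[R]_d -> R) : 'rV[R]_d -> R :=
  fun x => 'D_(delta_mx 0 i) f x.

(* All iterated partial derivatives exist and are continuous. *)
Definition smooth (f : 'rV[R]_d -> R) :=
  forall s : seq 'I_d, let g := foldr pderiv f s in
    continuous g /\ forall i x, derivable g x (delta_mx 0 i).

Definition lp_bump (chi : 'rV[R]_d -> R) :=
  [/\ smooth chi,
      forall x y, enorm x = enorm y -> chi x = chi y,
      closure [set x | chi x != 0] `<=` [set x | enorm x < 1] &
      forall x, enorm x < 9 / 10 -> chi x = 1].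

(* P_{<= N}; the sum has finite support when chi satisfies [lp_bump]. *)
Definition lp_le (chi : 'rV[R]_d -> R) (N : nat) (f : 'rV[R]_d -> R[i])
    (x : 'rV[R]_d) : R[i] :=
  \sum_(m \in [set: 'rV[int]_d])
    ((chi (N%:R^-1 *: intv m))%:C * fcoef f m * fexp m x).

(* P_N for N = 2 ^ k. *)
Definition lp_proj (chi : 'rV[R]_d -> R) (k : nat) (f : 'rV[R]_d -> R[i])
    (x : 'rV[R]_d) : R[i] :=
  if k is j.+1 then lp_le chi (2 ^ k) f x - lp_le chi (2 ^ j) f x
  else lp_le chi 1 f x.

Definition besov_norm (chi : 'rV[R]_d -> R) (s : R) (q : \bar R) (r : R)
    (f : 'rV[R]_d -> R[i]) : \bar R :=
  ((\sum_(0 <= k <oo) (((2 ^ k)%:R : R) `^ (s * r))%:E *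
      (Lnorm T q (fun x => (Normc.normc (lp_proj chi k f x))%:E)) `^ r) `^ r^-1)%E.

End fourier.

Section navier_stokes.
Context (R : realType) (d : nat).
Local Notation T := (torus_prob R d).
Implicit Types (u phi : 'rV[R]_d -> 'rV[R]_d).

Definition vcomp u (i : 'I_d) : 'rV[R]_d -> R := fun x => u x 0 i.

Definition cvcomp u (i : 'I_d) : 'rV[R]_d -> R[i] := fun x => (u x 0 i)%:C.

Definition in_L2 u := forall i, vcomp u i \in Lfun T 2%:E.

Definition in_besov (chi : 'rV[R]_d -> R) (s : R) (q : \bar R) (r : R) u :=
  forall i, (besov_norm chi s q r (cvcomp u i) < +oo)%E.

Definition weakly_divfree u :=
  forall psi : 'rV[R]_d -> R, Zperiodic psi -> smooth psi ->
    \sum_i \int[T]_x (vcomp u i x * pderiv i psi x) = 0.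

Definition divfree_test phi :=
  [/\ Zperiodic phi, forall i, smooth (vcomp phi i) &
      forall x, \sum_i pderiv i (vcomp phi i) x = 0].

Definition stationary_solution (alpha : R) u :=
  [/\ Zperiodic u, in_L2 u, forall i, fcoef (cvcomp u i) 0 = 0,
      weakly_divfree u &
      forall phi, divfree_test phi ->
        - (\sum_i \sum_j
             \int[T]_x (vcomp u i x * vcomp u j x * pderiv j (vcomp phi i) x))%:C
        + \sum_i cintegral (fun x => cvcomp u i x * fraclap alpha (cvcomp phi i) x)
        = 0].

(* As an element of L^2, i.e. up to null sets. *)
Definition nontrivial u := ~ {ae T, forall x, u x = 0}.

End navier_stokes.

(* Main.v *)
Require Import Defs.
From HB Require Import structures.
From mathcomp Require Import all_boot all_order all_algebra.
From mathcomp Require Import complex.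
From mathcomp Require Import all_classical all_reals all_analysis.
From mathcomp Require Import measurable_realfun ess_sup_inf finmap.
From mathcomp Require Import ring lra zify.

Set Implicit Arguments.
Unset Strict Implicit.
Unset Printing Implicit Defensive.

Import Order.TTheory GRing.Theory Num.Theory.
Import numFieldNormedType.Exports.

Local Open Scope classical_set_scope.
Local Open Scope ring_scope.
Local Open Scope complex_scope.

(** Only the size of the frequency blocks of [u] matters. Let [p k] bound the
    [k]-th block in [L^oo]. By Bernstein's inequality each of the two Besov
    assumptions, and the mere finiteness of the energy when
    [alpha > (d + 2) / 4], makes the series of [2 ^ (k * (1 - 2 * alpha)) * p k]
    converge ([besov_solution_trivial], [L2_solution_trivial]).

    Fix a dyadic scale [n] and test the equation with a smooth cutoff of [u]
    itself at frequency [8 * n] ([solution_balance]). With [c] the Fourier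
    coefficients of [u], the dissipation becomes a weighted sum of [|c m| ^ 2],
    and the quadratic term a flux of energy through the frequency [n]. Split [u]
    into a low part [L] and a high part [H] at frequency [n]. The interactions
    with at most one high factor cancel ([flux_split]). Those that remain have
    two high factors, against the gradient of a low-frequency function or a
    commutator of the cutoff with [L]; hence the flux is at most [g n * t n],
    where [t n] is the energy beyond the frequency [n] and [g n] is, up to a
    constant, the sum of [2 ^ k * p k] over the blocks of frequency [O(n)]
    ([flux_le]). The dissipation is at least [n ^ (2 * alpha)] times the energy
    between the frequencies [n] and [2 * n]. Therefore
      [t n - t (2 * n) <= C * n ^ (- 2 * alpha) * g n * t n].
    The convergent series above makes the relative decrements on the right
    summable over the dyadic scales ([geometric_average_sums]), and a positive
    sequence with summable relative decrements does not tend to 0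
    ([slow_decrease_vanish]). But [t n] does, since [u] has finite energy. So
    [t n = 0] at large scales, where the flux, the dissipation and finally [c]
    vanish ([coefficients_vanish]).

    The estimates concern trigonometric polynomials, whose mean over the torus
    is their average over a fine enough finite grid: translations, convolutions
    and Parseval's identity become finite sums. The integral over the torus is
    used for three facts. The exponentials are orthonormal. Real trigonometric
    polynomials are dense in [L^2] ([trigonometric_density]), so the flux of [u]
    is the limit of the fluxes of its partial Fourier sums
    ([weak_balance_fsum]). And a function of bounded frequency reproduces itself
    against a kernel, which gives Bernstein's inequality
    ([sup_le_level_excess]). *)

Local Notation nc := Normc.normc.

(** * Moduli of complex numbers *)

Section complex_modulus.
Context {R : realType}.
Implicit Types z w : R[i].

Lemma nc_ge0 z : 0 <= nc z.
Proof. by case: z => a b; exact: sqrtr_ge0. Qed.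

Lemma nc0 : nc (0 : R[i]) = 0. Proof. exact: Normc.normc0. Qed.

Lemma ncM z w : nc (z * w) = nc z * nc w. Proof. exact: Normc.normcM. Qed.

Lemma ncN z : nc (- z) = nc z. Proof. exact: normcN. Qed.

Lemma ncD z w : nc (z + w) <= nc z + nc w. Proof. exact: le_normcD. Qed.

Lemma ncB z w : nc (z - w) <= nc z + nc w.
Proof. by rewrite -(ncN w); exact: ncD. Qed.

Lemma nc_sum (I : Type) (r : seq I) (P : pred I) (F : I -> R[i]) :
  nc (\sum_(i <- r | P i) F i) <= \sum_(i <- r | P i) nc (F i).
Proof.
elim/big_ind2 : _ => [|z x w y zx wy|//]; first by rewrite nc0.
by rewrite (le_trans (ncD _ _))// lerD.
Qed.

Lemma nc_real (x : R) : nc x%:C = `|x|.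
Proof. by rewrite /= expr0n addr0 sqrtr_sqr. Qed.

Lemma nc_conj z : nc (conjc z) = nc z.
Proof. by case: z => a b /=; rewrite sqrrN. Qed.

Lemma realcD (x y : R) : (x + y)%:C = x%:C + y%:C :> R[i].
Proof. exact: (rmorphD (real_complex R)). Qed.

Lemma realcB (x y : R) : (x - y)%:C = x%:C - y%:C :> R[i].
Proof. exact: (rmorphB (real_complex R)). Qed.

Lemma realcM (x y : R) : (x * y)%:C = x%:C * y%:C :> R[i].
Proof. exact: (rmorphM (real_complex R)). Qed.

Lemma realc_sum (I : Type) (r : seq I) (P : pred I) (F : I -> R) :
  (\sum_(i <- r | P i) F i)%:C = \sum_(i <- r | P i) (F i)%:C :> R[i].
Proof. exact: (rmorph_sum (real_complex R)). Qed.

Lemma conjcI z : conjc (conjc z) = z. Proof. by case: z => a b /=; rewrite opprK. Qed.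

Lemma conjcB z w : conjc (z - w) = conjc z - conjc w.
Proof. by case: z w => [a b] [a' b'] /=; rewrite opprD. Qed.

Lemma conjcM z w : conjc (z * w) = conjc z * conjc w.
Proof. exact: (rmorphM (@conjc R)). Qed.

Lemma conjc_sum (I : Type) (r : seq I) (P : pred I) (F : I -> R[i]) :
  conjc (\sum_(i <- r | P i) F i) = \sum_(i <- r | P i) conjc (F i).
Proof. exact: (rmorph_sum (@conjc R)). Qed.

Lemma nc_sqr z : nc z ^+ 2 = complex.Re z ^+ 2 + complex.Im z ^+ 2.
Proof. by case: z => a b /=; rewrite sqr_sqrtr// addr_ge0// sqr_ge0. Qed.

Lemma mul_conj z : z * conjc z = (nc z ^+ 2)%:C.
Proof.
case: z => a b; rewrite nc_sqr/=; apply/eqP; rewrite eq_complex/=.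
by apply/andP; split; apply/eqP; ring.
Qed.

Lemma nc_Re z : `|complex.Re z| <= nc z.
Proof.
case: z => a b /=; rewrite -(sqrtr_sqr a) ler_wsqrtr//.
by rewrite lerDl sqr_ge0.
Qed.

Lemma nc_Im z : `|complex.Im z| <= nc z.
Proof.
case: z => a b /=; rewrite -(sqrtr_sqr b) ler_wsqrtr//.
by rewrite lerDr sqr_ge0.
Qed.

Lemma ReM_real (x : R) z : complex.Re (x%:C * z) = x * complex.Re z.
Proof. by case: z => a b /=; rewrite mul0r subr0. Qed.

Lemma ImM_real (x : R) z : complex.Im (x%:C * z) = x * complex.Im z.
Proof. by case: z => a b /=; rewrite mul0r addr0. Qed.

Lemma Re_sum (I : Type) (r : seq I) (P : pred I) (F : I -> R[i]) :
  complex.Re (\sum_(i <- r | P i) F i) = \sum_(i <- r | P i) complex.Re (F i).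
Proof. by apply: (big_morph (@complex.Re R)) => // -[a b] [a' b']. Qed.

Lemma Im_sum (I : Type) (r : seq I) (P : pred I) (F : I -> R[i]) :
  complex.Im (\sum_(i <- r | P i) F i) = \sum_(i <- r | P i) complex.Im (F i).
Proof. by apply: (big_morph (@complex.Im R)) => // -[a b] [a' b']. Qed.

Lemma nc_eq0 z : nc z = 0 -> z = 0. Proof. exact: Normc.eq0_normc. Qed.

(** Each further factor [z] adds one displacement [z - 1], rotated. *)
Lemma nc_expB1 z n : nc z = 1 -> nc (z ^+ n - 1) <= n%:R * nc (z - 1).
Proof.
move=> z1; elim: n => [|n ih]; first by rewrite expr0 subrr nc0 mul0r.
rewrite (_ : z ^+ n.+1 - 1 = z * (z ^+ n - 1) + (z - 1)); last first.
  by rewrite exprS; ring.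
rewrite (le_trans (ncD _ _))// ncM z1 mul1r -natr1 mulrDl mul1r lerD2r.
exact: ih.
Qed.

End complex_modulus.

(** * Sums over lattice cubes *)

Section lattice_sums.
Context {d : nat}.
Implicit Types m k : 'rV[int]_d.

Definition cube (n : nat) : seq 'rV[int]_d :=
  [seq \row_i ((f i : nat)%:Z - n%:Z) | f : {ffun 'I_d -> 'I_(n.*2.+1)}].

Lemma uniq_cube n : uniq (cube n).
Proof.
rewrite map_inj_uniq ?enum_uniq// => f g /rowP fg; apply/ffunP => i.
have := fg i; rewrite !mxE => /addIr/eqP; rewrite eqz_nat => /eqP.
exact: val_inj.
Qed.

Lemma mem_cube n m : (m \in cube n) = [forall i, (absz (m ord0 i) <= n)%N].
Proof.
apply/mapP/forallP => [[f _ ->] i|mn].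
  by rewrite mxE; have := ltn_ord (f i); rewrite ltnS; move: (f i : nat) => a; rewrite -addnn; lia.
have lt_i i : (absz (m ord0 i + n%:Z)%R < n.*2.+1)%N.
  by have := mn i; rewrite -addnn; move: (m ord0 i) => z; lia.
exists [ffun i => Ordinal (lt_i i)]; first by rewrite mem_enum.
apply/rowP => i; rewrite !mxE ffunE/=; have := mn i; rewrite [m 0 i](_ : _ = m ord0 i)//; move: (m ord0 i) => z; lia.
Qed.

Lemma cubeP n m : reflect (forall i, (absz (m ord0 i) <= n)%N) (m \in cube n).
Proof. by rewrite mem_cube; exact: forallP. Qed.

Lemma size_cube n : size (cube n) = (n.*2.+1 ^ d)%N.
Proof. by rewrite size_map -cardE card_ffun !card_ord. Qed.

Lemma cube_le n n' m : (n <= n')%N -> m \in cube n -> m \in cube n'.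
Proof. by move=> nn' /cubeP mn; apply/cubeP => i; exact: leq_trans nn'. Qed.

Lemma cubeN n m : (- m \in cube n) = (m \in cube n).
Proof. by rewrite !mem_cube; apply: eq_forallb => i; rewrite mxE abszN. Qed.

Lemma cubeD n n' m k : m \in cube n -> k \in cube n' -> m + k \in cube (n + n').
Proof.
move=> /cubeP mn /cubeP kn; apply/cubeP => i.
by rewrite mxE; have := mn i; have := kn i; move: (m ord0 i) (k ord0 i) => z w; lia.
Qed.

Lemma cube0 n : 0 \in cube n.
Proof. by apply/cubeP => i; rewrite mxE. Qed.

Lemma cube_exists m : exists n, m \in cube n.
Proof.
exists (\sum_i absz (m ord0 i))%N; apply/cubeP => i.
by rewrite (bigD1 i)//= leq_addr.
Qed.

Section supports.
Context {V : nmodType}.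
Implicit Types a : 'rV[int]_d -> V.

Definition supp n a := forall m, m \notin cube n -> a m = 0.

Lemma supp_le n n' a : (n <= n')%N -> supp n a -> supp n' a.
Proof.
by move=> nn' an m mn'; apply: an; apply: contra mn'; exact: cube_le.
Qed.

Lemma eq_big_support (s t : seq 'rV[int]_d) a : uniq s -> uniq t ->
  (forall m, m \in s -> m \notin t -> a m = 0) ->
  (forall m, m \in t -> m \notin s -> a m = 0) ->
  \sum_(m <- s) a m = \sum_(m <- t) a m.
Proof.
move=> us ut st ts.
rewrite (bigID [in t])/= [X in _ + X]big_seq_cond [X in _ + X]big1 ?addr0; last first.
  by move=> m /andP[ms mt]; exact: st.
rewrite [RHS](bigID [in s])/= [X in _ = _ + X]big_seq_cond [X in _ = _ + X]big1 ?addr0; last first.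
  by move=> m /andP[mt ms]; exact: ts.
rewrite -[LHS]big_filter -[RHS]big_filter; apply: perm_big; apply: uniq_perm; rewrite ?filter_uniq//.
by move=> m; rewrite !mem_filter andbC.
Qed.

Lemma sum_cube_le n n' a : (n <= n')%N -> supp n a ->
  \sum_(m <- cube n') a m = \sum_(m <- cube n) a m.
Proof.
move=> nn' an; apply: eq_big_support; rewrite ?uniq_cube// => m mn.
  exact: an.
by rewrite (cube_le nn' mn).
Qed.

Lemma sum_cubeN n a : \sum_(m <- cube n) a (- m) = \sum_(m <- cube n) a m.
Proof.
rewrite -(big_map -%R xpredT a); apply: perm_big; apply: uniq_perm.
- by rewrite map_inj_uniq ?uniq_cube//; exact: oppr_inj.
- exact: uniq_cube.
- by move=> m; rewrite -{1}(opprK m) mem_map ?cubeN//; exact: oppr_inj.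
Qed.

Lemma sum_cube_shift n n' k a : k \in cube n -> supp n' a ->
  \sum_(m <- cube n') a m = \sum_(m <- cube (n + n')) a (m - k).
Proof.
move=> kn an; rewrite -(big_map (fun m => m - k) xpredT a).
apply: eq_big_support.
- exact: uniq_cube.
- by rewrite map_inj_uniq ?uniq_cube//; exact: addIr.
- move=> m mn /mapP[]; exists (m + k); last by rewrite addrK.
  by rewrite addrC cubeD.
- by move=> m _; exact: an.
Qed.

End supports.

End lattice_sums.

(** * Trigonometric polynomials *)

Section trigonometric_polynomials.
Context {R : realType} {d : nat}.
Local Arguments fexp : simpl never.
Local Notation C := R[i].
Local Notation Z := 'rV[int]_d.
Local Notation V := 'rV[R]_d.
Implicit Types (m k : Z) (x y : V) (a b : Z -> C).

Lemma fexp0 x : fexp 0 x = 1.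
Proof.
rewrite /fexp big1 ?mulr0 ?cos0 ?sin0//.
by move=> i _; rewrite !mxE mul0r.
Qed.

Lemma fexpDl m k x : fexp (m + k) x = fexp m x * fexp k x.
Proof.
rewrite /fexp.
have -> : \sum_i intv R (m + k) 0 i * x 0 i =
    \sum_i intv R m 0 i * x 0 i + \sum_i intv R k 0 i * x 0 i.
  by rewrite -big_split/=; apply: eq_bigr => i _; rewrite !mxE intrD mulrDl.
by rewrite mulrDr cosD sinD; apply/eqP; rewrite eq_complex/= eqxx/= addrC.
Qed.

Lemma fexpDr m x y : fexp m (x + y) = fexp m x * fexp m y.
Proof.
rewrite /fexp.
have -> : \sum_i intv R m 0 i * (x + y) 0 i =
    \sum_i intv R m 0 i * x 0 i + \sum_i intv R m 0 i * y 0 i.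
  by rewrite -big_split/=; apply: eq_bigr => i _; rewrite !mxE mulrDr.
by rewrite mulrDr cosD sinD; apply/eqP; rewrite eq_complex/= eqxx/= addrC.
Qed.

Lemma fexpNl m x : fexp (- m) x = conjc (fexp m x).
Proof.
rewrite /fexp/=; set S := \sum_i _; set S' := \sum_i _.
have -> : S = - S' by rewrite -sumrN; apply: eq_bigr => i _; rewrite !mxE rmorphN mulNr.
by rewrite mulrN cosN sinN.
Qed.

Lemma fexpNr m x : fexp m (- x) = conjc (fexp m x).
Proof.
rewrite -fexpNl /fexp.
suff -> : \sum_i intv R m 0 i * (- x) 0 i = \sum_i intv R (- m) 0 i * x 0 i by [].
by apply: eq_bigr => i _; rewrite !mxE rmorphN mulNr mulrN.
Qed.

Lemma nc_fexp m x : nc (fexp m x) = 1.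
Proof. by rewrite /fexp/= cos2Dsin2 sqrtr1. Qed.

Lemma fexp_natl m x n : fexp (m *+ n) x = fexp m x ^+ n.
Proof.
elim: n => [|n ih]; first by rewrite mulr0n fexp0.
by rewrite mulrSr fexpDl ih exprSr.
Qed.

Lemma cos_sin_2pi_nat n : cos (2 * pi * n%:R : R) = 1 /\ sin (2 * pi * n%:R : R) = 0.
Proof.
elim: n => [|n [c s]]; first by rewrite mulr0 cos0 sin0.
rewrite -[n.+1%:R]natr1 mulrDr mulr1 cosD sinD c s [2 * pi]mulr_natl cos2pi sin2pi.
by split; ring.
Qed.

Lemma cos_sin_2pi_int (z : int) : cos (2 * pi * z%:~R : R) = 1 /\ sin (2 * pi * z%:~R : R) = 0.
Proof.
case: z => n; first exact: cos_sin_2pi_nat.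
rewrite NegzE rmorphN/= mulrN cosN sinN.
by have [-> ->] := cos_sin_2pi_nat n.+1; rewrite oppr0.
Qed.

Lemma fexp_period m (k : Z) : fexp m (intv R k) = 1.
Proof.
rewrite /fexp; set S := \sum_i _.
have -> : S = (\sum_i m 0 i * k 0 i)%:~R.
  by rewrite rmorph_sum/=; apply: eq_bigr => i _; rewrite !mxE intrM.
by have [-> ->] := cos_sin_2pi_int (\sum_i m 0 i * k 0 i).
Qed.

Lemma Zperiodic_fexp m : Zperiodic (@fexp R d m).
Proof. by move=> x k; rewrite fexpDr fexp_period mulr1. Qed.

Definition unitv (l : 'I_d) : Z := delta_mx 0 l.

Lemma int_row_sum (m : Z) : m = \sum_l unitv l *~ m 0 l.
Proof.
apply/rowP => i; rewrite summxE (bigD1 i)//= big1 ?addr0.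
  rewrite /unitv -scaler_int.
  by rewrite !mxE !eqxx/= mulr1 intz.
move=> j ji; rewrite /unitv -scaler_int !mxE eqxx/= eq_sym (negbTE ji) mulr0//.
Qed.

Lemma nc_fexp_natB1 m n x : nc (fexp (m *+ n) x - 1) <= n%:R * nc (fexp m x - 1).
Proof. by rewrite fexp_natl nc_expB1// nc_fexp. Qed.

Lemma nc_fexpNB1 m x : nc (fexp (- m) x - 1) = nc (fexp m x - 1).
Proof.
by rewrite fexpNl -[LHS]nc_conj conjcB conjcI conjc1.
Qed.

Lemma nc_fexp_intB1 m (z : int) x :
  nc (fexp (m *~ z) x - 1) <= (absz z)%:R * nc (fexp m x - 1).
Proof.
case: z => n; first by rewrite -pmulrn; exact: nc_fexp_natB1.
by rewrite NegzE mulrNz nc_fexpNB1 abszN; exact: nc_fexp_natB1.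
Qed.

(** The size of a displacement as seen by the unit frequencies; it stands for
   the distance of [y] to the integer lattice. *)
Definition disp y : R := \sum_(l < d) nc (fexp (unitv l) y - 1).

Lemma disp_ge0 y : 0 <= disp y.
Proof. by apply: sumr_ge0 => l _; exact: nc_ge0. Qed.

Lemma nc_fexpB1 n m y : m \in cube n -> nc (fexp m y - 1) <= n%:R * disp y.
Proof.
move=> /cubeP mn; rewrite {1}(int_row_sum m) /disp mulr_sumr.
elim/big_ind2 : _ => [|z w z' w' zw zw'|l _].
- by rewrite fexp0 subrr nc0.
- rewrite fexpDl (_ : _ - 1 = fexp w y * (fexp w' y - 1) + (fexp w y - 1)); last by ring.
  rewrite (le_trans (ncD _ _))// ncM nc_fexp mul1r addrC.
  exact: lerD.
- rewrite (le_trans (nc_fexp_intB1 _ _ _))// ler_wpM2r ?nc_ge0//.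
  by rewrite ler_nat mn.
Qed.

Definition tp n a x : C := \sum_(m <- cube n) a m * fexp m x.

Lemma Zperiodic_tp n a : Zperiodic (tp n a).
Proof.
by move=> x k; rewrite /tp; apply: eq_bigr => m _; rewrite Zperiodic_fexp.
Qed.

Lemma tp_le n n' a x : (n <= n')%N -> supp n a -> tp n' a x = tp n a x.
Proof.
move=> nn' an; apply: sum_cube_le => // m mn.
by rewrite an// mul0r.
Qed.

Lemma eq_tp n a b x : a =1 b -> tp n a x = tp n b x.
Proof. by move=> ab; apply: eq_bigr => m _; rewrite ab. Qed.

Lemma tpD n a b x : tp n (fun m => a m + b m) x = tp n a x + tp n b x.
Proof. by rewrite /tp -big_split/=; apply: eq_bigr => m _; rewrite mulrDl. Qed.

Lemma tpB n a b x : tp n (fun m => a m - b m) x = tp n a x - tp n b x.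
Proof.
by rewrite /tp -sumrB; apply: eq_bigr => m _; rewrite mulrBl.
Qed.

Lemma tpZ n (z : C) a x : tp n (fun m => z * a m) x = z * tp n a x.
Proof. by rewrite /tp mulr_sumr; apply: eq_bigr => m _; rewrite mulrA. Qed.

Lemma tp_sum (I : Type) (r : seq I) n (a : I -> Z -> C) x :
  tp n (fun m => \sum_(i <- r) a i m) x = \sum_(i <- r) tp n (a i) x.
Proof.
rewrite /tp exchange_big/=; apply: eq_bigr => m _.
by rewrite mulr_suml.
Qed.

Lemma tp_translate n a x y : tp n a (x + y) = tp n (fun m => a m * fexp m y) x.
Proof. by apply: eq_bigr => m _; rewrite fexpDr mulrA mulrAC. Qed.

Definition cv n a b : Z -> C := fun m => \sum_(k <- cube n) a k * b (m - k).

Lemma cv_supp n1 n2 a b : supp n2 b -> supp (n1 + n2) (cv n1 a b).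
Proof.
move=> bn m mn; rewrite /cv big_seq big1// => k kn; rewrite bn ?mulr0//.
by apply: contra mn => mk; rewrite -(subrK k m) addrC cubeD.
Qed.

Lemma tp_cv n1 n2 a b x : supp n2 b ->
  tp (n1 + n2) (cv n1 a b) x = tp n1 a x * tp n2 b x.
Proof.
move=> bn; rewrite /tp /cv mulr_suml.
under eq_bigr do rewrite mulr_suml.
rewrite exchange_big/= big_seq [RHS]big_seq; apply: eq_bigr => k kn.
have -> : \sum_(m <- cube n2) b m * fexp m x =
    \sum_(m <- cube (n1 + n2)) b (m - k) * fexp (m - k) x.
  apply: (@sum_cube_shift _ _ n1 n2 k (fun m => b m * fexp m x)) => // m mn.
  by rewrite bn// mul0r.
rewrite mulr_sumr; apply: eq_bigr => m _.
have -> : fexp m x = fexp (m - k) x * fexp k x by rewrite -fexpDl subrK.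
ring.
Qed.

Lemma conj_tp n a x : conjc (tp n a x) = tp n (fun m => conjc (a (- m))) x.
Proof.
rewrite /tp conjc_sum -[RHS]sum_cubeN; apply: eq_bigr => m _.
by rewrite conjcM fexpNl opprK.
Qed.

End trigonometric_polynomials.

(** * Averages over finite grids *)

Lemma discriminant_le0 (R : realFieldType) (A B D : R) : 0 <= A ->
  (forall s t, 0 <= s ^+ 2 * A - 2 * s * t * B + t ^+ 2 * D) -> B ^+ 2 <= A * D.
Proof.
move=> A0 quad; have [A00|A00] := eqVneq A 0.
  have [->|B0] := eqVneq B 0; first by rewrite A00 mul0r expr0n.
  have := quad ((D + 1) / B / 2) 1; rewrite A00.
  rewrite (_ : _ + _ = -1); last by field.
  by rewrite lerNr oppr0 ler10.
have {}A0 : 0 < A by rewrite lt_neqAle eq_sym A00.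
have := quad B A; rewrite (_ : _ + _ = A * (A * D - B ^+ 2)); last by ring.
by rewrite pmulr_rge0// subr_ge0.
Qed.

Lemma sum_cauchy_schwarz (R : realType) (I : Type) (r : seq I) (f g : I -> R) :
  (\sum_(i <- r) f i * g i) ^+ 2 <=
    (\sum_(i <- r) f i ^+ 2) * (\sum_(i <- r) g i ^+ 2).
Proof.
set A := \sum_(i <- r) f i ^+ 2; set B := \sum_(i <- r) _ * _.
set D := \sum_(i <- r) g i ^+ 2.
have A0 : 0 <= A by apply: sumr_ge0 => i _; exact: sqr_ge0.
have quad s t : 0 <= s ^+ 2 * A - 2 * s * t * B + t ^+ 2 * D.
  rewrite (_ : _ + _ = \sum_(i <- r) (s * f i - t * g i) ^+ 2).
    by apply: sumr_ge0 => i _; exact: sqr_ge0.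
  rewrite /A /B /D !mulr_sumr -sumrB -big_split/=.
  by apply: eq_bigr => i _; ring.
exact: discriminant_le0.
Qed.

Lemma cos_neq1 (R : realType) (t : R) : 0 < t < 2 * pi -> cos t != 1.
Proof.
move=> /andP[t0 t2]; apply/eqP => c1.
have s0 : 0 < sin (t / 2) by apply: sin_gt0_pi; apply/andP; split; lra.
have := cosD (t / 2) (t / 2); rewrite -splitr c1 -!expr2 cos2sin2.
nra.
Qed.

Section grid.
Context {R : realType} {d : nat} (q : nat).
Local Notation C := R[i].
Local Notation Z := 'rV[int]_d.
Local Notation V := 'rV[R]_d.
Local Notation G := {ffun 'I_d -> 'I_q.+1}.
Implicit Types (m k : Z) (x y : V) (a b : Z -> C) (g h : G).

Definition gpt g : V := \row_i ((g i : nat)%:R / q.+1%:R).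

(** For trigonometric polynomials of frequency at most [q] this average is the
    mean over the torus ([avg_tp]). As a finite sum it needs no integrability,
    and it is invariant under the translations of the grid. *)
Definition avg (K : fieldType) (f : V -> K) : K :=
  #|G|%:R^-1 * \sum_g f (gpt g).

Lemma card_grid_neq0 (K : numFieldType) : #|G|%:R != 0 :> K.
Proof. by rewrite pnatr_eq0 card_ffun !card_ord expn_eq0. Qed.

Lemma eq_avg (K : fieldType) (f f' : V -> K) : f =1 f' -> avg f = avg f'.
Proof. by move=> ff'; congr (_ * _); apply: eq_bigr. Qed.

Lemma avgD (K : fieldType) (f f' : V -> K) :
  avg (fun x => f x + f' x) = avg f + avg f'.
Proof. by rewrite /avg big_split/= mulrDr. Qed.

Lemma avgN (K : fieldType) (f : V -> K) : avg (fun x => - f x) = - avg f.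
Proof. by rewrite /avg sumrN mulrN. Qed.

Lemma avgB (K : fieldType) (f f' : V -> K) :
  avg (fun x => f x - f' x) = avg f - avg f'.
Proof. by rewrite avgD avgN. Qed.

Lemma avgZ (K : fieldType) (f : V -> K) z :
  avg (fun x => z * f x) = z * avg f.
Proof. by rewrite /avg -mulr_sumr mulrCA. Qed.

Lemma avg_sum (K : fieldType) (I : Type) (r : seq I) (f : I -> V -> K) :
  avg (fun x => \sum_(i <- r) f i x) = \sum_(i <- r) avg (f i).
Proof. by rewrite /avg exchange_big mulr_sumr. Qed.

Lemma avg_exchange (K : fieldType) (f : V -> V -> K) :
  avg (fun x => avg (f x)) = avg (fun y => avg (fun x => f x y)).
Proof.
rewrite /avg; congr (_ * _); rewrite -!mulr_sumr; congr (_ * _).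
exact: exchange_big.
Qed.

Lemma avg_ge0 (f : V -> R) : (forall x, 0 <= f x) -> 0 <= avg f.
Proof. by move=> f0; rewrite mulr_ge0 ?invr_ge0 ?sumr_ge0. Qed.

Lemma le_avg (f f' : V -> R) : (forall x, f x <= f' x) -> avg f <= avg f'.
Proof.
by move=> ff'; rewrite ler_wpM2l ?invr_ge0// ler_sum.
Qed.

Lemma nc_avg (f : V -> C) : nc (avg f) <= avg (fun x => nc (f x)).
Proof.
rewrite /avg ncM (_ : nc _ = #|G|%:R^-1).
  by rewrite ler_wpM2l ?invr_ge0// nc_sum.
have -> : (#|G|%:R^-1 : C) = (#|G|%:R^-1)%:C by rewrite fmorphV rmorph_nat.
by rewrite nc_real ger0_norm// invr_ge0.
Qed.

Lemma avg_cst (K : numFieldType) (z : K) : avg (fun=> z) = z.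
Proof.
rewrite /avg sumr_const -[z *+ _]mulr_natl mulrA mulVf ?mul1r//.
exact: card_grid_neq0.
Qed.

Lemma avg_cauchy_schwarz (f g : V -> R) :
  avg (fun x => f x * g x) <=
    Num.sqrt (avg (fun x => f x ^+ 2)) * Num.sqrt (avg (fun x => g x ^+ 2)).
Proof.
rewrite -sqrtrM; last by apply: avg_ge0 => x; exact: sqr_ge0.
rewrite (le_trans (ler_norm _))// -sqrtr_sqr ler_wsqrtr//.
rewrite /avg; set c := _^-1; set S := \sum_g _; set A := \sum_g _; set B := \sum_g _.
rewrite (_ : (c * S) ^+ 2 = c ^+ 2 * S ^+ 2); last by ring.
rewrite (_ : c * A * (c * B) = c ^+ 2 * (A * B)); last by ring.
rewrite ler_wpM2l ?sqr_ge0//; exact: sum_cauchy_schwarz.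
Qed.

(** Subtraction of grid points is modular; the multiple of [q.+1] that it
    discards is an integer translation, invisible to periodic functions. *)
Lemma Zp_sub_rep (a b : 'I_q.+1) : exists z : int,
  ((a - b)%R : nat)%:Z = (a : nat)%:Z - (b : nat)%:Z + z * q.+1%:Z.
Proof.
have e1 := divn_eq (q.+1 - b) q.+1.
have e2 := divn_eq (a + (q.+1 - b) %% q.+1) q.+1.
rewrite [X in Posz X](_ : _ = (a + (q.+1 - b) %% q.+1) %% q.+1)%N//.
exists (1 - ((q.+1 - b) %/ q.+1)%N%:Z - ((a + (q.+1 - b) %% q.+1) %/ q.+1)%N%:Z).
move: e1 e2; set u := ((q.+1 - b) %/ q.+1)%N; set v := ((q.+1 - b) %% q.+1)%N.
set w := ((a + v) %/ q.+1)%N; set t := ((a + v) %% q.+1)%N.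
have := ltn_ord b; move: (a : nat) (b : nat) => a' b' bq e1 e2.
nia.
Qed.

Lemma gpt_sub g h : exists k, gpt [ffun i => (g i - h i)%R] = gpt g - gpt h + intv R k.
Proof.
exists (\row_i projT1 (cid (Zp_sub_rep (g i) (h i)))).
apply/rowP => i; rewrite !mxE ffunE; case: cid => z e; rewrite [projT1 _]/=.
have -> : ((g i - h i)%R : nat)%:R = (g i)%:R - (h i)%:R + z%:~R * q.+1%:R :> R.
  by rewrite [LHS](congr1 (fun z : int => z%:~R : R) e) rmorphD rmorphB rmorphM.
by rewrite mulrDl mulrBl mulfK// pnatr_eq0.
Qed.

Lemma avg_translate (K : fieldType) (f : V -> K) h : Zperiodic f ->
  avg (fun x => f (x - gpt h)) = avg f.
Proof.
move=> pf; congr (_ * _); rewrite [RHS](reindex (fun g => [ffun i => (g i - h i)%R])).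
  apply: eq_bigr => g _; have [k ->] := gpt_sub g h.
  by rewrite pf.
apply: onW_bij; apply: injF_bij => g g' /ffunP gg'; apply/ffunP => i.
by have := gg' i; rewrite !ffunE => /addIr.
Qed.

Lemma gpt_opp g : exists k, gpt [ffun i => (- g i)%R] = - gpt g + intv R k.
Proof.
have [k] := gpt_sub [ffun=> 0] g; rewrite (_ : gpt [ffun=> 0] = 0).
  by move=> e; exists k; rewrite sub0r in e; rewrite -e; congr gpt; apply/ffunP => i; rewrite !ffunE sub0r.
by apply/rowP => i; rewrite !mxE ffunE mul0r.
Qed.

Lemma avg_opp (K : fieldType) (f : V -> K) : Zperiodic f ->
  avg (fun x => f (- x)) = avg f.
Proof.
move=> pf; congr (_ * _); rewrite [RHS](reindex (fun g => [ffun i => (- g i)%R])).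
  apply: eq_bigr => g _; have [k ->] := gpt_opp g.
  by rewrite pf.
apply: onW_bij; apply: injF_bij => g g' /ffunP gg'; apply/ffunP => i.
by have := gg' i; rewrite !ffunE => /oppr_inj.
Qed.

(** Translation by one step of the grid in a direction where [m] is nonzero
    multiplies the average by a root of unity other than 1. *)
Lemma avg_fexp m : m \in cube q -> avg (fexp m) = (m == 0)%:R :> C.
Proof.
move=> /cubeP mq; have [->|m0] := eqVneq m 0.
  by rewrite (eq_avg (@fexp0 R d)) avg_cst.
have [i mi] : exists i, m ord0 i != 0.
  apply/existsP; apply: contraNT m0; rewrite negb_exists => /forallP m0.
  apply/eqP/rowP => i; rewrite mxE; apply/eqP; have := m0 i.
  by rewrite negbK.
have q0 : (1 < q.+1)%N.
  by have := mq i; move: (m ord0 i) mi => z; case: (q) => [|//]; lia.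
pose h : G := [ffun j => if j == i then Ordinal q0 else ord0].
have pm := @Zperiodic_fexp R d m.
have := avg_translate h pm.
rewrite (eq_avg (f' := fun x => fexp m (- gpt h) * fexp m x)); last first.
  by move=> x; rewrite fexpDr mulrC.
rewrite avgZ => /eqP; rewrite -subr_eq0 -{2}(mul1r (avg _)) -mulrBl mulf_eq0.
move=> /orP[|/eqP->//]; rewrite subr_eq0 fexpNr => /eqP/(congr1 (@complex.Re R)).
rewrite /fexp/=; set t := 2 * pi * _ => ct; exfalso.
have te : t = 2 * pi * ((m ord0 i)%:~R / q.+1%:R).
  rewrite /t (bigD1 i)//= big1 ?addr0; last first.
    by move=> j /negbTE ji; rewrite !mxE ffunE ji mul0r mulr0.
  by rewrite !mxE ffunE eqxx/= mul1r.
have pi0 := @pi_gt0 R.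
have Q0 : (0 : R) < q.+1%:R by rewrite ltr0n.
have ct' : cos `|t| = 1 by have [|] := ger0P t; rewrite ?cosN.
suff ht : 0 < `|t| < 2 * pi by move: (cos_neq1 ht); rewrite ct' eqxx.
rewrite te normrM (ger0_norm (_ : 0 <= 2 * pi)); last by lra.
rewrite normf_div (ger0_norm (ltW Q0)) -intr_norm.
rewrite -[X in _ < _ < X]mulr1 ltr_pM2l; last by lra.
rewrite ltr_pdivrMr// mul1r pmulr_rgt0; last by lra.
rewrite divr_gt0//=; last by rewrite ltr0z normr_gt0.
by rewrite -[q.+1%:R]/(q.+1%:Z%:~R) ltr_int; have := mq i; move: (m ord0 i) => z; lia.
Qed.

Lemma avg_tp n a : (n <= q)%N -> avg (tp n a) = a 0.
Proof.
move=> nq; rewrite /tp avg_sum big_seq.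
rewrite (eq_bigr (fun m => a m * (m == 0)%:R)); last first.
  by move=> m mn; rewrite avgZ avg_fexp// (cube_le nq).
rewrite -big_seq (bigD1_seq 0) ?cube0 ?uniq_cube//= eqxx mulr1 big1 ?addr0//.
by move=> m /negbTE->; rewrite mulr0.
Qed.

Lemma avg_mul_supp n n' a b : (n + n' <= q)%N -> supp n' b ->
  avg (fun x => tp n a x * tp n' b x) = \sum_(m <- cube n) a m * b (- m).
Proof.
move=> nq bn; rewrite (eq_avg (f' := tp (n + n') (cv n a b))) => [|x]; last by rewrite tp_cv.
by rewrite avg_tp//; apply: eq_bigr => m _; rewrite sub0r.
Qed.

Lemma avg_parseval n a : (n.*2 <= q)%N ->
  avg (fun x => nc (tp n a x) ^+ 2) = \sum_(m <- cube n) nc (a m) ^+ 2.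
Proof.
move=> nq; apply: complexI; pose b m := if m \in cube n then a m else 0.
have ab x : tp n a x = tp n b x.
  by rewrite /tp big_seq [RHS]big_seq; apply: eq_bigr => m mn; rewrite /b mn.
transitivity (avg (fun x => tp n a x * tp n (fun m => conjc (b (- m))) x)).
  rewrite /avg rmorphM/= fmorphV/= rmorph_nat rmorph_sum/=; congr (_ * _).
  apply: eq_bigr => g _; rewrite -conj_tp -ab mul_conj//.
rewrite avg_mul_supp ?addnn// => [|m mn]; last by rewrite /b cubeN (negbTE mn) conjc0.
rewrite rmorph_sum/= big_seq [RHS]big_seq; apply: eq_bigr => m mn.
by rewrite /b opprK mn mul_conj.
Qed.

(** Averaging in [y] pairs each frequency of the kernel with the same frequency
    of the function, so that convolution on the grid is a Fourier multiplier. *)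
Lemma avg_conv n n' (s : Z -> C) a x : (n + n' <= q)%N -> supp n s ->
  avg (fun y => tp n s y * tp n' a (x - y)) = tp n' (fun m => s m * a m) x.
Proof.
move=> nq sn.
have e y : tp n' a (x - y) = tp n' (fun m => a (- m) * fexp (- m) x) y.
  rewrite /tp -[RHS]sum_cubeN; apply: eq_bigr => m _.
  by rewrite fexpDr fexpNr -fexpNl opprK mulrA.
rewrite (eq_avg (f' := fun y => tp n' (fun m => a (- m) * fexp (- m) x) y * tp n s y)); last first.
  by move=> y; rewrite mulrC e.
rewrite avg_mul_supp 1?addnC// /tp -[RHS]sum_cubeN; apply: eq_bigr => m _.
ring.
Qed.

End grid.

(** * Fourier multipliers and their symbols *)

Section l2_norm.
Context {R : realType} {d : nat}.
Local Notation C := R[i].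
Local Notation Z := 'rV[int]_d.
Local Notation V := 'rV[R]_d.
Implicit Types (m k : Z) (x y : V) (a b f : Z -> C).

Definition l2 n a : R := Num.sqrt (\sum_(m <- cube n) nc (a m) ^+ 2).

Lemma l2_ge0 n a : 0 <= l2 n a. Proof. exact: sqrtr_ge0. Qed.

Lemma avg_sqrt_tp q n a : (n.*2 <= q)%N ->
  Num.sqrt (avg q (fun x => nc (tp n a x) ^+ 2)) = l2 n a.
Proof. by move=> nq; rewrite avg_parseval. Qed.

Lemma avg_tp_mul_le q n n' a b : (n.*2 <= q)%N -> (n'.*2 <= q)%N ->
  avg q (fun x => nc (tp n a x) * nc (tp n' b x)) <= l2 n a * l2 n' b.
Proof.
move=> nq n'q; rewrite (le_trans (avg_cauchy_schwarz _ _ _))//.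
by rewrite !avg_sqrt_tp.
Qed.

(** The kernel of the multiplier [cv n a b] is the product of the kernels of
    [a] and [b], so its [L^1] norm is controlled by Cauchy-Schwarz and Parseval;
    this is how every operator norm on [L^oo] is bounded. *)
Lemma nc_multiplier_le n n' N a b f (B : R) x : supp n' b ->
  (forall x, nc (tp N f x) <= B) ->
  nc (tp N (fun m => cv n a b m * f m) x) <= l2 n a * l2 n' b * B.
Proof.
move=> bn fB; have B0 : 0 <= B := le_trans (nc_ge0 _) (fB 0).
have [q qE] : exists q, q = (n.*2 + n'.*2 + N)%N by eexists.
rewrite -(@avg_conv _ _ q (n + n')); last first.
- exact: cv_supp.
- by rewrite qE -!addnn; lia.
rewrite (le_trans (nc_avg _ _))//.
rewrite (@le_trans _ _ (avg q (fun y => B * (nc (tp n a y) * nc (tp n' b y)))))//.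
  apply: le_avg => y; rewrite tp_cv// !ncM mulrC.
  by rewrite ler_wpM2r// mulr_ge0 ?nc_ge0.
rewrite avgZ mulrC ler_wpM2r// avg_tp_mul_le// qE -!addnn; lia.
Qed.

End l2_norm.

Section symbols.
Context {R : realType} {d : nat}.
Local Notation C := R[i].
Local Notation Z := 'rV[int]_d.
Local Notation V := 'rV[R]_d.
Implicit Types (m k : Z) (x y : V) (a b f : Z -> C).

Definition dsym (j : 'I_d) m : C := Complex 0 (2 * pi * (m ord0 j)%:~R).

Lemma dsymD j m k : dsym j (m + k) = dsym j m + dsym j k.
Proof.
by apply/eqP; rewrite eq_complex/= addr0 eqxx/= mxE intrD mulrDr.
Qed.

Lemma dsymN j m : dsym j (- m) = - dsym j m.
Proof.
by apply/eqP; rewrite eq_complex/= oppr0 eqxx/= mxE rmorphN mulrN.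
Qed.

Lemma nc_dsym j m n : m \in cube n -> nc (dsym j m) <= 2 * pi * n%:R.
Proof.
move=> /cubeP mn; rewrite /dsym/= expr0n/= add0r sqrtr_sqr normrM.
rewrite ger0_norm; last by rewrite mulr_ge0// pi_ge0.
rewrite ler_wpM2l ?mulr_ge0 ?pi_ge0//.
by rewrite -intr_norm -[n%:R]/(n%:Z%:~R) ler_int; exact: mn.
Qed.

(** The product rule, read on the coefficients of the two factors. *)
Lemma cv_dsym j n a b m :
  dsym j m * cv n a b m =
    cv n (fun m => dsym j m * a m) b m + cv n a (fun m => dsym j m * b m) m.
Proof.
rewrite /cv mulr_sumr -big_split/=; apply: eq_bigr => k _.
have -> : dsym j m = dsym j k + dsym j (m - k) by rewrite -dsymD addrC subrK.
ring.
Qed.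

Lemma cv_fexpB1 y n a b m :
  (fexp m y - 1) * cv n a b m =
    cv n (fun m => (fexp m y - 1) * a m) b m +
    cv n (fun m => fexp m y * a m) (fun m => (fexp m y - 1) * b m) m.
Proof.
rewrite /cv mulr_sumr -big_split/=; apply: eq_bigr => k _.
have -> : fexp m y = fexp k y * fexp (m - k) y by rewrite -fexpDl addrC subrK.
ring.
Qed.

Lemma tp_sub_translate n a x y :
  tp n a (x + y) - tp n a x = tp n (fun m => (fexp m y - 1) * a m) x.
Proof.
rewrite tp_translate -tpB; apply: eq_tp => m; ring.
Qed.

Lemma cube_unitv l : @unitv d l \in cube 1.
Proof.
apply/cubeP => i; rewrite mxE eqxx/=.
by case: eqP.
Qed.

(** Differencing coefficients that vary at scale [n] gains a factor [n]: this
    converts a displacement of [x] into a gain on the kernels. *)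
Lemma fexpB1_tp l n a x : supp n a ->
  (fexp (unitv l) x - 1) * tp n a x =
    tp n.+1 (fun m => a (m - unitv l) - a m) x.
Proof.
move=> an; rewrite mulrBl mul1r tpB (tp_le _ (leqnSn n) an); congr (_ - _).
have an' : supp n (fun m => a m * fexp m x) by move=> m /an->; rewrite mul0r.
rewrite /tp (sum_cube_shift (cube_unitv l) an') add1n mulr_sumr.
apply: eq_bigr => m _.
have -> : fexp m x = fexp (unitv l) x * fexp (m - unitv l) x by rewrite -fexpDl addrC subrK.
ring.
Qed.

End symbols.

(** * The frequency cutoff *)

Section cutoff.
Context {R : realType} {d : nat}.
Local Notation C := R[i].
Local Notation Z := 'rV[int]_d.
Local Notation V := 'rV[R]_d.
Implicit Types (m k : Z) (x y : V) (f : Z -> C) (n : nat).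

Definition maxabs m : nat := \max_(i < d) absz (m ord0 i).

Lemma maxabs_le n m : (maxabs m <= n)%N = (m \in cube n).
Proof.
apply/bigmax_leqP/cubeP => mn i; first exact: mn.
by move=> _; exact: mn.
Qed.

Lemma maxabsN m : maxabs (- m) = maxabs m.
Proof. by apply: eq_bigr => i _; rewrite mxE abszN. Qed.

Lemma maxabs_unitv m l : `|(maxabs (m - unitv l))%:R - (maxabs m)%:R| <= 1 :> R.
Proof.
have h k k' : k - k' \in cube 1 -> (maxabs k <= (maxabs k').+1)%N.
  move=> kk'; rewrite maxabs_le -(addn1 (maxabs k')) -[k](subrK k') addrC cubeD//.
  by rewrite -maxabs_le.
have h1 : (maxabs (m - unitv l) <= (maxabs m).+1)%N.
  by apply: h; rewrite addrAC subrr sub0r cubeN cube_unitv.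
have h2 : (maxabs m <= (maxabs (m - unitv l)).+1)%N.
  by apply: h; rewrite subKr cube_unitv.
move: h1 h2; move: (maxabs _) (maxabs _) => s t; rewrite -(ler_nat R) -(ler_nat R s).
rewrite -!natr1 ler_norml => h1 h2; apply/andP; split; lra.
Qed.

Definition plateau n m : R :=
  Num.max 0 (Num.min 1 (3 - (maxabs m)%:R / n%:R)).

Definition tent n m : R := Num.max 0 (1 - (maxabs m)%:R / n%:R).

Definition tent_mass n : R := \sum_(m <- cube n) tent n m.

Definition mollifier n m : R := tent n m / tent_mass n.

(** The symbol of the smooth frequency cutoff: the average of a plateau against
    the mollifier, both at scale [n]. The convolution structure is what makes its
    kernel a product. *)
Definition theta n m : R := \sum_(k <- cube (3 * n)) plateau n k * mollifier n (m - k).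

(** The same symbol as a convolution of complex coefficients, the form to which
    [nc_multiplier_le] applies. *)
Definition thetaC n : Z -> C :=
  cv (3 * n) (fun m => (plateau n m)%:C) (fun m => (mollifier n m)%:C).

Lemma thetaCE n m : thetaC n m = (theta n m)%:C.
Proof.
rewrite /thetaC /cv /theta realc_sum; apply: eq_bigr => k _.
by rewrite realcM.
Qed.

Section fixed_scale.
Variables (n : nat).
Hypothesis n0 : (0 < n)%N.

Let n0R : 0 < n%:R :> R. Proof. by rewrite ltr0n. Qed.

Lemma plateau_ge0 m : 0 <= plateau n m.
Proof. by rewrite le_max lexx. Qed.

Lemma plateau_le1 m : plateau n m <= 1.
Proof. by rewrite ge_max ler01 ge_min lexx. Qed.

Lemma plateau1 m : m \in cube (2 * n) -> plateau n m = 1.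
Proof.
rewrite -maxabs_le -(ler_nat R) natrM => mn; rewrite /plateau min_l ?max_r//.
rewrite lerBrDr -lerBrDl ler_pdivrMr//; nra.
Qed.

Lemma supp_plateau : supp (3 * n) (plateau n).
Proof.
move=> m; rewrite -maxabs_le -ltnNge -(ltr_nat R) natrM => mn.
rewrite /plateau max_l// ge_min; apply/orP; right.
by rewrite subr_le0 ler_pdivlMr// ltW.
Qed.

Lemma tent_ge0 m : 0 <= tent n m.
Proof. by rewrite le_max lexx. Qed.

Lemma tent_le1 m : tent n m <= 1.
Proof. by rewrite ge_max ler01/= gerBl divr_ge0. Qed.

Lemma supp_tent : supp n (tent n).
Proof.
move=> m; rewrite -maxabs_le -ltnNge -(ltr_nat R) => mn.
by rewrite /tent max_l// subr_le0 ler_pdivlMr// mul1r ltW.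
Qed.

Lemma lip_max0 (s t : R) : `|Num.max 0 s - Num.max 0 t| <= `|s - t|.
Proof.
by rewrite !maxEle; case: ifPn => s0; case: ifPn => t0; move: s0 t0;
  rewrite ?ler_norml -?ltNge => s0 t0; have := ger0_norm; case: (ger0P (s - t)) => *;
  apply/andP; split; lra.
Qed.

Lemma lip_min1 (s t : R) : `|Num.min 1 s - Num.min 1 t| <= `|s - t|.
Proof.
by rewrite !minEle; case: ifPn => s0; case: ifPn => t0; move: s0 t0;
  rewrite ?ler_norml -?ltNge => s0 t0; case: (ger0P (s - t)) => *;
  apply/andP; split; lra.
Qed.

Lemma lip_maxabs m l :
  `|(maxabs (m - unitv l))%:R / n%:R - (maxabs m)%:R / n%:R| <= n%:R^-1 :> R.
Proof.
rewrite -mulrBl normrM (ger0_norm (_ : 0 <= n%:R^-1)) ?invr_ge0//.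
by rewrite ler_piMl ?invr_ge0// maxabs_unitv.
Qed.

Lemma plateau_lip m l : `|plateau n (m - unitv l) - plateau n m| <= n%:R^-1.
Proof.
rewrite (le_trans (lip_max0 _ _))// (le_trans (lip_min1 _ _))//.
have e (c s t : R) : (c - s) - (c - t) = t - s by ring.
by rewrite e distrC lip_maxabs.
Qed.

Lemma tent_lip m l : `|tent n (m - unitv l) - tent n m| <= n%:R^-1.
Proof.
rewrite (le_trans (lip_max0 _ _))//.
have e (c s t : R) : (c - s) - (c - t) = t - s by ring.
by rewrite e distrC lip_maxabs.
Qed.

(** The tent is at least 1/2 on the cube of half its size. *)
Lemma tent_mass_ge : n%:R ^+ d / 2 <= tent_mass n.
Proof.
have [h [hn nh]] : exists h, (h.*2 <= n)%N /\ (n <= h.*2.+1)%N.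
  by exists n./2; have := odd_double_half n; case: odd => /= e; lia.
rewrite /tent_mass.
rewrite (@le_trans _ _ (\sum_(m <- (cube h : seq Z)) (1 / 2 : R)))//.
  rewrite big_const_seq count_predT size_cube iter_addr_0 -[leRHS]mulr_natl natrX div1r.
  rewrite ler_wpM2r ?invr_ge0// lerXn2r// ?nnegrE ?ler0n//.
  by rewrite ler_nat.
rewrite (@le_trans _ _ (\sum_(m <- cube h) tent n m))//.
  rewrite big_seq [leRHS]big_seq; apply: ler_sum => m.
  rewrite -maxabs_le -(ler_nat R) => mn; rewrite /tent le_max; apply/orP; right.
  rewrite lerBrDl -lerBrDr ler_pdivrMr//.
  have : (h.*2)%:R <= n%:R :> R by rewrite ler_nat.
  by rewrite -muln2 natrM => ?; lra.
rewrite (_ : \sum_(m <- cube h) tent n m = \sum_(m <- cube n | m \in cube h) tent n m).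
  by rewrite [leRHS](bigID [in cube h])/= lerDl sumr_ge0// => m _; exact: tent_ge0.
rewrite -[RHS]big_filter; apply: perm_big; apply: uniq_perm; rewrite ?filter_uniq ?uniq_cube//.
move=> m; rewrite mem_filter andb_idr//; apply: cube_le.
by rewrite (leq_trans _ hn)// -addnn leq_addr.
Qed.

Lemma tent_mass_gt0 : 0 < tent_mass n.
Proof. by rewrite (lt_le_trans _ tent_mass_ge)// divr_gt0// exprn_gt0. Qed.

Lemma mollifier_ge0 m : 0 <= mollifier n m.
Proof. by rewrite divr_ge0// ?tent_ge0// ltW// tent_mass_gt0. Qed.

Lemma supp_mollifier : supp n (mollifier n).
Proof. by move=> m mn; rewrite /mollifier supp_tent// mul0r. Qed.

Lemma mollifierN m : mollifier n (- m) = mollifier n m.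
Proof. by rewrite /mollifier /tent maxabsN. Qed.

Lemma sum_mollifier : \sum_(m <- cube n) mollifier n m = 1.
Proof. by rewrite -mulr_suml divff// gt_eqF// tent_mass_gt0. Qed.

Lemma sum_bump_le k N : \sum_(m <- cube N) mollifier n (k - m) <= 1.
Proof.
have [p kp] := cube_exists k.
rewrite -sum_mollifier; pose M := (p + n + N)%N.
have -> : \sum_(m <- cube n) mollifier n m = \sum_(m <- cube (p + M)) mollifier n (m - k).
  rewrite -(sum_cube_shift kp) => [|m mM]; last first.
    by apply: supp_mollifier; apply: contra mM; apply: cube_le; rewrite /M; lia.
  by rewrite (sum_cube_le _ supp_mollifier)// /M; lia.
rewrite (_ : \sum_(m <- cube N) _ = \sum_(m <- cube (p + M) | m \in cube N) mollifier n (m - k)).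
  by rewrite [leRHS](bigID [in cube N])/= lerDl sumr_ge0// => m _; exact: mollifier_ge0.
rewrite -[RHS]big_filter (eq_bigr (fun m => mollifier n (m - k))); last first.
  by move=> m _; rewrite -mollifierN opprB.
apply: perm_big; apply: uniq_perm; rewrite ?filter_uniq ?uniq_cube//.
move=> m; rewrite mem_filter andb_idr//; apply: cube_le; rewrite /M; lia.
Qed.

Lemma theta_ge0 m : 0 <= theta n m.
Proof. by apply: sumr_ge0 => k _; rewrite mulr_ge0 ?plateau_ge0 ?mollifier_ge0. Qed.

Lemma theta_le1 m : theta n m <= 1.
Proof.
rewrite (le_trans _ (sum_bump_le m (3 * n)))//; apply: ler_sum => k _.
by rewrite ler_piMl ?mollifier_ge0 ?plateau_le1.
Qed.

Lemma theta1 m : m \in cube n -> theta n m = 1.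
Proof.
move=> mn; rewrite /theta.
rewrite (eq_big_seq (fun k => mollifier n (k - m))) => [|k k3]; last first.
  rewrite -mollifierN opprB; have [kn|kn] := boolP (k - m \in cube n).
    rewrite plateau1 ?mul1r// (_ : (2 * n = n + n)%N); last lia.
    by rewrite -(subrK m k) cubeD.
  by rewrite supp_mollifier// mulr0.
rewrite -sum_mollifier (_ : (3 * n = n + 2 * n)%N); last lia.
rewrite -(sum_cube_shift mn) => [|k kn]; last first.
  by apply: supp_mollifier; apply: contra kn; apply: cube_le; lia.
by rewrite (sum_cube_le _ supp_mollifier)//; lia.
Qed.

Lemma supp_theta : supp (4 * n) (theta n).
Proof.
move=> m mn; rewrite /theta big_seq big1// => k kn.
rewrite supp_mollifier ?mulr0//; apply: contra mn => mk.
have -> : (4 * n = n + 3 * n)%N by lia.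
by rewrite -[m](subrK k); exact: cubeD.
Qed.

Lemma thetaN m : theta n (- m) = theta n m.
Proof.
rewrite /theta -[RHS]sum_cubeN; apply: eq_bigr => k _.
by rewrite /plateau maxabsN -(mollifierN (- m - k)) opprD opprK.
Qed.

End fixed_scale.
End cutoff.

(** * Kernel estimates *)

Section kernel_bounds.
Context {R : realType} {d : nat}.
Local Notation C := R[i].
Local Notation Z := 'rV[int]_d.
Local Notation V := 'rV[R]_d.
Implicit Types (m k : Z) (x y : V) (a b f : Z -> C).

(** Bounds the [L^1] norm of the cutoff kernel at every scale. The supports lie
    in cubes of at most [(9 * n) ^ d] points, and the factor 2 is that of
    [tent_mass_ge]. *)
Definition kcst : R := 2 * 9 ^+ d.

Lemma kcst_ge0 : 0 <= kcst.
Proof. by rewrite mulr_ge0// exprn_ge0. Qed.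

Section fixed_scale.
Variable n : nat.
Hypothesis n0 : (0 < n)%N.

Let n0R : 0 < n%:R :> R. Proof. by rewrite ltr0n. Qed.
Let pi0 : 0 < pi :> R. Proof. exact: pi_gt0. Qed.

Let wt : R := Num.sqrt ((9 * n)%:R ^+ d).
Let mass := @tent_mass R d n.
Let A := fun m : Z => (plateau n m)%:C : C.
Let B := fun m : Z => (mollifier n m)%:C : C.

Let wt0 : 0 <= wt. Proof. exact: sqrtr_ge0. Qed.
Let mass0 : 0 < mass. Proof. exact: tent_mass_gt0. Qed.

Let suppA : supp (3 * n) A.
Proof. by move=> m /(supp_plateau n0) mn; rewrite /A mn. Qed.

Let suppB : supp n B.
Proof. by move=> m /(supp_mollifier n0) mn; rewrite /B mn. Qed.

Let l2_le N a (t : R) : 0 <= t -> (N <= 4 * n)%N ->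
  (forall m, m \in cube N -> nc (a m) <= t) -> l2 N a <= t * wt.
Proof.
move=> t0 Nn at_; rewrite /l2 -(ger0_norm t0) -sqrtr_sqr -sqrtrM ?sqr_ge0//.
apply: ler_wsqrtr; rewrite big_seq.
rewrite (@le_trans _ _ (\sum_(m <- cube N | m \in (cube N : seq Z)) t ^+ 2))//.
  by apply: ler_sum => m /at_ h; apply: lerXn2r; rewrite ?nnegrE ?nc_ge0.
rewrite -big_seq big_const_seq count_predT size_cube iter_addr_0 -[leLHS]mulr_natr.
rewrite natrX ler_wpM2l ?sqr_ge0// lerXn2r ?nnegrE ?ler0n//.
rewrite ler_nat -addnn; lia.
Qed.

Let wt_mass : wt * (wt / mass) <= kcst.
Proof.
rewrite mulrA -expr2 sqr_sqrtr ?exprn_ge0// ler_pdivrMr//.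
rewrite (@le_trans _ _ (kcst * (n%:R ^+ d / 2)))//.
  by rewrite natrM exprMn /kcst; lra.
by rewrite ler_wpM2l ?kcst_ge0// tent_mass_ge.
Qed.

Let l2_mul a b (s t : R) (N N' : nat) : 0 <= s -> 0 <= t ->
  (N <= 4 * n)%N -> (N' <= 4 * n)%N ->
  (forall m, m \in cube N -> nc (a m) <= s) ->
  (forall m, m \in cube N' -> nc (b m) <= t / mass) ->
  l2 N a * l2 N' b <= s * t * kcst.
Proof.
move=> s0 t0 Nn Nn' sa tb.
have h1 := l2_le s0 Nn sa; have h2 := l2_le (divr_ge0 t0 (ltW mass0)) Nn' tb.
rewrite (le_trans (ler_pM (l2_ge0 _ _) (l2_ge0 _ _) h1 h2))//.
rewrite [leLHS](_ : _ = s * t * (wt * (wt / mass))); last by field; rewrite gt_eqF.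
by rewrite ler_wpM2l// mulr_ge0.
Qed.

Let ncA m : nc (A m) <= 1.
Proof. by rewrite nc_real ger0_norm ?plateau_le1 ?plateau_ge0. Qed.

Let ncB m : nc (B m) <= 1 / mass.
Proof.
rewrite nc_real ger0_norm ?mollifier_ge0//.
by rewrite ler_wpM2r ?invr_ge0 ?(ltW mass0)// tent_le1.
Qed.

Let nle3 : (3 * n <= 4 * n)%N. Proof. lia. Qed.
Let nle1 : (n <= 4 * n)%N. Proof. lia. Qed.
Let nle3S : ((3 * n).+1 <= 4 * n)%N. Proof. lia. Qed.
Let nle1S : (n.+1 <= 4 * n)%N. Proof. lia. Qed.

Lemma l2_plateau_mollifier :
  l2 (3 * n) (fun m => (plateau n m)%:C : C) * l2 n (fun m => (mollifier n m)%:C : C) <= kcst.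
Proof.
have := l2_mul ler01 ler01 nle3 nle1 (fun m _ => ncA m) (fun m _ => ncB m).
by rewrite !mul1r.
Qed.

Lemma thetaC_sup_le N f (M : R) x : (forall x, nc (tp N f x) <= M) ->
  nc (tp N (fun m => thetaC n m * f m) x) <= kcst * M.
Proof.
move=> fM; rewrite (le_trans (nc_multiplier_le _ _ _ suppB fM))//.
rewrite ler_wpM2r ?(le_trans (nc_ge0 _) (fM 0))//.
exact: l2_plateau_mollifier.
Qed.

(** A derivative falls on one of the two factors of the kernel, both of
    frequency [O(n)]. *)
Lemma dsym_thetaC_sup_le j N f (M : R) x : (forall x, nc (tp N f x) <= M) ->
  nc (tp N (fun m => dsym j m * (thetaC n m * f m)) x) <= 8 * pi * kcst * n%:R * M.
Proof.
move=> fM; have M0 : 0 <= M := le_trans (nc_ge0 _) (fM 0).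
rewrite (eq_tp N _ (b := fun m => cv (3 * n) (fun m => dsym j m * A m) B m * f m +
   cv (3 * n) A (fun m => dsym j m * B m) m * f m)); last first.
  by move=> m; rewrite mulrA cv_dsym mulrDl.
rewrite tpD (le_trans (ncD _ _))//.
have suppB' : supp n (fun m => dsym j m * B m).
  by move=> m /suppB->; rewrite mulr0.
have h1 := nc_multiplier_le (3 * n) (fun m => dsym j m * A m) x suppB fM.
have h2 := nc_multiplier_le (3 * n) A x suppB' fM.
rewrite (le_trans (lerD h1 h2))// -mulrDl ler_wpM2r//.
have p0 : 0 <= 2 * pi * (3 * n)%:R :> R by rewrite !mulr_ge0// ltW.
have p1 : 0 <= 2 * pi * n%:R :> R by rewrite !mulr_ge0// ltW.
rewrite (@le_trans _ _ (2 * pi * (3 * n)%:R * 1 * kcst + 1 * (2 * pi * n%:R) * kcst))//.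
  apply: lerD; apply: l2_mul => //.
    move=> m mn; rewrite ncM -[leRHS]mulr1 ler_pM ?nc_ge0//.
    exact: nc_dsym.
  move=> m mn; rewrite ncM ler_pM ?nc_ge0//.
    exact: nc_dsym.
  by rewrite -div1r.
rewrite natrM; lra.
Qed.

(** A difference splits over the two factors of the kernel exactly as the
    derivative does in [dsym_thetaC_sup_le]. *)
Lemma thetaC_lipschitz N f (M : R) x y : (forall x, nc (tp N f x) <= M) ->
  nc (tp N (fun m => thetaC n m * f m) (x + y) -
      tp N (fun m => thetaC n m * f m) x) <= 4 * kcst * n%:R * M * disp y.
Proof.
move=> fM; have M0 : 0 <= M := le_trans (nc_ge0 _) (fM 0).
rewrite tp_sub_translate.
rewrite (eq_tp N _ (b := fun m => cv (3 * n) (fun m => (fexp m y - 1) * A m) B m * f m +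
   cv (3 * n) (fun m => fexp m y * A m) (fun m => (fexp m y - 1) * B m) m * f m)); last first.
  by move=> m; rewrite mulrA cv_fexpB1 mulrDl.
rewrite tpD (le_trans (ncD _ _))//.
have suppB' : supp n (fun m => (fexp m y - 1) * B m).
  by move=> m /suppB->; rewrite mulr0.
have h1 := nc_multiplier_le (3 * n) (fun m => (fexp m y - 1) * A m) x suppB fM.
have h2 := nc_multiplier_le (3 * n) (fun m => fexp m y * A m) x suppB' fM.
rewrite (le_trans (lerD h1 h2))// -mulrDl [leRHS]mulrAC ler_wpM2r//.
have D0 := @disp_ge0 R d y.
rewrite (@le_trans _ _ ((3 * n)%:R * disp y * 1 * kcst + 1 * (n%:R * disp y) * kcst))//.
  apply: lerD; apply: l2_mul => //; rewrite ?mulr_ge0//.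
  - move=> m mn; rewrite ncM -[leRHS]mulr1 ler_pM ?nc_ge0//.
    exact: nc_fexpB1.
  - by move=> m mn; rewrite ncM nc_fexp mul1r.
  - move=> m mn; rewrite ncM ler_pM ?nc_ge0//.
      exact: nc_fexpB1.
    by rewrite -div1r.
rewrite natrM; lra.
Qed.

Definition dkernel j : V -> C := tp (4 * n) (fun m => dsym j m * thetaC n m).

Lemma dkernelE j y : dkernel j y =
  tp (3 * n) (fun m => dsym j m * A m) y * tp n B y +
  tp (3 * n) A y * tp n (fun m => dsym j m * B m) y.
Proof.
have suppB' : supp n (fun m => dsym j m * B m).
  by move=> m /suppB->; rewrite mulr0.
rewrite -!tp_cv// -tpD /dkernel.
have -> : (4 * n = 3 * n + n)%N by lia.
by apply: eq_tp => m; rewrite cv_dsym.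
Qed.

(** The first absolute moment of the differentiated kernel is bounded
    uniformly in the scale: the derivative costs a factor [n] and the
    displacement gains one, provided that they fall on different factors of
    the kernel. *)
Lemma dkernel_moment j q : (8 * n <= q)%N ->
  avg q (fun y => nc (dkernel j y) * disp y) <= d%:R * (8 * pi * kcst).
Proof.
move=> nq.
rewrite (eq_avg q (f' := fun y => \sum_(l < d) nc (dkernel j y) * nc (fexp (unitv l) y - 1))); last first.
  by move=> y; rewrite /disp mulr_sumr.
rewrite avg_sum.
rewrite (@le_trans _ _ (\sum_(l < d) (8 * pi * kcst)))//; last first.
  by rewrite sumr_const card_ord -[leLHS]mulr_natl.
apply: ler_sum => l _.
pose dA m := A (m - unitv l) - A m; pose dB m := B (m - unitv l) - B m.
rewrite (@le_trans _ _ (avg q (fun y =>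
    nc (tp (3 * n) (fun m => dsym j m * A m) y) * nc (tp n.+1 dB y) +
    nc (tp (3 * n).+1 dA y) * nc (tp n (fun m => dsym j m * B m) y))))//.
  apply: le_avg => y; rewrite dkernelE -ncM mulrDl (le_trans (ncD _ _))//.
  rewrite -(fexpB1_tp _ _ suppA) -(fexpB1_tp _ _ suppB) -!ncM.
  by rewrite -!mulrA [tp n B y * _]mulrC [tp n _ y * _]mulrC [X in _ + nc X]mulrCA mulrA.
rewrite avgD (@le_trans _ _ (2 * pi * (3 * n)%:R * n%:R^-1 * kcst + n%:R^-1 * (2 * pi * n%:R) * kcst))//.
  have p0 : 0 <= 2 * pi * (3 * n)%:R :> R by rewrite !mulr_ge0// ltW.
  have p1 : 0 <= 2 * pi * n%:R :> R by rewrite !mulr_ge0// ltW.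
  have p2 : 0 <= n%:R^-1 :> R by rewrite invr_ge0.
  apply: lerD; rewrite (le_trans (avg_tp_mul_le _ _ _ _))//.
  - rewrite -addnn; lia.
  - rewrite -addnn; lia.
  - apply: l2_mul => //.
      move=> m mn; rewrite ncM -[leRHS]mulr1 ler_pM ?nc_ge0//.
      exact: nc_dsym.
    move=> m mn; rewrite /dB /B -realcB nc_real /mollifier -mulrBl normrM.
    rewrite (ger0_norm (_ : 0 <= mass^-1)) ?invr_ge0 ?(ltW mass0)//.
    by rewrite ler_wpM2r ?invr_ge0 ?(ltW mass0)// tent_lip.
  - rewrite -addnn; lia.
  - rewrite -addnn; lia.
  - apply: l2_mul => //.
      by move=> m mn; rewrite /dA /A -realcB nc_real plateau_lip.
    move=> m mn; rewrite ncM ler_pM ?nc_ge0//.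
      exact: nc_dsym.
    by rewrite -div1r.
rewrite le_eqVlt; apply/orP; left; apply/eqP; rewrite natrM; field.
by rewrite gt_eqF.
Qed.

Lemma dkernel_odd j y : dkernel j (- y) = - dkernel j y.
Proof.
rewrite /dkernel /tp -sumrN -sum_cubeN; apply: eq_bigr => m _.
rewrite dsymN fexpNr -fexpNl opprK !thetaCE thetaN//; ring.
Qed.

End fixed_scale.
End kernel_bounds.

(** * A commutator estimate *)

Section commutator.
Context {R : realType} {d : nat} (q : nat).
Local Notation C := R[i].
Local Notation V := 'rV[R]_d.
Implicit Types (H L K : V -> C) (w : V -> R).

Lemma eq_avg_grid (F : fieldType) (f f' : V -> F) :
  (forall g : {ffun 'I_d -> 'I_q.+1}, f (gpt g) = f' (gpt g)) -> avg q f = avg q f'.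
Proof. by move=> ff'; congr (_ * _); apply: eq_bigr. Qed.

Lemma le_avg_grid (f f' : V -> R) :
  (forall g : {ffun 'I_d -> 'I_q.+1}, f (gpt g) <= f' (gpt g)) -> avg q f <= avg q f'.
Proof. by move=> ff'; rewrite ler_wpM2l ?invr_ge0// ler_sum. Qed.

(** With an odd kernel, exchanging the two copies of [H] turns [L x] into a
    difference [L x - L (x - y)]; the derivative hidden in [K] is then paid by
    the Lipschitz modulus of [L]. *)
Lemma commutator_le H L K w g : Zperiodic H -> Zperiodic L -> Zperiodic K ->
  (forall y, K (- y) = - K y) ->
  0 <= g -> (forall y, 0 <= w y) ->
  (forall x y, nc (L x - L (x - y)) <= g * w y) ->
  nc (avg q (fun x => H x * L x * avg q (fun y => K y * H (x - y)))) <=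
    g / 2 * avg q (fun y => nc (K y) * w y) * avg q (fun x => nc (H x) ^+ 2).
Proof.
move=> pH pL pK oK g0 w0 lipL; set J := avg q _.
pose Phi y := avg q (fun x => H x * H (x - y) * L x).
pose Psi y := avg q (fun x => H x * H (x - y) * L (x - y)).
have JPhi : J = avg q (fun y => K y * Phi y).
  rewrite /J (eq_avg q (f' := fun x => avg q (fun y => K y * (H x * H (x - y) * L x)))).
    by rewrite avg_exchange; apply: eq_avg => y; rewrite avgZ.
  by move=> x; rewrite -avgZ; apply: eq_avg => y; ring.
have JPsi : J = - avg q (fun y => K y * Psi y).
  rewrite JPhi -avg_opp.
    rewrite -avgN; apply: eq_avg_grid => h; rewrite oK mulNr; congr (- (_ * _)).
    rewrite /Phi -(avg_translate h).
      by apply: eq_avg => x; rewrite opprK subrK (mulrC (H _)).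
    by move=> x m; rewrite addrAC !(pH, pL).
  move=> y m; rewrite pK /Phi; congr (_ * _); apply: eq_avg => x.
  by rewrite -(pH (x - (y + intv R m)) m) opprD addrA subrK.
have J2 : 2 * J = avg q (fun y => K y * (Phi y - Psi y)).
  rewrite mulr2n mulrDl mul1r {1}JPhi JPsi -avgB.
  by apply: eq_avg => y; rewrite mulrBr.
have bnd : nc (2 * J) <= g * avg q (fun y => nc (K y) * w y) * avg q (fun x => nc (H x) ^+ 2).
  rewrite J2 (le_trans (nc_avg _ _))// mulrAC -avgZ; apply: le_avg_grid => h.
  rewrite ncM mulrCA ler_wpM2l ?nc_ge0//.
  rewrite /Phi /Psi -avgB (le_trans (nc_avg _ _))//.
  rewrite -mulrA [leRHS]mulrCA.
  rewrite (@le_trans _ _ (avg q (fun x => (g * w (gpt h)) *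
     (2^-1 * (nc (H x) ^+ 2) + 2^-1 * (nc (H (x - gpt h)) ^+ 2)))))//.
    apply: le_avg => x; rewrite -mulrBr !ncM mulrC ler_pM ?mulr_ge0 ?nc_ge0//.
    have := sqr_ge0 (nc (H x) - nc (H (x - gpt h))); nra.
  rewrite avgZ avgD !avgZ.
  rewrite (avg_translate h (f := fun x => nc (H x) ^+ 2)); last by move=> x m; rewrite pH.
  rewrite -mulrDl (_ : 2^-1 + 2^-1 = 1); last by field.
  by rewrite mul1r; lra.
rewrite (_ : nc J = 2^-1 * nc (2 * J)).
  rewrite (_ : g / 2 * _ * _ = 2^-1 * (g * avg q (fun y => nc (K y) * w y) * avg q (fun x => nc (H x) ^+ 2))).
    by rewrite ler_wpM2l// invr_ge0.
  by field.
have -> : nc (2 * J) = 2 * nc J by rewrite !mulr_natl; exact: normcMn.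
by field.
Qed.

End commutator.

(** * The energy flux *)

Section trilinear.
Context {R : realType} {d : nat} (q S : nat).
Local Notation C := R[i].
Local Notation Z := 'rV[int]_d.
Implicit Types (m k l : Z) (f h g : Z -> C).

(** The trilinear form behind the flux. It is the mean over the torus of a
    product of three functions as soon as [3 * S <= q]. *)
Definition tri f h g : C := avg q (fun x => tp S f x * tp S h x * tp S g x).

Lemma triDl f f' h g : tri (fun m => f m + f' m) h g = tri f h g + tri f' h g.
Proof. by rewrite /tri -avgD; apply: eq_avg => x; rewrite tpD; ring. Qed.

Lemma triDm f h h' g : tri f (fun m => h m + h' m) g = tri f h g + tri f h' g.
Proof. by rewrite /tri -avgD; apply: eq_avg => x; rewrite tpD; ring. Qed.

Lemma triDr f h g g' : tri f h (fun m => g m + g' m) = tri f h g + tri f h g'.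
Proof. by rewrite /tri -avgD; apply: eq_avg => x; rewrite tpD; ring. Qed.

Lemma triBl f f' h g : tri (fun m => f m - f' m) h g = tri f h g - tri f' h g.
Proof. by rewrite /tri -avgB; apply: eq_avg => x; rewrite tpB; ring. Qed.

Lemma tri_sym f h g : tri f h g = tri g h f.
Proof. by apply: eq_avg => x; ring. Qed.

Lemma eq_tri f f' h h' g g' : f =1 f' -> h =1 h' -> g =1 g' ->
  tri f h g = tri f' h' g'.
Proof.
by move=> ff' hh' gg'; apply: eq_avg => x; congr (_ * _ * _); exact: eq_tp.
Qed.

Hypothesis Sq : (3 * S <= q)%N.

Lemma tri_sum f h g : supp S h -> supp S g ->
  tri f h g = \sum_(k <- cube S) \sum_(l <- cube S) f k * h l * g (- k - l).
Proof.
move=> hS gS; rewrite /tri.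
rewrite (eq_avg q (f' := fun x => tp (S + S) (cv S f h) x * tp S g x)); last first.
  by move=> x; rewrite tp_cv.
rewrite avg_mul_supp//; last by lia.
rewrite /cv; under eq_bigr do rewrite mulr_suml.
rewrite exchange_big big_seq [RHS]big_seq; apply: eq_bigr => k kS.
have /(sum_cube_shift kS) -> : supp S (fun l => f k * h l * g (- k - l)).
  by move=> l /hS->; rewrite mulr0 mul0r.
by apply: eq_bigr => m _; rewrite opprB addrA [- k + k]addrC subrr sub0r.
Qed.

(** Integration by parts. The three frequencies add up to 0, hence so do the
    derivatives of the three factors; those of [h] sum to its divergence. *)
Lemma tri_ibp f (h : 'I_d -> Z -> C) g :
  (forall m, \sum_j dsym j m * h j m = 0) ->
  (forall j, supp S (h j)) -> supp S g ->
  \sum_j tri f (h j) (fun m => dsym j m * g m) =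
  - \sum_j tri (fun m => dsym j m * f m) (h j) g.
Proof.
move=> hdiv hS gS.
have gS' j : supp S (fun m => dsym j m * g m) by move=> m /gS->; rewrite mulr0.
under eq_bigr do rewrite tri_sum//.
rewrite -sumrN; under [RHS]eq_bigr do rewrite tri_sum// -sumrN.
rewrite exchange_big [RHS]exchange_big; apply: eq_bigr => k _ /=.
under [RHS]eq_bigr do rewrite -sumrN.
rewrite exchange_big [RHS]exchange_big; apply: eq_bigr => l _ /=.
apply/eqP; rewrite -subr_eq0 -sumrB.
rewrite (eq_bigr (fun j => - (f k * g (- k - l)) * (dsym j l * h j l))).
  by rewrite -mulr_sumr hdiv mulr0.
by move=> j _; rewrite dsymD !dsymN; ring.
Qed.

(** The frequencies of the three factors add up to 0, and two frequencies at
    most [n] do not balance one beyond [n + n]. *)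
Lemma tri_far f h g (n p : nat) : (n + n <= p)%N -> (forall k, k \in cube p -> f k = 0) ->
  supp n h -> supp n g -> supp S h -> supp S g -> tri f h g = 0.
Proof.
move=> np fp hn gn hS gS; rewrite tri_sum// big1// => k _; rewrite big1// => l _.
have [ln|/hn->] := boolP (l \in cube n); last by rewrite mulr0 mul0r.
have [kn|/gn->] := boolP (- k - l \in cube n); last by rewrite mulr0.
rewrite fp ?mul0r// -cubeN (cube_le np)//.
by rewrite -[- k](subrK l) cubeD.
Qed.

Lemma nc_tri_le f h g (B : R) : (forall x, nc (tp S g x) <= B) ->
  nc (tri f h g) <= B / 2 * (\sum_(m <- cube S) nc (f m) ^+ 2 + \sum_(m <- cube S) nc (h m) ^+ 2).
Proof.
move=> gB; rewrite (le_trans (nc_avg _ _))//.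
rewrite -!(avg_parseval (q := q)); [|by lia..].
rewrite -avgD -avgZ; apply: le_avg => x.
rewrite !ncM; have B0 := le_trans (nc_ge0 _) (gB x).
have := gB x; have := nc_ge0 (tp S g x).
have := nc_ge0 (tp S f x); have := nc_ge0 (tp S h x).
move: (nc (tp S f x)) (nc (tp S h x)) (nc (tp S g x)) => s t u t0 s0 u0 uB.
rewrite (@le_trans _ _ (s * t * B))//; first by rewrite ler_wpM2l// mulr_ge0.
have := mulr_ge0 B0 (sqr_ge0 (s - t)); lra.
Qed.

End trilinear.

Section flux.
Context {R : realType} {d : nat}.
Local Notation C := R[i].
Local Notation Z := 'rV[int]_d.
Variables (n S : nat) (c : 'I_d -> Z -> C).
Hypothesis n0 : (0 < n)%N.
Hypothesis nS : (32 * n <= S)%N.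
Hypothesis cS : forall i, supp S (c i).
Hypothesis cdiv : forall m, \sum_j dsym j m * c j m = 0.

Let q := (64 * n + 3 * S)%N.
Let n80 : (0 < 8 * n)%N. Proof. lia. Qed.
Let Sq : (3 * S <= q)%N. Proof. by rewrite /q; lia. Qed.
Let th (m : Z) : C := thetaC n m.
Let th8 (m : Z) : C := thetaC (8 * n) m.
(* [L] and [H] are the low and high parts of the field at scale [n]. The test
   field [P], its cutoff at scale [8 * n], is [L + HT]. *)
Let L i m := th m * c i m.
Let H i m := c i m - th m * c i m.
Let HT i m := th8 m * H i m.
Let P i m := th8 m * c i m.
Let D j (f : Z -> C) m := dsym j m * f m.
Local Notation T := (tri q S).

Let LS i : supp S (L i). Proof. by move=> m /cS mS; rewrite /L mS mulr0. Qed.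
Let HS i : supp S (H i). Proof. by move=> m /cS mS; rewrite /H mS mulr0 subrr. Qed.
Let HTS i : supp S (HT i). Proof. by move=> m /HS mS; rewrite /HT mS mulr0. Qed.
Let DS j f : supp S f -> supp S (D j f).
Proof. by move=> fS m /fS mS; rewrite /D mS mulr0. Qed.
Let Ln i : supp (4 * n) (L i).
Proof. by move=> m /(supp_theta n0) mn; rewrite /L /th thetaCE mn mul0r. Qed.

Let Ldiv m : \sum_j dsym j m * L j m = 0.
Proof.
rewrite (eq_bigr (fun j => th m * (dsym j m * c j m))); last by move=> j _; rewrite /L; ring.
by rewrite -mulr_sumr cdiv mulr0.
Qed.

Let Hdiv m : \sum_j dsym j m * H j m = 0.
Proof.
rewrite (eq_bigr (fun j => (1 - th m) * (dsym j m * c j m))); last by move=> j _; rewrite /H; ring.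
by rewrite -mulr_sumr cdiv mulr0.
Qed.

Let thth8 m : th8 m * th m = th m.
Proof.
have [m8|m8] := boolP (m \in cube (8 * n)).
  by rewrite /th8 thetaCE theta1// mul1r.
rewrite /th [thetaC n m]thetaCE supp_theta ?mulr0//.
by apply: contra m8; apply: cube_le; lia.
Qed.

Let PE i m : P i m = L i m + HT i m.
Proof. by rewrite /P /L /HT /H mulrBr mulrA thth8; ring. Qed.

Let cE i m : c i m = L i m + H i m.
Proof. by rewrite /L /H; ring. Qed.

(** The quadratic term of the equation, tested against [P]. *)
Definition flux : C := \sum_i \sum_j T (c i) (c j) (D j (P i)).

Let self0 i (h : 'I_d -> Z -> C) : (forall m, \sum_j dsym j m * h j m = 0) ->
  (forall j, supp S (h j)) -> \sum_j T (L i) (h j) (D j (L i)) = 0.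
Proof.
move=> hdiv hS; have := tri_ibp Sq (L i) hdiv hS (LS i).
rewrite [X in _ = - X](eq_bigr (fun j => T (L i) (h j) (D j (L i)))); last first.
  by move=> j _; rewrite tri_sym.
by move=> /eqP; rewrite -subr_eq0 opprK -mulr2n mulrn_eq0/= => /eqP.
Qed.

(** Splitting the field into its low part [L] and its high part [H], the purely
    low interactions cancel: two of them because the transporting field is
    divergence free, the others because a product of two low parts has no
    frequency where the cutoff differs from 1. *)
Lemma flux_split : flux =
  \sum_i \sum_j T (H i) (H j) (D j (P i)) +
  \sum_i \sum_j T (H i) (L j) (D j (HT i)) -
  \sum_i \sum_j T (D j (L i)) (H j) (HT i).
Proof.
rewrite /flux -big_split -sumrB; apply: eq_bigr => i _ /=.
have e1 : \sum_j T (L i) (H j) (D j (HT i)) = - \sum_j T (D j (L i)) (H j) (HT i).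
  exact: tri_ibp.
have e2 : \sum_j T (L i) (L j) (D j (HT i)) = - \sum_j T (HT i) (L j) (D j (L i)).
  rewrite (tri_ibp Sq)//; congr (- _); apply: eq_bigr => j _.
  by rewrite tri_sym.
have e3 : \sum_j T (H i) (L j) (D j (L i)) - \sum_j T (HT i) (L j) (D j (L i)) = 0.
  rewrite -sumrB big1// => j _; rewrite -triBl.
  apply: (@tri_far _ _ _ _ Sq _ _ _ (4 * n) (8 * n)) => //; first by lia.
  - move=> k k8; rewrite /HT /th8 thetaCE theta1//; ring.
  - by move=> m /Ln mn; rewrite /D mn mulr0.
  - exact: DS.
have e4 := self0 i Ldiv LS.
have e5 := self0 i Hdiv HS.
rewrite -sumrN -!big_split/=.
have split j : T (c i) (c j) (D j (P i)) =
    T (H i) (H j) (D j (P i)) + T (H i) (L j) (D j (HT i)) + T (H i) (L j) (D j (L i)) +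
    T (L i) (H j) (D j (L i)) + T (L i) (H j) (D j (HT i)) +
    T (L i) (L j) (D j (L i)) + T (L i) (L j) (D j (HT i)).
  have cl h g : T (c i) h g = T (L i) h g + T (H i) h g.
    by rewrite -triDl; exact: eq_tri.
  have cm f g : T f (c j) g = T f (L j) g + T f (H j) g.
    by rewrite -triDm; exact: eq_tri.
  have De f h : T f h (D j (P i)) = T f h (D j (L i)) + T f h (D j (HT i)).
    rewrite -triDr; apply: eq_tri => // m.
    by rewrite /D PE mulrDr.
  rewrite cl !cm (De (L i) (L j)) (De (L i) (H j)) (De (H i) (L j)); ring.
under eq_bigr do rewrite split.
move/eqP: e3; rewrite subr_eq0 => /eqP e3.
rewrite !big_split/= e1 e2 e3 e4 e5 sumrN; ring.
Qed.

Let hi i : R := \sum_(m <- cube S) nc (H i m) ^+ 2.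
Let X : R := \sum_i hi i.

Let hi0 i : 0 <= hi i. Proof. by apply: sumr_ge0 => m _; exact: sqr_ge0. Qed.

Let HThi i : \sum_(m <- cube S) nc (HT i m) ^+ 2 <= hi i.
Proof.
apply: ler_sum => m _; rewrite /HT /th8 thetaCE ncM nc_real ger0_norm ?theta_ge0//.
rewrite exprMn ler_piMl ?sqr_ge0// expr_le1// ?theta_le1 ?theta_ge0//.
Qed.

(** Every term of [flux_split] has two high factors. The third factor is a
    gradient, bounded by [g], unless the derivative falls on the high test
    factor [HT]; there [commutator_le] moves it to the kernel of the cutoff. *)
Lemma flux_le (g : R) : 0 <= g ->
  (forall i j x, nc (tp S (D j (P i)) x) <= g) ->
  (forall i j x, nc (tp S (D j (L i)) x) <= g) ->
  (forall j x y, nc (tp S (L j) (x + y) - tp S (L j) x) <= g * disp y) ->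
  nc flux <= (d%:R * (2 + d%:R * (4 * pi * kcst (d := d)))) * g * X.
Proof.
move=> g0 gP gL lipL; rewrite flux_split.
have pairs (F : 'I_d -> 'I_d -> C) : (forall i j, nc (F i j) <= g / 2 * (hi i + hi j)) ->
    nc (\sum_i \sum_j F i j) <= d%:R * (g * X).
  move=> Fle; rewrite (le_trans (nc_sum _ _ _))//.
  rewrite (@le_trans _ _ (\sum_(i < d) \sum_(j < d) g / 2 * (hi i + hi j)))//.
    by apply: ler_sum => i _; rewrite (le_trans (nc_sum _ _ _))// ler_sum.
  under eq_bigr do rewrite -mulr_sumr big_split/= sumr_const card_ord.
  rewrite -mulr_sumr big_split/= sumr_const card_ord sumrMnl -/X.
  by rewrite -[X *+ d]mulr_natl; lra.
have b1 : nc (\sum_i \sum_j T (H i) (H j) (D j (P i))) <= d%:R * (g * X).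
  by apply: pairs => i j; exact: nc_tri_le.
have b3 : nc (\sum_i \sum_j T (D j (L i)) (H j) (HT i)) <= d%:R * (g * X).
  apply: pairs => i j; rewrite [T _ _ _](_ : _ = T (HT i) (H j) (D j (L i))); last exact: tri_sym.
  rewrite (le_trans (nc_tri_le _ _ _ (gL i j)))//.
  by rewrite ler_wpM2l ?divr_ge0// lerD2r.
have b2 : nc (\sum_i \sum_j T (H i) (L j) (D j (HT i))) <=
    d%:R * (g / 2 * (d%:R * (8 * pi * kcst (d := d))) * X).
  rewrite (le_trans (nc_sum _ _ _))//.
  rewrite (@le_trans _ _ (\sum_(i < d) \sum_(j < d) g / 2 * (d%:R * (8 * pi * kcst (d := d))) * hi i))//.
    apply: ler_sum => i _; rewrite (le_trans (nc_sum _ _ _))//.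
    apply: ler_sum => j _; rewrite /tri.
    rewrite (eq_avg q (f' := fun x => tp S (H i) x * tp S (L j) x *
        avg q (fun y => dkernel (8 * n) j y * tp S (H i) (x - y)))); last first.
      move=> x; congr (_ * _); rewrite /dkernel avg_conv; last first.
      - by move=> m /(supp_theta n80) mn; rewrite thetaCE mn mulr0.
      - by rewrite /q; lia.
      by apply: eq_tp => m; rewrite /D /HT mulrA.
    rewrite (le_trans (commutator_le q (w := @disp R d) _ _ _ _ g0 _ _))//.
    - exact: Zperiodic_tp.
    - exact: Zperiodic_tp.
    - exact: Zperiodic_tp.
    - exact: dkernel_odd.
    - exact: disp_ge0.
    - by move=> x y; rewrite -{1}(subrK y x).
    rewrite avg_parseval; last by rewrite /q; lia.
    apply: ler_wpM2r; first exact: hi0.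
    apply: ler_wpM2l; first by rewrite divr_ge0.
    by apply: dkernel_moment => //; rewrite /q; lia.
  under eq_bigr do rewrite sumr_const card_ord.
  by rewrite sumrMnl -mulr_sumr -/X -[leLHS]mulr_natl.
rewrite (le_trans (ncB _ _))// (le_trans (lerD (ncD _ _) (lexx _)))//.
rewrite (le_trans (lerD (lerD b1 b2) b3))//; lra.
Qed.

End flux.

(** * Slowly decreasing sequences *)

Section sequences.
Context {R : realType}.
Implicit Types (t a b w : nat -> R).

Lemma bounded_sums_small_tail a (B : R) : (forall n, 0 <= a n) ->
  (forall N, \sum_(n < N) a n <= B) ->
  forall e, 0 < e -> exists s, forall N, \sum_(s <= n < s + N) a n <= e.
Proof.
move=> a0 aB e e0; pose s N := \sum_(n < N) a n.
have supS : has_sup (range s).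
  by split; [exists (s 0%N), 0%N|exists B => _ [N _ <-]; exact: aB].
have [_ [n0 _ <-]] := sup_adherent e0 supS; rewrite ltrBlDr => sn0.
exists n0 => N; have : s (n0 + N)%N <= sup (range s).
  by apply: sup_upper_bound => //; exists (n0 + N)%N.
rewrite /s -(big_mkord xpredT a) (big_cat_nat (n := n0))//= ?leq_addr//.
by rewrite big_mkord -/(s n0) => h; lra.
Qed.

(** Once the tail of [a] sums up to at most 1/2, the sequence keeps half of its
    value for ever; as it tends to 0, that value is 0. *)
Lemma slow_decrease_vanish t a (B : R) : (forall n, 0 <= t n) ->
  (forall n, t n.+1 <= t n) -> (forall e, 0 < e -> exists n, t n < e) ->
  (forall n, 0 <= a n) -> (forall N, \sum_(n < N) a n <= B) ->
  (forall n, t n - t n.+1 <= a n * t n) ->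
  exists s, forall n, t (s + n)%N = 0.
Proof.
move=> t0 tle tlim a0 aB ta.
have h2 : (0 : R) < 2^-1 by rewrite invr_gt0.
have [s sa] := bounded_sums_small_tail a0 aB h2.
exists s.
have tmono n m : t (n + m)%N <= t n.
  by elim: m => [|m ih]; rewrite ?addn0// addnS (le_trans (tle _)).
suff ts : t s <= 0.
  by move=> n; apply/eqP; rewrite eq_le t0 andbT (le_trans (tmono _ _)).
have lb n : (1 - \sum_(s <= k < s + n) a k) * t s <= t (s + n)%N.
  elim: n => [|n ih]; first by rewrite addn0 big_geq// subr0 mul1r.
  rewrite addnS big_nat_recr/= ?leq_addr//; have := ta (s + n)%N.
  have := ler_wpM2l (a0 (s + n)%N) (tmono s n).
  move: ih; move: (\sum_(_ <= _ < _) _) (a _) (t s) (t (s + n)%N) (t (s + n).+1) => x y u v w.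
  nra.
rewrite leNgt; apply/negP => ts0.
have [N tN] := tlim (t s / 2) (divr_gt0 ts0 (ltr0Sn _ 1)).
have h : t (s + N)%N <= t N by rewrite addnC tmono.
have := lb N; have := sa N; have := t0 s.
move: (\sum_(_ <= _ < _) _) => x; nra.
Qed.

(** The averages satisfy [y s.+1 = r * y s] up to a summable term: this is the
    discrete Young inequality for a geometric kernel. *)
Lemma geometric_average_sums (r : R) w (K : nat) (B : R) : 0 < r < 1 ->
  (forall k, 0 <= w k) -> (forall N, \sum_(k < N) r ^+ k * w k <= B) ->
  exists B', forall N, \sum_(s < N) r ^+ s * \sum_(k < s + K) w k <= B'.
Proof.
move=> /andP[r0 r1] w0 wB.
pose y s := r ^+ s * \sum_(k < s + K) w k.
have y0 s : 0 <= y s.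
  by rewrite mulr_ge0 ?exprn_ge0 ?(ltW r0)// sumr_ge0.
have rec s : y s.+1 = r * y s + r / r ^+ K * (r ^+ (s + K) * w (s + K)%N).
  rewrite /y addSn big_ord_recr/= mulrDr exprS exprD; field.
  by rewrite gt_eqF// exprn_gt0.
exists ((y 0%N + r / r ^+ K * B) / (1 - r)) => N.
rewrite ler_pdivlMr ?subr_gt0//.
have : \sum_(s < N) y s <= y 0%N + \sum_(s < N) y s.+1.
  case: N => [|N]; first by rewrite !big_ord0 addr0.
  by rewrite big_ord_recl lerD2l big_ord_recr/= lerDl.
under [X in _ <= _ + X]eq_bigr do rewrite rec.
rewrite big_split/= -!mulr_sumr.
have : \sum_(s < N) r ^+ (s + K) * w (s + K)%N <= B.
  rewrite (le_trans _ (wB (K + N)%N))// big_split_ord/=.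
  rewrite [X in _ <= _ + X](eq_bigr (fun s : 'I_N => r ^+ (s + K) * w (s + K)%N)); last first.
    by move=> i _; rewrite addnC.
  by rewrite lerDr sumr_ge0// => i _; rewrite mulr_ge0// exprn_ge0// ltW.
move=> h; have rK : 0 <= r / r ^+ K by rewrite divr_ge0 ?exprn_ge0 ?(ltW r0).
have := ler_wpM2l rK h; rewrite -/(y _) /=.
move: (\sum_(i < N) y i) => Y; lra.
Qed.

Lemma powR_exprn (x : R) k : (2 ^ k)%:R `^ x = (2 `^ x) ^+ k :> R.
Proof.
by rewrite -powR_mulrn ?powR_ge0// -powRrM mulrC powRrM powR_mulrn// natrX.
Qed.

End sequences.

(** * Vanishing of the Fourier coefficients *)

Section coefficients.
Context {R : realType} {d : nat}.
Local Notation C := R[i].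
Local Notation Z := 'rV[int]_d.
Local Notation V := 'rV[R]_d.
Implicit Types (m : Z) (c : 'I_d -> Z -> C).

Lemma sum_cube_split (W : nmodType) n S (F : Z -> W) : (n <= S)%N ->
  \sum_(m <- cube S) F m =
  \sum_(m <- cube n) F m + \sum_(m <- cube S | m \notin cube n) F m.
Proof.
move=> nS; rewrite (bigID [in cube n])/=; congr (_ + _).
rewrite -[LHS]big_filter; apply: perm_big; apply: uniq_perm; rewrite ?filter_uniq ?uniq_cube//.
by move=> m; rewrite mem_filter andb_idr//; exact: cube_le.
Qed.

Lemma enorm_ge (x : V) i : `|x 0 i| <= enorm x.
Proof.
rewrite /enorm -sqrtr_sqr; apply: ler_wsqrtr.
by rewrite (bigD1 i)//= lerDl sumr_ge0// => j _; exact: sqr_ge0.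
Qed.

Lemma enorm_cubeN n m : m \notin cube n -> n%:R <= enorm (intv R m).
Proof.
rewrite mem_cube negb_forall => /existsP[j]; rewrite -ltnNge => mi.
rewrite (le_trans _ (enorm_ge _ j))// !mxE -intr_norm -[n%:R]/(n%:Z%:~R) ler_int.
by move: mi; move: (m ord0 j) => z; lia.
Qed.

Definition trunc S c : 'I_d -> Z -> C := fun i m => if m \in cube S then c i m else 0.

Definition lap (alpha : R) m : R := (2 * pi * enorm (intv R m)) `^ (2 * alpha).

(** The dissipation tested against the cutoff at scale [8 * n]; the symbol
    [theta (8 * n)] is supported in [cube (32 * n)]. *)
Definition dissip alpha n c : R :=
  \sum_i \sum_(m <- cube (32 * n)) theta (8 * n) m * lap alpha m * nc (c i m) ^+ 2.

Definition energy c n : R := \sum_i \sum_(m <- cube n) nc (c i m) ^+ 2.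

Lemma energyB c n S : (n <= S)%N -> energy c S - energy c n =
  \sum_i \sum_(m <- cube S | m \notin cube n) nc (c i m) ^+ 2.
Proof.
move=> nS; rewrite /energy -sumrB; apply: eq_bigr => i _.
by rewrite (sum_cube_split _ nS) addrC addKr.
Qed.

Lemma le_energy c n S : (n <= S)%N -> energy c n <= energy c S.
Proof.
move=> nS; rewrite -subr_ge0 energyB//.
by apply: sumr_ge0 => i _; apply: sumr_ge0 => m _; exact: sqr_ge0.
Qed.

Section vanishing.
Variables (alpha : R) (c : 'I_d -> Z -> C) (B B2 : R).
Variables (f : nat -> 'I_d -> Z -> C) (p : nat -> R) (K0 : nat).
Hypothesis alpha0 : 0 < alpha.
Hypothesis cdiv : forall m, \sum_j dsym j m * c j m = 0.
Hypothesis cmean : forall i, c i 0 = 0.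
Hypothesis cB : forall S, energy c S <= B.
Hypothesis fsupp : forall k i, supp (2 ^ k) (f k i).
Hypothesis fp : forall k i x, nc (tp (2 ^ k) (f k i) x) <= p k.
(* The shift [K0] makes room for smooth blocks, which add up to the identity
   only well below their maximal frequency. *)
Hypothesis fc : forall K i m, m \in cube (2 ^ K) -> c i m = \sum_(k < K + K0) f k i m.
Hypothesis psum : forall N, \sum_(k < N) (2 ^ k)%:R `^ (1 - 2 * alpha) * p k <= B2.
Hypothesis balance : forall n e S0, (0 < n)%N -> 0 < e ->
  exists S, (S0 <= S)%N /\ dissip alpha n c <= nc (flux n S (trunc S c)) + e.

Let kc : R := kcst (d := d).
Let kc0 : 0 <= kc. Proof. exact: kcst_ge0. Qed.
Let pi0 : 0 < pi :> R. Proof. exact: pi_gt0. Qed.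
Let pos2 k : (0 < 2 ^ k)%N. Proof. by rewrite expn_gt0. Qed.

Let gcst : R := kc * (8 * pi * kc).
Let gcst0 : 0 <= gcst. Proof. by rewrite !mulr_ge0// ltW. Qed.
Let gsum K : R := \sum_(k < K) (2 ^ k)%:R * p k.

Let fth k i m : thetaC (2 ^ k) m * f k i m = f k i m.
Proof.
have [mk|/fsupp->] := boolP (m \in cube (2 ^ k)); last by rewrite mulr0.
by rewrite thetaCE theta1// mul1r.
Qed.

Let fpS S k i : (2 ^ k <= S)%N -> forall x, nc (tp S (f k i) x) <= p k.
Proof. by move=> kS x; rewrite (tp_le _ kS). Qed.

Let trunc_blocks n K S i m : (0 < n)%N -> (4 * n <= 2 ^ K)%N -> (2 ^ (K + K0) <= S)%N ->
  thetaC n m * trunc S c i m = \sum_(k < K + K0) thetaC n m * f k i m.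
Proof.
move=> n0 nK KS; rewrite -mulr_sumr.
have [mn|mn] := boolP (m \in cube (4 * n)); last first.
  by rewrite thetaCE supp_theta// !mul0r.
have mK := cube_le nK mn; congr (_ * _); rewrite /trunc (fc i mK) ifT//.
by apply: cube_le mK; rewrite (leq_trans _ KS)// leq_exp2l// leq_addr.
Qed.

Let le_exp K S (k : 'I_K) : (2 ^ K <= S)%N -> (2 ^ k <= S)%N.
Proof. by apply: leq_trans; rewrite leq_exp2l// ltnW. Qed.

(* The cutoff at scale [n] only meets the blocks of frequency [O(n)], and on
   each of them a derivative costs its frequency. *)
Let grad_bound n K S i j x : (0 < n)%N -> (4 * n <= 2 ^ K)%N -> (2 ^ (K + K0) <= S)%N ->
  nc (tp S (fun m => dsym j m * (thetaC n m * trunc S c i m)) x) <= gcst * gsum (K + K0).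
Proof.
move=> n0 nK KS.
rewrite (eq_tp S x (b := fun m => \sum_(k < K + K0) thetaC n m * (dsym j m * f k i m))); last first.
  by move=> m; rewrite (trunc_blocks i m n0 nK KS) mulr_sumr; apply: eq_bigr => k _; ring.
rewrite tp_sum (le_trans (nc_sum _ _ _))// /gsum mulr_sumr; apply: ler_sum => k _.
have kS : (2 ^ k <= S)%N by exact: le_exp KS.
rewrite (le_trans (thetaC_sup_le n0 (M := 8 * pi * kc * (2 ^ k)%:R * p k) _ _))//.
  move=> y; rewrite (eq_tp S y (b := fun m => dsym j m * (thetaC (2 ^ k) m * f k i m))).
    by apply: dsym_thetaC_sup_le => //; exact: fpS.
  by move=> m; rewrite fth.
by rewrite /gcst /kc !mulrA.
Qed.

Let lip_bound n K S i x y : (0 < n)%N -> (4 * n <= 2 ^ K)%N -> (2 ^ (K + K0) <= S)%N ->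
  nc (tp S (fun m => thetaC n m * trunc S c i m) (x + y) -
      tp S (fun m => thetaC n m * trunc S c i m) x) <= gcst * gsum (K + K0) * disp y.
Proof.
move=> n0 nK KS; rewrite tp_sub_translate.
rewrite (eq_tp S x (b := fun m => \sum_(k < K + K0) thetaC n m * ((fexp m y - 1) * f k i m))); last first.
  by move=> m; rewrite (trunc_blocks i m n0 nK KS) mulr_sumr; apply: eq_bigr => k _; ring.
rewrite tp_sum (le_trans (nc_sum _ _ _))// /gsum [X in _ <= X * _]mulr_sumr mulr_suml; apply: ler_sum => k _.
have kS : (2 ^ k <= S)%N by exact: le_exp KS.
have pk0 : 0 <= p k by exact: le_trans (nc_ge0 _) (fp k i 0).
rewrite (le_trans (thetaC_sup_le n0 (M := 4 * kc * (2 ^ k)%:R * p k * disp y) _ _))//.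
  move=> z; rewrite (eq_tp S z (b := fun m => (fexp m y - 1) * (thetaC (2 ^ k) m * f k i m))).
    by rewrite -tp_sub_translate; apply: thetaC_lipschitz => //; exact: fpS.
  by move=> m; rewrite fth.
have Y0 : 0 <= kc * ((2 ^ k)%:R * (p k * disp y)) by rewrite !mulr_ge0// disp_ge0.
rewrite [leLHS](_ : _ = kc * (4 * (kc * ((2 ^ k)%:R * (p k * disp y))))); last by rewrite /kc; ring.
rewrite [leRHS](_ : _ = kc * (8 * pi * (kc * ((2 ^ k)%:R * (p k * disp y))))); last by rewrite /gcst /kc; ring.
rewrite ler_wpM2l// ler_wpM2r//.
by have := @pi_ge2 R; lra.
Qed.

Let einf : R := sup (range (energy c)).

Let has_sup_energy : has_sup (range (energy c)).
Proof. by split; [exists (energy c 0), 0%N|exists B => _ [N _ <-]]. Qed.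

Let energy_le n : energy c n <= einf.
Proof. by apply: sup_upper_bound => //; exists n. Qed.

Let fcst : R := d%:R * (2 + d%:R * (4 * pi * kcst (d := d))).
Let fcst0 : 0 <= fcst.
Proof. by rewrite mulr_ge0// addr_ge0// !mulr_ge0// ?kcst_ge0// ltW. Qed.

Let gsum0 K : (0 < d)%N -> 0 <= gsum K.
Proof.
move=> d0; apply: sumr_ge0 => k _; rewrite mulr_ge0//.
exact: le_trans (nc_ge0 _) (fp k (Ordinal d0) 0).
Qed.

(* The high part of the truncated field lives beyond frequency [n], hence the
   factor [einf - energy c n]. *)
Let dissip_le s : (0 < d)%N ->
  dissip alpha (2 ^ s) c <= fcst * (gcst * gsum (s + 5 + K0)) * (einf - energy c (2 ^ s)).
Proof.
move=> d0; set n := (2 ^ s)%N; have n0 : (0 < n)%N by exact: pos2.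
have g0 : 0 <= gcst * gsum (s + 5 + K0) by rewrite mulr_ge0// gsum0.
apply/ler_addgt0Pr => e e0.
have [S [nS bal]] := balance (2 ^ (s + 5 + K0) + 32 * n)%N n0 e0.
rewrite (le_trans bal)// lerD2r.
have nS1 : (2 ^ (s + 5 + K0) <= S)%N by apply: leq_trans nS; rewrite leq_addr.
have nS2 : (32 * n <= S)%N by apply: leq_trans nS; rewrite leq_addl.
have n5 : (32 * n = 2 ^ (s + 5))%N by rewrite expnD mulnC.
have h1 : (4 * (8 * n) <= 2 ^ (s + 5))%N by rewrite -n5 mulnA.
have h2 : (4 * n <= 2 ^ (s + 5))%N by rewrite -n5; lia.
have n80 : (0 < 8 * n)%N by lia.
apply: (le_trans (flux_le n0 nS2 _ _ g0 _ _ _)).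
- by move=> i m mS; rewrite /trunc (negbTE mS).
- move=> m; rewrite /trunc; have [mS|mS] := boolP (m \in cube S); first exact: cdiv.
  by rewrite big1// => j _; rewrite mulr0.
- by move=> i j x; exact: grad_bound.
- by move=> i j x; exact: grad_bound.
- by move=> j x y; exact: lip_bound.
apply: ler_wpM2l; first by apply: mulr_ge0; [exact: fcst0|exact: g0].
apply: (@le_trans _ _ (energy c S - energy c n)); last by rewrite lerD2r.
rewrite energyB; last by apply: leq_trans nS2; lia.
apply: ler_sum => i _; rewrite [leRHS]big_mkcond big_seq [leRHS]big_seq.
apply: ler_sum => m mS; rewrite /trunc mS thetaCE; case: ifPn => mn; last first.
  rewrite negbK in mn.
  by rewrite theta1// mul1r subrr nc0 expr0n.
have -> : c i m - (theta n m)%:C * c i m = (1 - theta n m)%:C * c i m.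
  by rewrite realcB mulrBl [in RHS]mul1r.
rewrite ncM exprMn ler_piMl ?sqr_ge0//.
have t0 := theta_ge0 n0 m (R := R); have t1 := theta_le1 n0 m (R := R).
by rewrite nc_real ger0_norm ?subr_ge0// expr_le1 ?subr_ge0// gerBl.
Qed.

Let dissip_term_ge0 n i m : (0 < n)%N -> 0 <= theta (8 * n) m * lap alpha m * nc (c i m) ^+ 2.
Proof.
move=> n0; have n80 : (0 < 8 * n)%N by lia.
apply: mulr_ge0; last exact: sqr_ge0.
by apply: mulr_ge0; [exact: theta_ge0|exact: powR_ge0].
Qed.

(* Frequencies beyond [n] are damped at rate at least [n ^ (2 * alpha)]. *)
Let le_dissip s : (2 ^ s)%:R `^ (2 * alpha) * (energy c (2 ^ s.+1) - energy c (2 ^ s)) <=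
  dissip alpha (2 ^ s) c.
Proof.
set n := (2 ^ s)%N; have n0 : (0 < n)%N by exact: pos2.
rewrite energyB; last by rewrite leq_exp2l.
have n32 : (2 ^ s.+1 <= 32 * n)%N by rewrite expnS -/n; lia.
rewrite mulr_sumr; apply: ler_sum => i _; rewrite mulr_sumr.
rewrite [leRHS](sum_cube_split _ n32).
rewrite (@le_trans _ _ (\sum_(m <- cube (2 ^ s.+1)) theta (8 * n) m * lap alpha m * nc (c i m) ^+ 2))//; last first.
  by rewrite lerDl sumr_ge0// => m _; exact: dissip_term_ge0.
rewrite big_mkcond big_seq [leRHS]big_seq; apply: ler_sum => m m2.
case: ifPn => mn; last exact: dissip_term_ge0.
rewrite ler_wpM2r ?sqr_ge0// theta1 ?mul1r; first last.
- by apply: cube_le m2; rewrite expnS -/n; lia.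
- by lia.
rewrite /lap ge0_ler_powR ?nnegrE ?mulr_ge0// ?(ltW alpha0)// ?(ltW pi0) ?sqrtr_ge0//.
rewrite (le_trans (enorm_cubeN mn))// ler_peMl ?sqrtr_ge0//.
have := @pi_ge2 R; lra.
Qed.

(** Let [t s] be the energy beyond the frequency [2 ^ s]. The lower and upper
    bounds on the dissipation give [t s - t s.+1 <= a s * t s] with [a]
    summable, so [t] vanishes from some scale on. Then the dissipation vanishes
    at arbitrarily large scales, where it sees every nonzero frequency. *)
Theorem coefficients_vanish i m : c i m = 0.
Proof.
have d0 : (0 < d)%N by case: (d) i => [[]|].
pose t s := einf - energy c (2 ^ s).
pose a s := (2 `^ (- (2 * alpha))) ^+ s * (fcst * gcst) * gsum (s + 5 + K0).
have r01 : 0 < (2 : R) `^ (- (2 * alpha)) < 1.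
  rewrite powR_gt0//= /powR pnatr_eq0/= expR_lt1 mulNr oppr_lt0.
  by rewrite mulr_gt0 ?mulr_gt0// ln_gt0// ltr1n.
have [r0 r1] := andP r01.
have t0 s : 0 <= t s by rewrite subr_ge0.
have [B' aB'] : exists B', forall N, \sum_(s < N) a s <= B'.
  have w0 k : 0 <= (2 ^ k)%:R * p k.
    by rewrite mulr_ge0//; exact: le_trans (nc_ge0 _) (fp k i 0).
  have wB N : \sum_(k < N) (2 `^ (- (2 * alpha))) ^+ k * ((2 ^ k)%:R * p k) <= B2.
    rewrite (le_trans _ (psum N))//; apply: ler_sum => k _.
    rewrite -powR_exprn mulrA powRD; last by rewrite pnatr_eq0 -lt0n pos2 implybT.
    by rewrite powRr1// [X in _ <= X * _]mulrC.
  have [B3 hB3] := geometric_average_sums (5 + K0) r01 w0 wB.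
  exists (fcst * gcst * B3) => N; rewrite (le_trans _ (ler_wpM2l _ (hB3 N)))//.
    rewrite mulr_sumr; apply: ler_sum => s _; rewrite /a /gsum addnA.
    by rewrite le_eqVlt; apply/orP; left; apply/eqP; ring.
  by rewrite mulr_ge0.
have [s0 ts0] : exists s, forall n, t (s + n)%N = 0.
  apply: (slow_decrease_vanish t0 _ _ _ aB').
  - by move=> s; rewrite lerD2l lerN2 le_energy// leq_exp2l.
  - move=> e e0; have [_ [N _ <-]] := sup_adherent e0 has_sup_energy.
    rewrite -/einf => h; exists N; rewrite ltrBlDr -ltrBlDl (lt_le_trans h)//.
    by rewrite le_energy// ltnW// ltn_expl.
  - move=> s; apply: mulr_ge0; last exact: gsum0.
    apply: mulr_ge0; last by apply: mulr_ge0; [exact: fcst0|exact: gcst0].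
    by rewrite exprn_ge0// ltW.
  - move=> s; rewrite [leLHS](_ : _ = energy c (2 ^ s.+1) - energy c (2 ^ s)); last by rewrite /t; ring.
    have P0 : 0 < (2 ^ s)%:R `^ (2 * alpha) :> R by rewrite powR_gt0 ?ltr0n.
    rewrite -(ler_pM2l P0) (le_trans (le_dissip s))// (le_trans (dissip_le s d0))//.
    rewrite /a -powR_exprn powRN -/(t s).
    rewrite le_eqVlt; apply/orP; left; apply/eqP; field.
    by rewrite gt_eqF.
have [K mK] := cube_exists m.
pose s := (s0 + K)%N; pose n := (2 ^ s)%N.
have n0 : (0 < n)%N by exact: pos2.
have D0 : dissip alpha n c <= 0.
  by rewrite (le_trans (dissip_le s d0))// -/(t s) ts0 mulr0.
have m8 : m \in cube (8 * n).
  apply: cube_le mK; rewrite (leq_trans (ltnW (ltn_expl K (ltnSn 1))))//.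
  rewrite (@leq_trans n)//; last by lia.
  by rewrite leq_exp2l// leq_addl.
have [->|mn0] := eqVneq m 0; first exact: cmean.
have le0 : theta (8 * n) m * lap alpha m * nc (c i m) ^+ 2 <= 0.
  rewrite (le_trans _ D0)// /dissip (bigD1 i)//= (bigD1_seq m)/= ?uniq_cube//.
    rewrite -addrA lerDl addr_ge0// ?sumr_ge0// => [k _|j _].
      exact: dissip_term_ge0.
    by rewrite sumr_ge0// => k _; exact: dissip_term_ge0.
  by apply: cube_le m8; lia.
rewrite theta1// ?mul1r in le0; last by lia.
apply: nc_eq0; apply/eqP; rewrite -sqrf_eq0 eq_le sqr_ge0 andbT.
have lap0 : 0 < lap alpha m.
  rewrite /lap powR_gt0// mulr_gt0// ?mulr_gt0//.
  have : m \notin cube 0.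
    apply: contra mn0 => /cubeP m0; apply/eqP/rowP => j; rewrite mxE.
    by have := m0 j; rewrite leqn0 absz_eq0 => /eqP.
  move=> /cubeP m0; have [j mj] : exists j, m ord0 j != 0.
    apply/existsP; apply: contra_notT m0 => /existsPn m0 j.
    by have := m0 j; rewrite negbK => /eqP->.
  by rewrite (lt_le_trans _ (enorm_ge _ j))// normr_gt0 mxE intr_eq0.
by rewrite -(pmulr_rle0 _ lap0).
Qed.

End vanishing.
End coefficients.

(** * Square-integrable functions on a probability space *)

Section square_integrable.
Context {d : measure_display} {T : measurableType d} {R : realType}.
Variable P : probability T R.
Implicit Types (f g h : T -> R).

Definition itg f := P.-integrable setT (EFin \o f).
Local Notation I f := (Rintegral P setT f).

Lemma itg_le f g : measurable_fun setT f -> (forall x, `|f x| <= g x) ->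
  itg g -> itg f.
Proof.
move=> mf fg ig; apply: (le_integrable measurableT _ _ ig).
  exact/measurable_EFinP.
by move=> x _ /=; rewrite lee_fin (le_trans (fg x))// ler_norm.
Qed.

Lemma itg_cst (c : R) : itg (fun=> c).
Proof. by apply: finite_measure_integrable_cst. Qed.

Lemma itg_bounded f (M : R) : measurable_fun setT f -> (forall x, `|f x| <= M) ->
  itg f.
Proof. by move=> mf fM; exact: (itg_le mf fM (itg_cst M)). Qed.

Lemma itgD f g : itg f -> itg g -> itg (fun x => f x + g x).
Proof. by move=> fi gi; exact: (integrableD measurableT fi gi). Qed.

Lemma itgB f g : itg f -> itg g -> itg (fun x => f x - g x).
Proof. by move=> fi gi; exact: (integrableB measurableT fi gi). Qed.

Lemma itgZ c f : itg f -> itg (fun x => c * f x).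
Proof. by move=> fi; exact: (integrableZl measurableT c fi). Qed.

Lemma itg_measurable f : itg f -> measurable_fun setT f.
Proof. by move=> /integrableP[/measurable_EFinP]. Qed.

Lemma ID f g : itg f -> itg g -> I (fun x => f x + g x) = I f + I g.
Proof. by move=> fi gi; rewrite RintegralD. Qed.

Lemma IB f g : itg f -> itg g -> I (fun x => f x - g x) = I f - I g.
Proof. by move=> fi gi; rewrite RintegralB. Qed.

Lemma IZ c f : itg f -> I (fun x => c * f x) = c * I f.
Proof. by move=> fi; rewrite RintegralZl. Qed.

Lemma Icst c : I (fun=> c) = c.
Proof.
rewrite Rintegral_cst//; have h := @probability_setT _ _ _ P.
by rewrite [X in c * X](_ : _ = fine (P setT))// h mulr1.
Qed.

Lemma le_I f g : itg f -> itg g -> (forall x, f x <= g x) -> I f <= I g.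
Proof. by move=> fi gi fg; apply: le_Rintegral. Qed.

Lemma I_ge0 f : (forall x, 0 <= f x) -> 0 <= I f.
Proof. by move=> f0; apply: Rintegral_ge0. Qed.

Lemma norm_I f : itg f -> `|I f| <= I (fun x => `|f x|).
Proof. by move=> fi; apply: le_normr_Rintegral. Qed.

Definition sqi f := measurable_fun setT f /\ itg (fun x => f x ^+ 2).

Lemma sqi_measurable f : sqi f -> measurable_fun setT f. Proof. by case. Qed.

Lemma sqi_sqr f : sqi f -> itg (fun x => f x ^+ 2). Proof. by case. Qed.

Lemma sqi_le f g : measurable_fun setT f -> (forall x, `|f x| <= `|g x|) ->
  sqi g -> sqi f.
Proof.
move=> mf fg [mg ig]; split => //.
apply: (itg_le _ _ ig); first exact: measurable_funX.
move=> x; rewrite normrX -[leRHS]real_normK ?num_real//.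
by rewrite lerXn2r ?nnegrE.
Qed.

Lemma sqi_bounded f (M : R) : measurable_fun setT f -> (forall x, `|f x| <= M) ->
  sqi f.
Proof.
move=> mf fM; split => //; apply: (@itg_bounded _ (M ^+ 2)).
  exact: measurable_funX.
by move=> x; rewrite normrX lerXn2r ?nnegrE// (le_trans _ (fM x)).
Qed.

Lemma sqiM f g : sqi f -> sqi g -> itg (fun x => f x * g x).
Proof.
move=> [mf fi] [mg gi]; apply: (itg_le _ _ (itgD fi gi)).
  exact: measurable_funM.
move=> x; rewrite normrM -(real_normK (num_real (f x))) -(real_normK (num_real (g x))).
have := sqr_ge0 (`|f x| - `|g x|); have := normr_ge0 (f x); have := normr_ge0 (g x).
nra.
Qed.

Lemma sqi_itg f : sqi f -> itg f.
Proof.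
move=> fi; have := sqiM fi (@sqi_bounded (cst 1) 1 _ _).
under eq_fun do rewrite mulr1.
apply; first exact: measurable_cst.
by move=> x; rewrite normr1.
Qed.

Lemma sqiD f g : sqi f -> sqi g -> sqi (fun x => f x + g x).
Proof.
move=> fi gi; split; first by apply: measurable_funD; [case: fi|case: gi].
have e x : (f x + g x) ^+ 2 = f x ^+ 2 + (2 * (f x * g x) + g x ^+ 2) by ring.
under eq_fun do rewrite e.
apply: itgD; first exact: sqi_sqr.
by apply: itgD; [apply: itgZ; exact: sqiM|exact: sqi_sqr].
Qed.

Lemma sqiZ c f : sqi f -> sqi (fun x => c * f x).
Proof.
move=> fi; split; first by apply: measurable_funM => //; case: fi.
under eq_fun do rewrite exprMn.
by apply: itgZ; exact: sqi_sqr.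
Qed.

Lemma sqiB f g : sqi f -> sqi g -> sqi (fun x => f x - g x).
Proof.
move=> fi gi; have := sqiD fi (sqiZ (-1) gi).
by under eq_fun do rewrite mulN1r.
Qed.

Lemma sqi_sum (J : Type) (r : seq J) (F : J -> T -> R) : (forall j, sqi (F j)) ->
  sqi (fun x => \sum_(j <- r) F j x).
Proof.
move=> iF; elim: r => [|j r ih].
  under eq_fun do rewrite big_nil.
  by apply: (@sqi_bounded _ 0) => [|x]; [exact: measurable_cst|rewrite normr0].
under eq_fun do rewrite big_cons; exact: sqiD.
Qed.

Lemma I_cauchy_schwarz f g : sqi f -> sqi g ->
  `|I (fun x => f x * g x)| <=
    Num.sqrt (I (fun x => f x ^+ 2)) * Num.sqrt (I (fun x => g x ^+ 2)).
Proof.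
move=> fi gi; set A := I (fun x => f x ^+ 2); set D := I (fun x => g x ^+ 2).
set B := I _.
have A0 : 0 <= A by apply: I_ge0 => x; exact: sqr_ge0.
have D0 : 0 <= D by apply: I_ge0 => x; exact: sqr_ge0.
have quad s t : 0 <= s ^+ 2 * A - 2 * s * t * B + t ^+ 2 * D.
  rewrite (_ : _ + _ = I (fun x => (s * f x - t * g x) ^+ 2)).
    by apply: I_ge0 => x; exact: sqr_ge0.
  have e x : (s * f x - t * g x) ^+ 2 =
    (s ^+ 2 * f x ^+ 2 - 2 * s * t * (f x * g x)) + t ^+ 2 * g x ^+ 2 by ring.
  under [RHS]eq_Rintegral do rewrite e.
  have i1 : itg (fun x => s ^+ 2 * f x ^+ 2) by apply: itgZ; case: fi.
  have i2 : itg (fun x => 2 * s * t * (f x * g x)) by apply: itgZ; exact: sqiM.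
  have i3 : itg (fun x => t ^+ 2 * g x ^+ 2) by apply: itgZ; case: gi.
  rewrite ID; [|exact: itgB|exact: i3].
  by rewrite IB// (IZ _ (sqi_sqr fi)) (IZ _ (sqiM fi gi)) (IZ _ (sqi_sqr gi)).
rewrite -sqrtrM// -sqrtr_sqr; apply: ler_wsqrtr.
exact: discriminant_le0.
Qed.

Lemma sqi_dominated_convergence (fn : nat -> T -> R) f g :
  (forall n, measurable_fun setT (fn n)) -> measurable_fun setT f -> sqi g ->
  (forall n x, `|fn n x| <= g x) -> (forall x, `|f x| <= g x) ->
  {ae P, forall x, fn ^~ x @ \oo --> f x} ->
  (fun n => I (fun x => (fn n x - f x) ^+ 2)) @ \oo --> (0 : R).
Proof.
move=> mfn mf [mg ig] fng fg cv.
have [] := @dominated_convergence _ T R P setT measurableT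
  (fun n x => ((fn n x - f x) ^+ 2)%:E) (cst 0%E) (fun x => (4 * g x ^+ 2)%:E).
- by move=> n; apply/measurable_EFinP; apply: measurable_funX; exact: measurable_funB.
- exact: measurable_cst.
- apply: filterS cv => x cvx _; apply/fine_cvgP; split; first exact: nearW.
  have c1 : fn n x - f x @[n --> \oo] --> (0 : R).
    by rewrite -(subrr (f x)); apply: cvgB => //; exact: cvg_cst.
  have := @continuous_cvg _ _ _ _ _ _ (fun y : R => y ^+ 2) _ (@exprn_continuous R 2 0) c1.
  rewrite /= expr0n/= => h; exact: h.
- exact: itgZ.
- apply: nearW => x n _ /=; rewrite lee_fin normrX.
  have h : `|fn n x - f x| <= 2 * g x.
    by rewrite (le_trans (ler_normB _ _))//; have := fng n x; have := fg x; lra.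
  have := normr_ge0 (fn n x - f x); move: h; move: `|_ - _| => y; nra.
- move=> _ _ ; rewrite integral_cst// mul0e => h.
  have h2 := fine_cvg h; exact: h2.
Qed.

End square_integrable.

(** * Mean-square density of algebras of functions *)

Import HBNNSimple.

Section square_density.
Context {d : measure_display} {T : measurableType d} {R : realType}.
Variable P : probability T R.
Variable A : set (T -> R).
Hypothesis AD : forall p q, A p -> A q -> A (fun x => p x + q x).
Hypothesis AZ : forall c p, A p -> A (fun x => c * p x).
Hypothesis Asqi : forall p, A p -> sqi P p.
Hypothesis A1 : A (fun=> 1).
Implicit Types (f g h p : T -> R).
Local Notation I f := (Rintegral P setT f).

Definition apx f := forall e, 0 < e -> exists2 p, A p & I (fun x => (f x - p x) ^+ 2) < e.

Lemma apx_self p : A p -> apx p.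
Proof.
move=> Ap e e0; exists p => //; under eq_Rintegral do rewrite subrr expr0n/=.
by rewrite Icst.
Qed.

Lemma I_sqrD_le f g : sqi P f -> sqi P g ->
  I (fun x => (f x + g x) ^+ 2) <= 2 * I (fun x => f x ^+ 2) + 2 * I (fun x => g x ^+ 2).
Proof.
move=> fi gi.
rewrite -!IZ; [|exact: sqi_sqr..].
rewrite -ID; [|by apply: itgZ; exact: sqi_sqr..].
apply: le_I.
- exact: sqi_sqr (sqiD fi gi).
- by apply: itgD; apply: itgZ; exact: sqi_sqr.
- by move=> x; have := sqr_ge0 (f x - g x); nra.
Qed.

Lemma apxD f g : sqi P f -> sqi P g -> apx f -> apx g -> apx (fun x => f x + g x).
Proof.
move=> fi gi af ag e e0; have e4 : 0 < e / 4 by rewrite divr_gt0.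
have [p Ap fp] := af _ e4; have [q Aq gq] := ag _ e4.
exists (fun x => p x + q x); first exact: AD.
have ee x : (f x + g x - (p x + q x)) ^+ 2 = ((f x - p x) + (g x - q x)) ^+ 2 by ring.
under eq_Rintegral do rewrite ee.
rewrite (le_lt_trans (I_sqrD_le (sqiB fi (Asqi Ap)) (sqiB gi (Asqi Aq))))//.
by lra.
Qed.

Lemma apxZ c f : sqi P f -> apx f -> apx (fun x => c * f x).
Proof.
move=> fi af e e0; have c0 : 0 < c ^+ 2 + 1 by rewrite ltr_wpDl// sqr_ge0.
have [p Ap fp] := af _ (divr_gt0 e0 c0).
exists (fun x => c * p x); first exact: AZ.
have ee x : (c * f x - c * p x) ^+ 2 = c ^+ 2 * (f x - p x) ^+ 2 by ring.
under eq_Rintegral do rewrite ee.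
rewrite IZ; last exact: sqi_sqr (sqiB fi (Asqi Ap)).
have J0 : 0 <= I (fun x => (f x - p x) ^+ 2) by apply: I_ge0 => x; exact: sqr_ge0.
rewrite ltr_pdivlMr// in fp; nra.
Qed.

Lemma apx_sum (J : Type) (r : seq J) (F : J -> T -> R) : (forall j, sqi P (F j)) ->
  (forall j, apx (F j)) -> apx (fun x => \sum_(j <- r) F j x).
Proof.
move=> iF aF; elim: r => [|j r ih].
  under eq_fun do rewrite big_nil.
  have := apx_self (AZ 0 A1); by under eq_fun do rewrite mul0r.
by under eq_fun do rewrite big_cons; apply: apxD => //; exact: sqi_sum.
Qed.

Lemma apx_lim (fn : nat -> T -> R) f g :
  (forall n, measurable_fun setT (fn n)) -> measurable_fun setT f -> sqi P g ->
  (forall n x, `|fn n x| <= g x) -> (forall x, `|f x| <= g x) ->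
  {ae P, forall x, fn ^~ x @ \oo --> f x} ->
  (forall n, apx (fn n)) -> apx f.
Proof.
move=> mfn mf gi fng fg cv afn e e0.
have cv0 := sqi_dominated_convergence mfn mf gi fng fg cv.
have e4 : 0 < e / 4 by rewrite divr_gt0.
have /cvgrPdist_lt/(_ _ e4) [N _ /(_ N (leqnn N))] := cv0.
rewrite /= sub0r normrN => hN.
have [p Ap fp] := afn N _ e4; exists p => //.
have ng x : `|g x| = g x by rewrite ger0_norm// (le_trans _ (fg x)).
have fni : sqi P (fn N) by apply: (sqi_le (mfn N) _ gi) => x; rewrite ng.
have fi : sqi P f by apply: (sqi_le mf _ gi) => x; rewrite ng.
have ee x : (f x - p x) ^+ 2 = ((-1) * (fn N x - f x) + (fn N x - p x)) ^+ 2 by ring.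
under eq_Rintegral do rewrite ee.
rewrite (le_lt_trans (I_sqrD_le (sqiZ _ (sqiB fni fi)) (sqiB fni (Asqi Ap))))//.
under eq_Rintegral do rewrite exprMn sqrrN expr1n mul1r.
by have := ler_norm (I (fun x => (fn N x - f x) ^+ 2)); lra.
Qed.

Let sqi_indic (D : set T) : measurable D -> sqi P (\1_D : T -> R).
Proof.
move=> mD; apply: (@sqi_bounded _ _ _ _ _ 1); first exact: measurable_indic.
by move=> x; rewrite ger0_norm// indicE; case: (_ \in _).
Qed.

Section generated.
Variable G : set (set T).
Hypothesis GE : @measurable _ T = <<s G >>.
Hypothesis GI : setI_closed G.
Hypothesis GA : forall D, G D -> apx (\1_D : T -> R).

(** The sets whose indicators are approximated form a Dynkin system. *)
Lemma apx_indic (D : set T) : measurable D -> apx (\1_D : T -> R).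
Proof.
rewrite GE; move: D; apply: (dynkin_induction GE GI).
- by rewrite indicT; exact: apx_self.
- by move=> D /GA.
- move=> D mD aD; have -> : \1_(~` D) = (fun x => (1 : R) + (-1) * \1_D x).
    by apply/funext => x; rewrite !indicE in_setC; case: (x \in D) => /=; ring.
  apply: apxD.
  + by apply: Asqi.
  + by apply: sqiZ; exact: sqi_indic.
  + exact: apx_self.
  + by apply: apxZ => //; exact: sqi_indic.
- move=> F mF tF aF.
  pose fn n (x : T) : R := \sum_(k < n) \1_(F k) x.
  have fnE n x k : F k x -> fn n x = (k < n)%:R.
    move=> Fkx.
    rewrite /fn (eq_bigr (fun j : 'I_n => (j == k :> nat)%:R)); last first.
      move=> j _; rewrite indicE; case: eqP => [->|jk]; first by rewrite mem_set.
      rewrite memNset// => Fjx; apply: jk.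
      by apply: (tF j k) => //; exists x.
    case: ltnP => [kn|nk].
      rewrite (bigD1 (Ordinal kn))//= eqxx big1 ?addr0// => j /negbTE jk.
      by rewrite -val_eqE/= in jk; rewrite jk.
    rewrite big1// => j _; case: eqP => // jk.
    by have := ltn_ord j; rewrite jk ltnNge nk.
  have fn0 n x : ~ (exists k, F k x) -> fn n x = 0.
    move=> nF; rewrite /fn big1// => j _; rewrite indicE memNset// => Fjx.
    by apply: nF; exists j.
  have mU : measurable (\bigcup_k F k) by exact: bigcup_measurable.
  apply: (@apx_lim fn _ (fun=> 1)).
  + by move=> n; apply: measurable_sum => k; exact: measurable_indic.
  + exact: measurable_indic.
  + exact: Asqi.
  + move=> n x; have [[k Fkx]|nF] := pselect (exists k, F k x).
      by rewrite (fnE _ _ _ Fkx); case: ltnP; rewrite ?normr1 ?normr0.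
    by rewrite fn0// normr0.
  + by move=> x; rewrite indicE; case: (_ \in _); rewrite ?normr1 ?normr0.
  + apply: nearW => x; have [[k Fkx]|nF] := pselect (exists k, F k x).
      rewrite indicE mem_set; last by exists k.
      apply: cvg_near_cst; exists k.+1 => // n /= kn.
      by rewrite (fnE _ _ _ Fkx) kn.
    rewrite indicE memNset; last by move=> [k _ Fkx]; apply: nF; exists k.
    by apply: cvg_near_cst; apply: nearW => n; rewrite fn0.
  + move=> n; apply: apx_sum => k; first exact: sqi_indic.
    exact: aF.
Qed.

Let apx_ge0 f : sqi P f -> (forall x, 0 <= f x) -> apx f.
Proof.
move=> fi f0; have mf : measurable_fun setT (EFin \o f) by apply/measurable_EFinP; case: fi.
pose s := nnsfun_approx measurableT mf.
have sf n x : s n x <= f x.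
  by rewrite -lee_fin /s nnsfun_approxE; apply: le_approx => // t _; rewrite /= lee_fin.
apply: (@apx_lim (fun n => s n) f f) => //.
- by case: fi.
- by move=> n x; rewrite ger0_norm.
- by move=> x; rewrite ger0_norm.
- apply: nearW => x; have := @cvg_nnsfun_approx _ _ _ _ measurableT _ mf _ x Logic.I.
  by move=> /(_ (fun t _ => f0 t)) /fine_cvg.
move=> n.
have -> : (s n : T -> R) = (fun x => \sum_(y <- fset_set (range (s n))) y * \1_(s n @^-1` [set y]) x).
  by apply/funext => x; rewrite fimfunE fsbig_finite.
apply: apx_sum => y; first by apply: sqiZ; exact: sqi_indic.
apply: apxZ; first exact: sqi_indic.
exact: apx_indic.
Qed.

(** From indicators of measurable sets, linearity reaches simple functions and
    dominated convergence nonnegative ones. *)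
Theorem apx_sqi f : sqi P f -> apx f.
Proof.
move=> fi; have mf := sqi_measurable fi.
have -> : f = (fun x => Num.max (f x) 0 + (-1) * Num.max (- f x) 0).
  by apply/funext => x; rewrite !maxEle oppr_le0; case: ifPn; case: ifPn;
    rewrite -?ltNge => h1 h2; lra.
have i1 : sqi P (fun x => Num.max (f x) 0).
  apply: sqi_le fi; first by apply: measurable_maxr.
  by move=> x; rewrite maxEle; case: ifPn => _; rewrite ?normr0.
have i2 : sqi P (fun x => Num.max (- f x) 0).
  apply: sqi_le fi; first by apply: measurable_maxr => //; exact: measurableT_comp.
  by move=> x; rewrite maxEle; case: ifPn => _; rewrite ?normr0 ?normrN.
apply: apxD => //; first exact: sqiZ.
  by apply: apx_ge0 => // x; rewrite le_max lexx orbT.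
apply: apxZ => //.
by apply: apx_ge0 => // x; rewrite le_max lexx orbT.
Qed.

End generated.
End square_density.

(** * Integration on the torus *)

Section uniform_integral.
Context {R : realType}.
Local Notation U := (uniform_prob (@ltr01 R)).

Lemma uniform_integral_FTC (g G : R -> R) : continuous g -> (forall t, `|g t| <= 1) ->
  (forall t : R, is_derive t (1 : R) G (g t)) ->
  Rintegral U setT g = G 1 - G 0.
Proof.
move=> cg g1 dG.
have mg : measurable_fun setT g by exact: continuous_measurable_fun.
have ig : itg U g by exact: (@itg_bounded _ _ _ U g 1 mg g1).
(* The uniform law integrates nonnegative functions against its density. *)
have pos t : 0 <= 1 + g t by have := g1 t; rewrite ler_norml => /andP[]; lra.
have := ID (itg_cst U 1) ig; rewrite Icst => e.
suff : Rintegral U setT (fun t => 1 + g t) = 1 + (G 1 - G 0).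
  by rewrite e => /addrI.
rewrite /Rintegral integral_uniform; last 2 first.
- by apply/measurable_EFinP; apply: measurable_funD.
- by move=> x; rewrite lee_fin.
rewrite subr0 invr1 mul1e.
rewrite (@continuous_FTC2 _ _ (fun t => t + G t)) ?ltr01//=.
- by rewrite add0r; ring.
- by apply: continuous_subspaceT => t; apply: cvgD; [exact: cvg_cst|exact: cg].
- have dd t : derivable (fun t => t + G t) t 1.
    by apply: derivableD => //; case: (dG t).
  have cc : continuous (fun t => t + G t).
    by move=> t; apply: differentiable_continuous; apply/derivable1_diffP.
  split; first by move=> t _.
  + by apply: cvg_at_right_filter; exact: cc.
  + by apply: cvg_at_left_filter; exact: cc.
- move=> t _; rewrite derive1E; have := is_deriveD (is_derive_id t (1 : R)) (dG t).
  by move=> h; rewrite (@derive_val _ _ _ _ _ _ _ h).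
Qed.

End uniform_integral.

Section torus_measure.
Context {R : realType}.
Local Notation U := (uniform_prob (@ltr01 R)).
Local Notation "'I[' n ]" := (Rintegral (torus_prob R n) setT).

Definition phase n (m : 'rV[int]_n) (x : 'rV[R]_n) : R :=
  2 * pi * \sum_i intv R m 0 i * x 0 i.

Lemma fexpE n (m : 'rV[int]_n) x : fexp m x = Complex (cos (phase m x)) (sin (phase m x)).
Proof. by []. Qed.

Lemma measurable_coord n (i : 'I_n) : measurable_fun setT (fun x : 'rV[R]_n => x 0 i : R).
Proof. exact: measurable_rV_coord. Qed.

Lemma measurable_phase n (m : 'rV[int]_n) : measurable_fun setT (phase m).
Proof.
apply: measurable_funM; first exact: measurable_cst.
apply: measurable_sum => i; apply: measurable_funM; first exact: measurable_cst.
exact: measurable_coord.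
Qed.

Lemma measurable_cos_phase n (m : 'rV[int]_n) : measurable_fun setT (fun x => cos (phase m x)).
Proof.
apply: measurableT_comp; last exact: measurable_phase.
by apply: continuous_measurable_fun; exact: continuous_cos.
Qed.

Lemma measurable_sin_phase n (m : 'rV[int]_n) : measurable_fun setT (fun x => sin (phase m x)).
Proof.
apply: measurableT_comp; last exact: measurable_phase.
by apply: continuous_measurable_fun; exact: continuous_sin.
Qed.

(** Fubini, one coordinate at a time: the torus measure is an image of a
    product measure. *)
Lemma torus_integral_cons n (f : 'rV[R]_n.+1 -> R) (M : R) :
  measurable_fun setT f -> (forall x, `|f x| <= M) ->
  I[n.+1] f = Rintegral U setT (fun t => I[n] (fun x => f (rV_cons (t, x)))).
Proof.
move=> mf fM.
have mfc : measurable_fun setT (f \o @rV_cons R n).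
  by apply: measurableT_comp => //; exact: measurable_rV_cons.
have mfs t : measurable_fun setT (fun x => f (rV_cons (t, x))).
  by apply: (measurableT_comp mfc); exact: measurable_pair1.
have ifc : (U \x torus_prob R n)%E.-integrable setT (EFin \o (f \o @rV_cons R n)).
  by apply: (@itg_bounded _ _ _ _ _ M) => // p; exact: fM.
rewrite /Rintegral; congr fine.
rewrite [LHS]integral_distribution/=; last 2 first.
- exact/measurable_EFinP.
- exact: ifc.
rewrite -(integral12_prod_meas1 ifc); apply: eq_integral => t _.
rewrite /= fineK//.
apply: (integrable_fin_num measurableT).
by apply: (@itg_bounded _ _ _ (torus_prob R n) _ M) => // x; exact: fM.
Qed.

Lemma rV_cons0 n (p : measurableTypeR R * 'rV[R]_n) : rV_cons p 0 ord0 = p.1.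
Proof.
rewrite /rV_cons (_ : ord0 = @lshift 1 n ord0); last exact: val_inj.
by rewrite (@row_mxEl _ 1 1 n) mxE.
Qed.

Lemma rV_consS n (p : measurableTypeR R * 'rV[R]_n) i :
  rV_cons p 0 (lift ord0 i) = p.2 0 i.
Proof.
rewrite /rV_cons (_ : lift ord0 i = @rshift 1 n i); last exact: val_inj.
by rewrite (@row_mxEr _ 1 1 n).
Qed.

Lemma phase_cons n (m : 'rV[int]_n.+1) t (x : 'rV[R]_n) :
  phase m (rV_cons (t, x)) =
  2 * pi * ((m ord0 ord0)%:~R * t) + phase (\row_i m ord0 (lift ord0 i)) x.
Proof.
rewrite /phase big_ord_recl rV_cons0/= mxE mulrDr; congr (_ + _ * _).
by apply: eq_bigr => i _; rewrite rV_consS !mxE.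
Qed.

Lemma uniform_full_period (k : int) (f F : R -> R) : k != 0 -> continuous f ->
  (forall t, `|f t| <= 1) -> (forall t : R, is_derive t (1 : R) F (f t)) ->
  F (2 * pi * k%:~R) = F 0 -> Rintegral U setT (fun t => f (2 * pi * (k%:~R * t))) = 0.
Proof.
move=> k0 cf f1 dF F0; pose w : R := 2 * pi * k%:~R.
have w0 : w != 0 by rewrite !mulf_neq0 ?pnatr_eq0 ?intr_eq0// gt_eqF// pi_gt0.
under eq_Rintegral do rewrite mulrA -/w.
transitivity (w^-1 * F (w * 1) - w^-1 * F (w * 0)); last first.
  by rewrite mulr0 mulr1 /w F0 subrr.
apply: (@uniform_integral_FTC _ _ (fun t => w^-1 * F (w * t))) => // t.
  apply: (@continuous_comp _ _ _ (fun t => w * t) f); last exact: cf.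
  exact: mulrl_continuous.
have d1 : is_derive t (1 : R) (fun t => w * t) w.
  by have := is_deriveZ w (is_derive_id t (1 : R)); rewrite /GRing.scale/= mulr1.
have d2 : is_derive t (1 : R) (fun t => F (w * t)) (f (w * t) * w).
  by have := is_derive1_comp (dF (w * t)) d1; rewrite /GRing.scale/=.
have := is_deriveZ w^-1 d2; rewrite /GRing.scale/=.
by rewrite mulrCA mulVf// mulr1.
Qed.

Lemma norm_cos_le1 (t : R) : `|cos t| <= 1.
Proof. by rewrite ler_norml cos_geN1 cos_le1. Qed.

Lemma norm_sin_le1 (t : R) : `|sin t| <= 1.
Proof. by rewrite ler_norml sin_geN1 sin_le1. Qed.

Lemma uniform_cos (k : int) : Rintegral U setT (fun t => cos (2 * pi * (k%:~R * t))) = (k == 0)%:R.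
Proof.
have [->|k0] := eqVneq k 0.
  under eq_Rintegral do rewrite mul0r mulr0 cos0.
  exact: Icst.
apply: (uniform_full_period (F := @sin R) k0 (@continuous_cos R) norm_cos_le1).
by rewrite (cos_sin_2pi_int k).2 sin0.
Qed.

Lemma uniform_sin (k : int) : Rintegral U setT (fun t => sin (2 * pi * (k%:~R * t))) = 0.
Proof.
have [->|k0] := eqVneq k 0.
  under eq_Rintegral do rewrite mul0r mulr0 sin0.
  exact: Icst.
apply: (uniform_full_period (F := fun t => - cos t) k0 (@continuous_sin R) norm_sin_le1).
  by move=> t; rewrite -[sin t]opprK; apply: is_deriveN.
by rewrite (cos_sin_2pi_int k).1 cos0.
Qed.

Lemma itg_cos_phase n (m : 'rV[int]_n) : itg (torus_prob R n) (fun x => cos (phase m x)).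
Proof.
apply: (@itg_bounded _ _ _ _ _ 1); first exact: measurable_cos_phase.
by move=> x; exact: norm_cos_le1.
Qed.

Lemma itg_sin_phase n (m : 'rV[int]_n) : itg (torus_prob R n) (fun x => sin (phase m x)).
Proof.
apply: (@itg_bounded _ _ _ _ _ 1); first exact: measurable_sin_phase.
by move=> x; exact: norm_sin_le1.
Qed.

Lemma torus_integral_cos_sin n (m : 'rV[int]_n) :
  I[n] (fun x => cos (phase m x)) = (m == 0)%:R /\ I[n] (fun x => sin (phase m x)) = 0.
Proof.
elim: n m => [|n ih] m.
  have m0 : m = 0 by apply/rowP => -[].
  have p0 (k : 'rV[int]_0) x : phase k x = 0 by rewrite /phase big_ord0 mulr0.
  rewrite m0 eqxx; split.
    by under eq_Rintegral do rewrite p0 cos0; exact: Icst.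
  by under eq_Rintegral do rewrite p0 sin0; exact: Icst.
set m0 := m ord0 ord0; pose m' := \row_i m ord0 (lift ord0 i).
have mE : (m == 0) = (m0 == 0) && (m' == 0).
  apply/eqP/andP => [m00|[/eqP e0 /eqP e1]].
    split; apply/eqP; first by rewrite /m0 m00 mxE.
    by apply/rowP => i; rewrite /m' !mxE m00 mxE.
  apply/rowP => j; have [i ->|->] := unliftP ord0 j.
    by have := congr1 (fun v : 'rV_n => v ord0 i) e1; rewrite !mxE.
  by rewrite mxE.
have [c s] := ih m'.
pose al t : R := 2 * pi * (m0%:~R * t).
have mal : measurable_fun setT al.
  by do 2 (apply: measurable_funM; first exact: measurable_cst); exact: measurable_id.
have mcal : measurable_fun setT (cos \o al).
  by apply: measurableT_comp => //; apply: continuous_measurable_fun; exact: continuous_cos.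
have msal : measurable_fun setT (sin \o al).
  by apply: measurableT_comp => //; apply: continuous_measurable_fun; exact: continuous_sin.
have icos : itg U (fun t => cos (al t)).
  by apply: (@itg_bounded _ _ _ U _ 1) => // t; exact: norm_cos_le1.
have isin : itg U (fun t => sin (al t)).
  by apply: (@itg_bounded _ _ _ U _ 1) => // t; exact: norm_sin_le1.
split.
  rewrite (torus_integral_cons (M := 1)); last 2 first.
  - exact: measurable_cos_phase.
  - by move=> x; exact: norm_cos_le1.
  rewrite (_ : (fun t => _) = (fun t => (m' == 0)%:R * cos (al t))); last first.
    apply/funext => t.
    rewrite (_ : (fun x => _) = (fun x => cos (al t) * cos (phase m' x) - sin (al t) * sin (phase m' x))); last first.
      by apply/funext => x; rewrite phase_cons cosD.
    rewrite IB; [|by apply: itgZ; exact: itg_cos_phase|by apply: itgZ; exact: itg_sin_phase].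
    rewrite !IZ; [|exact: itg_sin_phase|exact: itg_cos_phase].
    by rewrite c s mulr0 subr0 mulrC.
  by rewrite IZ// uniform_cos mE andbC -mulnb natrM.
rewrite (torus_integral_cons (M := 1)); last 2 first.
- exact: measurable_sin_phase.
- by move=> x; exact: norm_sin_le1.
rewrite (_ : (fun t => _) = (fun t => (m' == 0)%:R * sin (al t))); last first.
  apply/funext => t.
  rewrite (_ : (fun x => _) = (fun x => sin (al t) * cos (phase m' x) + cos (al t) * sin (phase m' x))); last first.
    by apply/funext => x; rewrite phase_cons sinD.
  rewrite ID; [|by apply: itgZ; exact: itg_cos_phase|by apply: itgZ; exact: itg_sin_phase].
  rewrite !IZ; [|exact: itg_sin_phase|exact: itg_cos_phase].
  by rewrite c s mulr0 addr0 mulrC.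
by rewrite IZ// uniform_sin mulr0.
Qed.

End torus_measure.

(** * Trigonometric approximation of steps *)

Section smooth_step.
Context {R : realType}.
Implicit Types (b t p : R).

(** Bernoulli's inequality, applied from both sides, drives this to 0 when
    [p < 1 / 2] and to 1 when [p > 1 / 2]. *)
Definition step_iter (n : nat) p : R := 1 - (1 - p ^+ n) ^+ (2 ^ n).

Lemma bernoulli_ge (y : R) N : 0 <= y <= 1 -> 1 - N%:R * y <= (1 - y) ^+ N.
Proof.
move=> /andP[y0 y1]; elim: N => [|N ih]; first by rewrite mul0r subr0 expr0.
rewrite exprS (le_trans _ (ler_wpM2l _ ih)) ?subr_ge0//.
rewrite -[N.+1%:R]natr1; have := mulr_ge0 (ler0n R N) (sqr_ge0 y); move: (N%:R : R) => z; nra.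
Qed.

Lemma bernoulli_le (y : R) N : 0 <= y <= 1 -> (1 - y) ^+ N * (1 + N%:R * y) <= 1.
Proof.
move=> /andP[y0 y1].
have h : 1 + N%:R * y <= (1 + y) ^+ N.
  elim: N => [|N ih]; first by rewrite mul0r addr0 expr0.
  rewrite exprS (le_trans _ (ler_wpM2l _ ih)) ?addr_ge0//.
  rewrite -[N.+1%:R]natr1; have := mulr_ge0 (ler0n R N) (sqr_ge0 y); move: (N%:R : R) => z; nra.
rewrite (le_trans (ler_wpM2l _ h)) ?exprn_ge0 ?subr_ge0//.
by rewrite -exprMn exprn_ile1//; nra.
Qed.

Lemma step_iter_ge0_le1 n p : 0 <= p <= 1 -> 0 <= step_iter n p <= 1.
Proof.
move=> /andP[p0 p1]; have pn0 := exprn_ge0 n p0.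
have pn1 : p ^+ n <= 1 by rewrite exprn_ile1.
have a0 : 0 <= 1 - p ^+ n by lra.
have a1 : 1 - p ^+ n <= 1 by lra.
rewrite /step_iter subr_ge0 exprn_ile1//=.
by rewrite gerBl exprn_ge0.
Qed.

Lemma cvg_step_iter0 p : 0 <= p < 1 / 2 -> step_iter n p @[n --> \oo] --> (0 : R).
Proof.
move=> /andP[p0 p2].
have c : (2 * p) ^+ n @[n --> \oo] --> (0 : R).
  by apply: cvg_expr; rewrite ger0_norm; lra.
apply: (squeeze_cvgr _ (cvg_cst (0 : R)) c).
apply: nearW => n; have p1 : p <= 1 by lra.
have /andP[-> _] := @step_iter_ge0_le1 n p (introT andP (conj p0 p1)).
have := @bernoulli_ge (p ^+ n) (2 ^ n); rewrite exprn_ge0//= exprn_ile1// => /(_ isT).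
by rewrite /step_iter exprMn natrX; lra.
Qed.

Lemma cvg_step_iter1 p : 1 / 2 < p <= 1 -> step_iter n p @[n --> \oo] --> (1 : R).
Proof.
move=> /andP[p2 p1]; have p0 : 0 <= p by lra.
have q0 : 0 < 2 * p by lra.
have c : 1 - (2 * p)^-1 ^+ n @[n --> \oo] --> (1 : R).
  rewrite -[X in _ --> X]subr0; apply: cvgB; first exact: cvg_cst.
  apply: cvg_expr; rewrite ger0_norm ?invr_ge0 ?(ltW q0)//.
  by rewrite invf_lt1//; lra.
apply: (squeeze_cvgr _ c (cvg_cst (1 : R))).
apply: nearW => n.
have /andP[_ ->] := @step_iter_ge0_le1 n p (introT andP (conj p0 p1)).
rewrite andbT /step_iter lerD2l lerN2 exprVn.
have := @bernoulli_le (p ^+ n) (2 ^ n); rewrite exprn_ge0//= exprn_ile1// => /(_ isT).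
rewrite natrX -exprMn => h; have Q0 : 0 < (2 * p) ^+ n by rewrite exprn_gt0.
rewrite -[leRHS]mul1r ler_pdivlMr// (le_trans _ h)// ler_wpM2l ?lerDr//.
by rewrite exprn_ge0// subr_ge0 exprn_ile1.
Qed.

(** For [b] and [t] inside the unit interval, this trigonometric polynomial in
    [t] exceeds 1/2 exactly when [t < b], as [bumpcosE] shows; [step_iter] then
    sharpens it into the indicator of [t < b]. *)
Definition bumpcos b t : R := 1 / 2 + (cos (2 * pi * t - pi * b) - cos (pi * b)) / 4.

Lemma bumpcos_ge0_le1 b t : 0 <= bumpcos b t <= 1.
Proof.
have := cos_geN1 (2 * pi * t - pi * b); have := cos_le1 (2 * pi * t - pi * b).
have := cos_geN1 (pi * b); have := cos_le1 (pi * b).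
rewrite /bumpcos => *; apply/andP; split; lra.
Qed.

Lemma bumpcosE b t : bumpcos b t = 1 / 2 + sin (pi * t) * sin (pi * (b - t)) / 2.
Proof.
rewrite /bumpcos; congr (_ + _).
have -> : 2 * pi * t - pi * b = pi * t - pi * (b - t) by ring.
have -> : cos (pi * b) = cos (pi * t + pi * (b - t)) by congr cos; ring.
by rewrite cosB cosD; field.
Qed.

Definition smooth_step n b t : R :=
  if b <= 0 then 0 else if 1 <= b then 1 else step_iter n (bumpcos b t).

Lemma smooth_step_ge0_le1 n b t : 0 <= smooth_step n b t <= 1.
Proof.
rewrite /smooth_step; case: ifPn => _; first by rewrite lexx ler01.
case: ifPn => _; first by rewrite lexx ler01.
by rewrite step_iter_ge0_le1// bumpcos_ge0_le1.
Qed.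

Lemma cvg_smooth_step b t : 0 < t < 1 -> t != b ->
  smooth_step n b t @[n --> \oo] --> ((t < b)%R%:R : R).
Proof.
move=> /andP[t0 t1] tb; rewrite /smooth_step.
have [b0|b0] := leP b 0.
  by rewrite ltNge (le_trans b0) ?(ltW t0)//=; exact: cvg_cst.
have [b1|b1] := leP 1 b; first by rewrite (lt_le_trans t1 b1); exact: cvg_cst.
have pi0 := @pi_gt0 R.
have st : 0 < sin (pi * t) by rewrite sin_gt0_pi// mulr_gt0//= gtr_pMr.
have /andP[c0 c1] := bumpcos_ge0_le1 b t.
have [bt|bt|e] := ltgtP t b; last by rewrite e eqxx in tb.
  apply: cvg_step_iter1; rewrite c1 andbT bumpcosE ltrDl divr_gt0// mulr_gt0//.
  by rewrite sin_gt0_pi// mulr_gt0 ?subr_gt0//= gtr_pMr//; lra.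
apply: cvg_step_iter0; rewrite c0/= bumpcosE gtrDl pmulr_llt0// pmulr_rlt0//.
rewrite -opprB mulrN sinN oppr_lt0.
by rewrite sin_gt0_pi// mulr_gt0 ?subr_gt0//= gtr_pMr//; lra.
Qed.

End smooth_step.

(** * Density of trigonometric polynomials *)

Section trigonometric_density.
Context {R : realType} {d : nat}.
Local Notation C := R[i].
Local Notation Z := 'rV[int]_d.
Local Notation V := 'rV[R]_d.
Local Notation T := (torus_prob R d).
Implicit Types (f g : V -> R).

Definition rtrig f := exists n (a : Z -> C), supp n a /\ forall x, (f x)%:C = tp n a x.

Lemma rtrigD f g : rtrig f -> rtrig g -> rtrig (fun x => f x + g x).
Proof.
move=> [n [a [an fa]]] [k [b [bk gb]]].
exists (n + k)%N, (fun m => a m + b m); split.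
  move=> m mn; rewrite (supp_le (leq_addr k n) an mn) (supp_le (leq_addl n k) bk mn).
  by rewrite addr0.
move=> x; rewrite realcD fa gb tpD.
by rewrite (tp_le _ (leq_addr k n) an) (tp_le _ (leq_addl n k) bk).
Qed.

Lemma rtrigM f g : rtrig f -> rtrig g -> rtrig (fun x => f x * g x).
Proof.
move=> [n [a [an fa]]] [k [b [bk gb]]].
exists (n + k)%N, (cv n a b); split; first exact: cv_supp.
by move=> x; rewrite realcM fa gb tp_cv.
Qed.

Lemma tp_delta n (k : Z) x : k \in cube n -> tp n (fun m => (m == k)%:R) x = fexp k x :> C.
Proof.
move=> kn; rewrite /tp (bigD1_seq k) ?uniq_cube//= eqxx mul1r big1 ?addr0//.
by move=> m /negbTE->; rewrite mul0r.
Qed.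

Lemma rtrig_cst (c : R) : rtrig (fun=> c).
Proof.
exists 0%N, (fun m => c%:C * (m == 0)%:R); split.
  move=> m m0; case: eqP => [e|]; last by rewrite mulr0.
  by rewrite e cube0 in m0.
by move=> x; rewrite tpZ tp_delta ?cube0// fexp0 mulr1.
Qed.

Lemma rtrigZ (c : R) f : rtrig f -> rtrig (fun x => c * f x).
Proof. by apply: rtrigM; exact: rtrig_cst. Qed.

Lemma rtrigB f g : rtrig f -> rtrig g -> rtrig (fun x => f x - g x).
Proof.
move=> rf rg; have := rtrigD rf (rtrigZ (-1) rg).
by under eq_fun do rewrite mulN1r.
Qed.

Lemma rtrigX f n : rtrig f -> rtrig (fun x => f x ^+ n).
Proof.
move=> rf; elim: n => [|n ih].
  by under eq_fun do rewrite expr0; exact: rtrig_cst.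
by under eq_fun do rewrite exprS; exact: rtrigM.
Qed.

Lemma rtrig_prod (I : Type) (r : seq I) (F : I -> V -> R) : (forall i, rtrig (F i)) ->
  rtrig (fun x => \prod_(i <- r) F i x).
Proof.
move=> rF; elim: r => [|i r ih].
  by under eq_fun do rewrite big_nil; exact: rtrig_cst.
by under eq_fun do rewrite big_cons; exact: rtrigM.
Qed.

Lemma Re_halfD (z : C) : (complex.Re z)%:C = 2^-1%:C * (z + conjc z).
Proof.
case: z => a b; apply/eqP; rewrite eq_complex/=.
by apply/andP; split; apply/eqP; field.
Qed.

Lemma Im_halfB (z : C) : (complex.Im z)%:C = Complex 0 (- 2^-1) * (z - conjc z).
Proof.
case: z => a b; apply/eqP; rewrite eq_complex/=.
by apply/andP; split; apply/eqP; field.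
Qed.

Lemma rtrig_Re n (a : Z -> C) : supp n a -> rtrig (fun x => complex.Re (tp n a x)).
Proof.
move=> an; exists n, (fun m => 2^-1%:C * (a m + conjc (a (- m)))); split.
  by move=> m mn; rewrite !an ?cubeN// conjc0 addr0 mulr0.
by move=> x; rewrite Re_halfD conj_tp tpZ tpD.
Qed.

Lemma rtrig_Im n (a : Z -> C) : supp n a -> rtrig (fun x => complex.Im (tp n a x)).
Proof.
move=> an; exists n, (fun m => Complex 0 (- 2^-1) * (a m - conjc (a (- m)))); split.
  by move=> m mn; rewrite !an ?cubeN// conjc0 subr0 mulr0.
by move=> x; rewrite Im_halfB conj_tp tpZ tpB.
Qed.

Lemma supp_delta n (k : Z) : k \in cube n -> supp n (fun m => (m == k)%:R : C).
Proof. by move=> kn m mn; case: eqP => // e; rewrite -e (negbTE mn) in kn. Qed.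

Lemma phase_unitv i (x : V) : phase (unitv i) x = 2 * pi * x 0 i.
Proof.
rewrite /phase (bigD1 i)//= big1 ?addr0 => [|j /negbTE ji].
  by rewrite !mxE !eqxx/= mul1r.
by rewrite !mxE ji andbF/= mul0r.
Qed.

Lemma rtrig_step n b i : rtrig (fun x => smooth_step n b (x 0 i)).
Proof.
rewrite /smooth_step; case: (b <= 0); first exact: rtrig_cst.
case: (1 <= b); first exact: rtrig_cst.
have c1 := cube_unitv i.
have rc : rtrig (fun x => cos (2 * pi * x 0 i)).
  have := rtrig_Re (supp_delta c1).
  by under eq_fun do rewrite tp_delta// fexpE/= phase_unitv.
have rs : rtrig (fun x => sin (2 * pi * x 0 i)).
  have := rtrig_Im (supp_delta c1).
  by under eq_fun do rewrite tp_delta// fexpE/= phase_unitv.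
apply: rtrigB; first exact: rtrig_cst.
apply: rtrigX; apply: rtrigB; first exact: rtrig_cst.
apply: rtrigX; rewrite /bumpcos.
apply: rtrigD; first exact: rtrig_cst.
under eq_fun do rewrite cosB mulrC.
apply: rtrigZ; apply: rtrigB; last exact: rtrig_cst.
by apply: rtrigD; apply: rtrigM => //; exact: rtrig_cst.
Qed.

Lemma measurable_tp n (a : Z -> C) :
  measurable_fun setT (fun x => complex.Re (tp n a x)) /\
  measurable_fun setT (fun x => complex.Im (tp n a x)).
Proof.
split.
  under eq_fun do rewrite Re_sum.
  apply: measurable_sum => m.
  rewrite (_ : (fun x => _) = (fun x => complex.Re (a m) * cos (phase m x) - complex.Im (a m) * sin (phase m x))).
    apply: measurable_funB; apply: measurable_funM => //.
      exact: measurable_cos_phase.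
    exact: measurable_sin_phase.
  by apply/funext => x; rewrite fexpE; case: (a m).
under eq_fun do rewrite Im_sum.
apply: measurable_sum => m.
rewrite (_ : (fun x => _) = (fun x => complex.Re (a m) * sin (phase m x) + complex.Im (a m) * cos (phase m x))).
  apply: measurable_funD; apply: measurable_funM => //.
    exact: measurable_sin_phase.
  exact: measurable_cos_phase.
by apply/funext => x; rewrite fexpE; case: (a m).
Qed.

Lemma nc_tp_le n (a : Z -> C) x : nc (tp n a x) <= \sum_(m <- cube n) nc (a m).
Proof.
rewrite (le_trans (nc_sum _ _ _))//; apply: ler_sum => m _.
by rewrite ncM nc_fexp mulr1.
Qed.

Lemma rtrig_bounded f : rtrig f -> exists M, forall x, `|f x| <= M.
Proof.
move=> [n [a [_ fa]]]; exists (\sum_(m <- cube n) nc (a m)) => x.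
by rewrite -nc_real fa nc_tp_le.
Qed.

Lemma rtrig_measurable f : rtrig f -> measurable_fun setT f.
Proof.
move=> [n [a [_ fa]]]; have [h _] := measurable_tp n a.
rewrite (_ : f = (fun x => complex.Re (tp n a x)))//.
by apply/funext => x; rewrite -fa.
Qed.

Lemma rtrig_sqi f : rtrig f -> sqi T f.
Proof.
move=> rf; have [M fM] := rtrig_bounded rf.
by apply: sqi_bounded fM; exact: rtrig_measurable.
Qed.

End trigonometric_density.

Section box_density.
Context {R : realType}.
Local Notation U := (uniform_prob (@ltr01 R)).

Lemma torus_marginal d (i : 'I_d) (f : R -> R) (M : R) : measurable_fun setT f ->
  (forall t, `|f t| <= M) ->
  Rintegral (torus_prob R d) setT (fun x => f (x 0 i)) = Rintegral U setT f.
Proof.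
elim: d i => [[]//|d ih] i mf fM.
have mfi : measurable_fun setT (fun x : 'rV[R]_d.+1 => f (x 0 i)).
  by apply: (measurableT_comp mf); exact: measurable_coord.
rewrite (torus_integral_cons (M := M) mfi) => [|x]; last exact: fM.
have [j ->|->] := unliftP ord0 i.
  under eq_Rintegral do under eq_Rintegral do rewrite rV_consS.
  under eq_Rintegral do rewrite (ih j mf fM).
  exact: Icst.
under eq_Rintegral do under eq_Rintegral do rewrite rV_cons0.
by apply: eq_Rintegral => t _ /=; rewrite Icst.
Qed.

Lemma torus_coord_null d (i : 'I_d) (B : set R) : measurable B -> U B = 0%E ->
  torus_prob R d [set x | B (x 0 i)] = 0%E.
Proof.
move=> mB UB0.
have mE : measurable ([set x : 'rV[R]_d | B (x 0 i)] : set 'rV[R]_d).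
  have := @measurable_coord R d i measurableT B mB.
  by rewrite setTI.
have b1 (t : R) : `|\1_B t| <= 1 :> R.
  by rewrite ger0_norm ?indicE//; case: (_ \in _).
have := @torus_marginal d i (\1_B : R -> R) 1 (measurable_indic mB) b1.
have UB : (\int[U]_t (\1_B t)%:E = 0)%E by rewrite integral_indic// setIT; exact: UB0.
rewrite /Rintegral UB/=.
rewrite (_ : (fun x => _) = (fun x => (\1_[set x : 'rV[R]_d | B (x 0 i)] x)%:E)); last first.
  by apply/funext => x; rewrite !indicE; congr (_%:R%:E); apply/idP/idP; rewrite !inE.
rewrite integral_indic// setIT => h.
rewrite -[LHS]fineK ?h//.
exact: fin_num_measure.
Qed.

Lemma uniform_exceptional_null (b : R) :
  U (~` `]0, 1[%classic `|` [set b]) = 0%E.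
Proof.
rewrite /uniform_prob integral_uniform_pdf.
apply/eqP; rewrite eq_le; apply/andP; split; last first.
  by apply: integral_ge0 => x _; rewrite lee_fin uniform_pdf_ge0.
set D := _ `&` _.
have D0 : (lebesgue_measure D = 0)%E.
  apply/eqP; rewrite eq_le measure_ge0 andbT.
  have sub : D `<=` [set 0] `|` [set 1] `|` [set b].
    move=> x [[]]; last by move=> -> _; right.
    rewrite /= !in_itv/= => /negP; rewrite negb_and -!leNgt => /orP[x0|x1] /andP[h0 h1].
      by left; left; apply/eqP; rewrite eq_le x0.
    by left; right; apply/eqP; rewrite eq_le x1 h1.
  have mD : measurable D.
    apply: measurableI => //; apply: measurableU => //; exact: measurableC.
  have m2 : measurable ([set 0] `|` [set 1] : set R) by exact: measurableU.
  have m3 : measurable ([set 0] `|` [set 1] `|` [set b] : set R) by exact: measurableU.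
  rewrite (le_trans (le_measure _ (mem_set mD) (mem_set m3) sub))//.
  rewrite (le_trans (measureU2 _ _ _))//.
  rewrite [X in (_ + X)%E](lebesgue_measure_set1 b) adde0 (le_trans (measureU2 _ _ _))//.
  by rewrite [X in (_ + X)%E](lebesgue_measure_set1 1) [X in (X + _)%E](lebesgue_measure_set1 0) adde0.
rewrite le_eqVlt; apply/orP; left; apply/eqP.
apply: null_set_integral => //.
  by apply: measurableI => //; apply: measurableU => //; exact: measurableC.
by apply: measurable_funTS; apply/measurable_EFinP; exact: measurable_uniform_pdf.
Qed.

(** Off these null sets the approximate steps converge in every coordinate. *)
Lemma torus_generic d (b : 'rV[R]_d) :
  {ae torus_prob R d, forall x : 'rV[R]_d, forall i, 0 < x 0 i < 1 /\ x 0 i != b 0 i}.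
Proof.
have bad i : (torus_prob R d).-negligible
    [set x : 'rV[R]_d | (~` `]0, 1[%classic `|` [set b 0 i]) (x 0 i)].
  have mB : measurable (~` `]0, 1[%classic `|` [set b 0 i] : set R).
    by apply: measurableU => //; exact: measurableC.
  exists [set x : 'rV[R]_d | (~` `]0, 1[%classic `|` [set b 0 i]) (x 0 i)]; split => //.
    have := @measurable_coord R d i measurableT _ mB.
    by rewrite setTI.
  exact: torus_coord_null (uniform_exceptional_null _).
rewrite /almost_everywhere/=.
have : (torus_prob R d).-negligible (\big[setU/set0]_(i < d)
    [set x : 'rV[R]_d | (~` `]0, 1[%classic `|` [set b 0 i]) (x 0 i)]).
  elim/big_ind : _ => [|A B nA nB|i _].
  - exact: negligible_set0.
  - exact: negligibleU.
  - exact: bad.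
move=> h; apply: negligibleS h => x /= /existsNP[i hi].
rewrite -bigcup_seq; exists i => /=; first by rewrite mem_index_enum.
apply: contrapT => /not_orP[/contrapT h1 h2]; apply: hi; split.
  by move: h1; rewrite /= in_itv.
by apply/eqP.
Qed.

Context {d : nat}.
Local Notation T := (torus_prob R d).
Local Notation V := 'rV[R]_d.

(** Unbounded boxes suffice to generate, and their indicators are products of
    one-dimensional steps. *)
Definition boxes : set (set V) :=
  [set D | exists b : V, D = [set x : V | forall i, x 0 i < b 0 i]].

Lemma boxes_setI : setI_closed boxes.
Proof.
move=> _ _ [b ->] [c ->]; exists (\row_i Num.min (b 0 i) (c 0 i)).
apply/seteqP; split => x /=.
  by move=> [xb xc] i; rewrite mxE lt_min xb xc.
by move=> h; split=> i; have := h i; rewrite mxE lt_min => /andP[].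
Qed.

Lemma boxes_generate : @measurable _ V = <<s boxes >>.
Proof.
apply/seteqP; split; last first.
  apply: smallest_sub; first exact: sigma_algebra_measurable.
  move=> _ [b ->].
  rewrite (_ : [set x | _] = \big[setI/setT]_(i < d) [set x : V | x 0 i < b 0 i]).
    apply: bigsetI_measurable => i _.
    have := @measurable_coord R d i measurableT `]-oo, b 0 i[%classic (measurable_itv _).
    by rewrite setTI; congr measurable; apply/seteqP; split => x; rewrite /= in_itv.
  apply/seteqP; split => x /=.
    by move=> h; rewrite -bigcap_seq => i _; exact: h.
  by rewrite -bigcap_seq => h i; apply: (h i); rewrite /= mem_index_enum.
apply: smallest_sub; first exact: smallest_sigma_algebra.
rewrite -bigcup_seq => A [i _] [B mB <-]; rewrite setTI.
pose X := g_sigma_algebraType boxes.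
have mi : measurable_fun setT (fun x : X => (x : V) 0 i : R).
  apply: (measurability (@RGenInftyO.G R)).
    exact: RGenInftyO.measurableE.
  move=> _ [_ [r ->] <-]; rewrite setTI.
  rewrite (_ : _ @^-1` _ = \bigcup_n [set x : X | forall j, (x : V) 0 j < if j == i then r else n%:R]).
    apply: bigcup_measurable => n _; apply: sub_sigma_algebra.
    exists (\row_j if j == i then r else n%:R).
    by apply/seteqP; split => x /= h j; have := h j; rewrite mxE.
  apply/seteqP; split => x /=.
    rewrite in_itv/= => xr.
    pose F (j : 'I_d) := Num.truncn `|(x : V) 0 j|.
    exists (\sum_(j < d) F j)%N.+1 => //= j.
    case: eqP => [->//|_].
    rewrite (le_lt_trans (ler_norm _))//.
    have /andP[_ h] := truncn_itv (normr_ge0 ((x : V) 0 j)).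
    rewrite (lt_le_trans h)// ler_nat ltnS (bigD1 j)//= leq_addr//.
  by move=> [n _ /(_ i)]; rewrite eqxx in_itv.
by have := mi measurableT B mB; rewrite setTI.
Qed.

Lemma cvg_prod_seq (I : Type) (r : seq I) (f : I -> nat -> R) (l : I -> R) :
  (forall i, f i n @[n --> \oo] --> l i) ->
  \prod_(i <- r) f i n @[n --> \oo] --> \prod_(i <- r) l i.
Proof.
move=> fl; elim: r => [|i r ih].
  by under eq_fun do rewrite big_nil; rewrite big_nil; exact: cvg_cst.
by under eq_fun do rewrite big_cons; rewrite big_cons; apply: cvgM => //; exact: fl.
Qed.

Lemma apx_box (D : set V) : boxes D -> apx T (@rtrig R d) (\1_D : V -> R).
Proof.
move=> [b DE].
have GD : <<s boxes >> D by apply: sub_sigma_algebra; exists b.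
have mD : measurable D by rewrite boxes_generate.
pose fn n (x : V) : R := \prod_(i < d) smooth_step n (b 0 i) (x 0 i).
have rfn n : rtrig (fn n) by apply: rtrig_prod => i; exact: rtrig_step.
apply: (@apx_lim _ _ _ T (@rtrig R d) _ fn _ (fun=> 1)).
- exact: rtrig_sqi.
- by move=> n; exact: rtrig_measurable.
- exact: measurable_indic.
- by apply: rtrig_sqi; exact: rtrig_cst.
- move=> n x; rewrite normr_prod; apply: prodr_ile1 => i _.
  by have /andP[h0 h1] := smooth_step_ge0_le1 n (b 0 i) (x 0 i); rewrite normr_ge0 ger0_norm.
- by move=> x; rewrite ger0_norm ?indicE//; case: (_ \in _).
- apply: filterS (torus_generic b) => x gx.
  have -> : \1_D x = \prod_(i < d) ((x 0 i < b 0 i)%R%:R : R).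
    rewrite indicE DE; have [h|h] := pselect (forall i, x 0 i < b 0 i).
      by rewrite mem_set// big1// => i _; rewrite h.
    rewrite memNset//; move/existsNP : h => [i /negP/negbTE hi].
    by rewrite (bigD1 i)//= hi mul0r.
  by apply: cvg_prod_seq => i; have [h1 h2] := gx i; exact: cvg_smooth_step.
- by move=> n; apply: apx_self.
Qed.

(** Real trigonometric polynomials are dense in [L^2] of the torus. *)
Theorem trigonometric_density (f : V -> R) : sqi T f -> apx T (@rtrig R d) f.
Proof.
move=> fi; apply: (apx_sqi _ _ _ _ boxes_generate boxes_setI apx_box) => //.
- exact: rtrigD.
- exact: rtrigZ.
- exact: rtrig_sqi.
- exact: rtrig_cst.
Qed.

End box_density.

(** * Fourier series of square-integrable functions *)

Section complex_integral.
Context {R : realType} {d : nat}.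
Local Notation C := R[i].
Local Notation Z := 'rV[int]_d.
Local Notation V := 'rV[R]_d.
Local Notation T := (torus_prob R d).
Local Notation I f := (Rintegral T setT f).
Implicit Types (F G : V -> C) (m : Z) (a : Z -> C).

Definition citg F := itg T (fun x => complex.Re (F x)) /\ itg T (fun x => complex.Im (F x)).

Lemma eq_cintegral F G : F =1 G -> cintegral F = cintegral G.
Proof. by move=> FG; congr cintegral; apply/funext. Qed.

Lemma citgD F G : citg F -> citg G -> citg (fun x => F x + G x).
Proof.
move=> [F1 F2] [G1 G2]; split.
  rewrite (_ : (fun x => _) = (fun x => complex.Re (F x) + complex.Re (G x))); first exact: itgD.
  by apply/funext => x; case: (F x) (G x) => ? ? [].
rewrite (_ : (fun x => _) = (fun x => complex.Im (F x) + complex.Im (G x))); first exact: itgD.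
by apply/funext => x; case: (F x) (G x) => ? ? [].
Qed.

Lemma cintegralD F G : citg F -> citg G ->
  cintegral (fun x => F x + G x) = cintegral F + cintegral G.
Proof.
move=> [F1 F2] [G1 G2]; rewrite /cintegral.
transitivity (Complex (I (fun x => complex.Re (F x)) + I (fun x => complex.Re (G x)))
  (I (fun x => complex.Im (F x)) + I (fun x => complex.Im (G x)))); last by [].
rewrite -(ID F1 G1) -(ID F2 G2).
by congr (_ +i* _); apply: eq_Rintegral => x _; case: (F x) (G x) => ? ? [].
Qed.

Lemma citgZ z F : citg F -> citg (fun x => z * F x).
Proof.
case: z => a b [F1 F2]; split.
  rewrite (_ : (fun x => _) = (fun x => a * complex.Re (F x) - b * complex.Im (F x))).
    by apply: itgB; exact: itgZ.
  by apply/funext => x; case: (F x).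
rewrite (_ : (fun x => _) = (fun x => a * complex.Im (F x) + b * complex.Re (F x))).
  by apply: itgD; exact: itgZ.
by apply/funext => x; case: (F x).
Qed.

Lemma cintegralZ z F : citg F -> cintegral (fun x => z * F x) = z * cintegral F.
Proof.
case: z => a b [F1 F2]; rewrite /cintegral.
have -> : I (fun x => complex.Re (Complex a b * F x)) = a * I (fun x => complex.Re (F x)) - b * I (fun x => complex.Im (F x)).
  rewrite -(IZ a F1) -(IZ b F2) -IB; [|exact: itgZ..].
  by apply: eq_Rintegral => x _; case: (F x).
have -> : I (fun x => complex.Im (Complex a b * F x)) = a * I (fun x => complex.Im (F x)) + b * I (fun x => complex.Re (F x)).
  rewrite -(IZ b F1) -(IZ a F2) -ID; [|exact: itgZ..].
  by apply: eq_Rintegral => x _; case: (F x).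
by [].
Qed.

Lemma cintegral0 : cintegral (fun _ : V => 0 : C) = 0.
Proof. by rewrite /cintegral !Icst. Qed.

Lemma citg0 : citg (fun=> 0).
Proof. by split; exact: itg_cst. Qed.

Lemma citg_sum (J : Type) (r : seq J) (F : J -> V -> C) : (forall j, citg (F j)) ->
  citg (fun x => \sum_(j <- r) F j x).
Proof.
move=> iF; elim: r => [|j r ih].
  by under eq_fun do rewrite big_nil; exact: citg0.
by under eq_fun do rewrite big_cons; exact: citgD.
Qed.

Lemma cintegral_sum (J : Type) (r : seq J) (F : J -> V -> C) : (forall j, citg (F j)) ->
  cintegral (fun x => \sum_(j <- r) F j x) = \sum_(j <- r) cintegral (F j).
Proof.
move=> iF; elim: r => [|j r ih].
  by under eq_fun do rewrite big_nil; rewrite big_nil cintegral0.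
under eq_fun do rewrite big_cons; rewrite big_cons cintegralD ?ih//.
exact: citg_sum.
Qed.

Lemma cintegral_real (f : V -> R) : cintegral (fun x => (f x)%:C) = (I f)%:C.
Proof. by rewrite /cintegral/= Icst. Qed.

Lemma cintegral_conj F : citg F -> cintegral (fun x => conjc (F x)) = conjc (cintegral F).
Proof.
move=> [F1 F2]; rewrite /cintegral/=; congr (_ +i* _).
  by apply: eq_Rintegral => x _; case: (F x).
rewrite -mulN1r -(IZ _ F2); apply: eq_Rintegral => x _.
by case: (F x) => ? ? /=; rewrite mulN1r.
Qed.

Lemma citg_fexp m : citg (fexp m).
Proof. by split; [exact: itg_cos_phase|exact: itg_sin_phase]. Qed.

Lemma cintegral_fexp m : cintegral (@fexp R d m) = (m == 0)%:R.
Proof.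
have [c s] := torus_integral_cos_sin (R := R) m.
rewrite /cintegral/=.
rewrite [X in X +i* _](_ : _ = (m == 0)%:R); last exact: c.
rewrite [X in _ +i* X](_ : _ = 0); last exact: s.
by case: (m == 0).
Qed.

Lemma citg_tp n a : citg (tp n a).
Proof. by apply: citg_sum => m; apply: citgZ; exact: citg_fexp. Qed.

Lemma cintegral_tp n a : cintegral (tp n a) = a 0.
Proof.
rewrite /tp cintegral_sum; last by move=> m; apply: citgZ; exact: citg_fexp.
rewrite (bigD1_seq 0) ?uniq_cube ?cube0//= big1 ?addr0.
  by rewrite cintegralZ ?cintegral_fexp ?eqxx ?mulr1//; exact: citg_fexp.
move=> m /negbTE m0; rewrite cintegralZ ?cintegral_fexp ?m0 ?mulr0//.
exact: citg_fexp.
Qed.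

End complex_integral.

Section parseval.
Context {R : realType} {d : nat}.
Local Notation C := R[i].
Local Notation Z := 'rV[int]_d.
Local Notation V := 'rV[R]_d.
Local Notation T := (torus_prob R d).
Local Notation I f := (Rintegral T setT f).
Implicit Types (f g h q : V -> R) (m : Z) (a : Z -> C).

Definition rcoef f m : C := fcoef (fun x => (f x)%:C) m.

Definition cutoff N a m : C := if m \in cube N then a m else 0.

Lemma supp_cutoff N a : supp N (cutoff N a).
Proof. by move=> m mN; rewrite /cutoff (negbTE mN). Qed.

Lemma tp_cutoff N a x : tp N (cutoff N a) x = tp N a x.
Proof.
by rewrite /tp big_seq [RHS]big_seq; apply: eq_bigr => m mN; rewrite /cutoff mN.
Qed.

Definition fsum N f x : R := complex.Re (tp N (rcoef f) x).

Lemma citg_mul_fexp f m : itg T f -> citg (fun x => (f x)%:C * fexp m x).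
Proof.
move=> fi; have mf := itg_measurable fi; split.
  under eq_fun do rewrite ReM_real.
  apply: (@itg_le _ _ _ _ _ (fun x => `|f x|)).
  - by apply: measurable_funM => //; exact: measurable_cos_phase.
  - by move=> x; rewrite normrM ler_piMr// (le_trans (nc_Re _))// nc_fexp.
  - exact: integrable_norm.
under eq_fun do rewrite ImM_real.
apply: (@itg_le _ _ _ _ _ (fun x => `|f x|)).
- by apply: measurable_funM => //; exact: measurable_sin_phase.
- by move=> x; rewrite normrM ler_piMr// (le_trans (nc_Im _))// nc_fexp.
- exact: integrable_norm.
Qed.

Lemma cintegral_mul_tp f n a : itg T f ->
  cintegral (fun x => (f x)%:C * tp n a x) = \sum_(m <- cube n) a m * rcoef f (- m).
Proof.
move=> fi; rewrite (eq_cintegral (G := fun x => \sum_(m <- cube n) a m * ((f x)%:C * fexp m x))); last first.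
  by move=> x; rewrite /tp mulr_sumr; apply: eq_bigr => m _; ring.
rewrite cintegral_sum => [|m]; last by apply: citgZ; exact: citg_mul_fexp.
apply: eq_bigr => m _; rewrite cintegralZ; last exact: citg_mul_fexp.
by rewrite /rcoef /fcoef opprK.
Qed.

Lemma rcoefN f m : itg T f -> rcoef f (- m) = conjc (rcoef f m).
Proof.
move=> fi; rewrite /rcoef /fcoef -cintegral_conj; last exact: citg_mul_fexp.
apply: eq_cintegral => x; rewrite conjcM fexpNl; congr (_ * _).
by apply/eqP; rewrite eq_complex/= oppr0 !eqxx.
Qed.

Lemma fsumE f N x : itg T f -> (fsum N f x)%:C = tp N (rcoef f) x.
Proof.
move=> fi; rewrite /fsum Re_halfD conj_tp -tpD -tpZ; apply: eq_tp => m.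
rewrite rcoefN// conjcI; apply/eqP; rewrite eq_complex/=.
by case: (rcoef f m) => a b /=; apply/andP; split; apply/eqP; field.
Qed.

Lemma rtrig_fsum f N : itg T f -> rtrig (fsum N f).
Proof.
move=> fi; exists N, (cutoff N (rcoef f)); split; first exact: supp_cutoff.
by move=> x; rewrite fsumE// tp_cutoff.
Qed.

Lemma I_fsum_proj f q N a : itg T f -> supp N a -> (forall x, (q x)%:C = tp N a x) ->
  sqi T f -> I (fun x => f x * q x) = I (fun x => fsum N f x * q x).
Proof.
move=> fi aN qa sf; apply: complexI; rewrite -!cintegral_real.
rewrite (eq_cintegral (G := fun x => (f x)%:C * tp N a x)); last first.
  by move=> x; rewrite realcM qa.
rewrite [RHS](eq_cintegral (G := tp (N + N) (cv N a (cutoff N (rcoef f))))); last first.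
  move=> x; rewrite realcM qa fsumE// tp_cv; last exact: supp_cutoff.
  by rewrite tp_cutoff mulrC.
rewrite cintegral_tp cintegral_mul_tp// /cv big_seq [RHS]big_seq.
by apply: eq_bigr => m mN; rewrite sub0r /cutoff cubeN mN.
Qed.

(** The error of the partial sum is orthogonal to every polynomial of frequency
    at most [N]. *)
Lemma fsum_pythagoras f q N a : sqi T f -> supp N a -> (forall x, (q x)%:C = tp N a x) ->
  I (fun x => (f x - q x) ^+ 2) =
  I (fun x => (f x - fsum N f x) ^+ 2) + I (fun x => (fsum N f x - q x) ^+ 2).
Proof.
move=> sf aN qa; have fi := sqi_itg sf.
have rs := rtrig_fsum N fi; have ss := rtrig_sqi rs.
have sq : sqi T q by apply: rtrig_sqi; exists N, a.
have e x : (f x - q x) ^+ 2 = ((f x - fsum N f x) ^+ 2 + (fsum N f x - q x) ^+ 2) +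
    2 * ((f x - fsum N f x) * (fsum N f x - q x)) by ring.
under eq_Rintegral do rewrite e.
have i1 := sqi_sqr (sqiB sf ss); have i2 := sqi_sqr (sqiB ss sq).
have i3 := sqiM (sqiB sf ss) (sqiB ss sq).
rewrite ID; [|exact: itgD|exact: itgZ].
rewrite ID// IZ// (_ : I (fun x => (f x - fsum N f x) * (fsum N f x - q x)) = 0) ?mulr0 ?addr0//.
pose q' x := fsum N f x - q x.
have qa' x : (q' x)%:C = tp N (fun m => cutoff N (rcoef f) m - a m) x.
  by rewrite realcB fsumE// qa tpB tp_cutoff.
have aN' : supp N (fun m => cutoff N (rcoef f) m - a m).
  by move=> m mN; rewrite supp_cutoff// aN// subrr.
have e' x : (f x - fsum N f x) * q' x = f x * q' x - fsum N f x * q' x by ring.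
under eq_Rintegral do rewrite e'.
have sq' : sqi T q' by exact: sqiB.
by rewrite IB; [rewrite (I_fsum_proj fi aN' qa' sf) subrr|exact: sqiM|exact: sqiM].
Qed.

Lemma I_fsum_sqr f N : sqi T f ->
  I (fun x => fsum N f x ^+ 2) = \sum_(m <- cube N) nc (rcoef f m) ^+ 2.
Proof.
move=> sf; have fi := sqi_itg sf; apply: complexI; rewrite -cintegral_real.
rewrite (eq_cintegral (G := tp (N + N) (cv N (rcoef f) (cutoff N (rcoef f))))); last first.
  move=> x; rewrite expr2 realcM !fsumE// tp_cv; last exact: supp_cutoff.
  by rewrite tp_cutoff.
rewrite cintegral_tp /cv realc_sum big_seq [RHS]big_seq; apply: eq_bigr => m mN.
by rewrite sub0r /cutoff cubeN mN rcoefN// mul_conj.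
Qed.

Lemma fsum_defect f N : sqi T f -> I (fun x => f x ^+ 2) =
  I (fun x => (f x - fsum N f x) ^+ 2) + \sum_(m <- cube N) nc (rcoef f m) ^+ 2.
Proof.
move=> sf; have fi := sqi_itg sf; rewrite -I_fsum_sqr//.
have t0 (x : V) : (0 : R)%:C = tp N (fun=> 0) x by rewrite /tp big1// => m _; exact: mul0r.
have := @fsum_pythagoras f (fun=> 0) N (fun=> 0) sf (fun _ _ => erefl) t0.
have e (g : V -> R) : (fun x => (g x - 0) ^+ 2) = (fun x => g x ^+ 2).
  by apply/funext => x; rewrite subr0.
by rewrite (e f) (e (fsum N f)).
Qed.

(** The partial Fourier sums are the best mean-square approximations, so
    density of trigonometric polynomials makes them converge. *)
Lemma fsum_cvg f : sqi T f -> forall e, 0 < e ->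
  exists N0, forall N, (N0 <= N)%N -> I (fun x => (f x - fsum N f x) ^+ 2) < e.
Proof.
move=> sf e e0; have [q [n [a [an qa]]] fq] := trigonometric_density sf e0.
exists n => N nN; apply: le_lt_trans fq.
rewrite (@fsum_pythagoras f q N a sf).
- by rewrite lerDl I_ge0// => x; exact: sqr_ge0.
- exact: supp_le nN an.
- by move=> x; rewrite qa (tp_le _ nN an).
Qed.

Lemma rcoef0_sqr0 f : sqi T f -> (forall m, rcoef f m = 0) -> I (fun x => f x ^+ 2) = 0.
Proof.
move=> sf f0; apply/eqP; rewrite eq_le; apply/andP; split; last first.
  by apply: I_ge0 => x; exact: sqr_ge0.
apply/ler_addgt0Pr => e e0; rewrite add0r.
have [N /(_ N (leqnn N)) h] := fsum_cvg sf e0.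
rewrite (fsum_defect N sf) [X in _ + X]big1 ?addr0 ?(ltW h)// => m _.
by rewrite f0 nc0 expr0n.
Qed.

Let sqn f : R := Num.sqrt (I (fun x => f x ^+ 2)).

Let sqn_bounded_mul g h M : sqi T g -> measurable_fun setT h -> (forall x, `|h x| <= M) ->
  sqi T (fun x => g x * h x) /\ sqn (fun x => g x * h x) <= M * sqn g.
Proof.
move=> sg mh hM; have M0 : 0 <= M := le_trans (normr_ge0 _) (hM 0).
have sM : sqi T (fun x => M * g x) by exact: sqiZ.
have ptw x : `|g x * h x| <= `|M * g x|.
  by rewrite !normrM mulrC (ger0_norm M0) ler_wpM2r.
have sgh : sqi T (fun x => g x * h x).
  by apply: sqi_le ptw sM; apply: measurable_funM => //; case: sg.
split => //; rewrite -[M]ger0_norm// -sqrtr_sqr -sqrtrM ?sqr_ge0//.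
rewrite -IZ; last by case: sg.
apply: ler_wsqrtr; apply: le_I; first by case: sgh.
  by apply: itgZ; case: sg.
move=> x; rewrite -exprMn -(real_normK (num_real (g x * h x))) -(real_normK (num_real (M * g x))).
by rewrite lerXn2r ?nnegrE.
Qed.

(** The third factor stays as it is: it is bounded, so mean-square convergence
    of the other two is enough. *)
Lemma I_trilinear_fsum f g h M : sqi T f -> sqi T g -> measurable_fun setT h ->
  (forall x, `|h x| <= M) -> forall e, 0 < e ->
  exists N0, forall N, (N0 <= N)%N ->
    `|I (fun x => f x * g x * h x) - I (fun x => fsum N f x * fsum N g x * h x)| < e.
Proof.
move=> sf sg mh hM e e0; have M0 : 0 <= M := le_trans (normr_ge0 _) (hM 0).
pose K := M * (sqn f + sqn g) + 1.
have K0 : 0 < K by rewrite ltr_wpDl// mulr_ge0// addr_ge0// sqrtr_ge0.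
have e1 : 0 < (e / K) ^+ 2 by rewrite exprn_gt0// divr_gt0.
have [N1 h1] := fsum_cvg sf e1; have [N2 h2] := fsum_cvg sg e1.
exists (maxn N1 N2) => N; rewrite geq_max => /andP[/h1 {}h1 /h2 {}h2].
have fi := sqi_itg sf; have gi := sqi_itg sg.
have sfN := rtrig_sqi (rtrig_fsum N fi); have sgN := rtrig_sqi (rtrig_fsum N gi).
have sdf := sqiB sf sfN; have sdg := sqiB sg sgN.
have small u : I (fun x => u x ^+ 2) < (e / K) ^+ 2 -> sqn u < e / K.
  move=> ub; have eK : 0 <= e / K by rewrite divr_ge0 ?ltW.
  by rewrite -(ger0_norm eK) -sqrtr_sqr ltr_sqrt.
have {}h1 := small _ h1; have {}h2 := small _ h2.
have [sgh bgh] := sqn_bounded_mul sg mh hM.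
have [sfh bfh] := sqn_bounded_mul sfN mh hM.
have fle : sqn (fsum N f) <= sqn f.
  apply: ler_wsqrtr; rewrite (fsum_defect N sf) I_fsum_sqr//.
  by rewrite lerDr I_ge0// => x; exact: sqr_ge0.
rewrite -IB; first last.
- have := sqiM sgN sfh; congr itg; apply/funext => x; ring.
- have := sqiM sf sgh; congr itg; apply/funext => x; ring.
have ee x : f x * g x * h x - fsum N f x * fsum N g x * h x =
  (f x - fsum N f x) * (g x * h x) + (g x - fsum N g x) * (fsum N f x * h x) by ring.
under eq_Rintegral do rewrite ee.
rewrite ID; [|exact: sqiM..].
rewrite (le_lt_trans (ler_normD _ _))//.
have b1 : _ <= sqn (fun x => f x - fsum N f x) * sqn (fun x => g x * h x) :=
  I_cauchy_schwarz sdf sgh.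
have b2 : _ <= sqn (fun x => g x - fsum N g x) * sqn (fun x => fsum N f x * h x) :=
  I_cauchy_schwarz sdg sfh.
rewrite (le_lt_trans (lerD b1 b2))//.
have q1 : 0 <= sqn (fun x => f x - fsum N f x) by exact: sqrtr_ge0.
have q2 : 0 <= sqn (fun x => g x - fsum N g x) by exact: sqrtr_ge0.
have q3 : 0 <= sqn f by exact: sqrtr_ge0.
have q4 : 0 <= sqn g by exact: sqrtr_ge0.
have q5 : 0 <= sqn (fun x => g x * h x) by exact: sqrtr_ge0.
have q6 : 0 <= sqn (fun x => fsum N f x * h x) by exact: sqrtr_ge0.
have t1 := ler_pM q1 q5 (ltW h1) bgh.
have t2 := ler_pM q2 q6 (ltW h2) (le_trans bfh (ler_wpM2l M0 fle)).
rewrite (le_lt_trans (lerD t1 t2))// -mulrDr -mulrDr [sqn g + _]addrC.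
rewrite mulrAC ltr_pdivrMr// ltr_pM2l// /K ltrDl//.
Qed.

End parseval.

(** * Derivatives of trigonometric polynomials *)

Section smooth_trigonometric.
Context {R : realType} {d : nat}.
Local Notation C := R[i].
Local Notation Z := 'rV[int]_d.
Local Notation V := 'rV[R]_d.
Implicit Types (m : Z) (a : Z -> C).

(** A directional derivative only sees the restriction to a line. *)
Lemma is_derive_line (f : V -> R) (x v : V) (df : R) :
  is_derive (0 : R) (1 : R) (fun h : R => f (x + h *: v)) df -> is_derive x v f df.
Proof.
have e : (fun h : R => h^-1 *: ((fun h : R => f (x + h *: v)) (h *: (1 : R) + 0) - (fun h : R => f (x + h *: v)) 0)) =
   (fun h : R => h^-1 *: (f (h *: v + x) - f x)).
  apply/funext => h; rewrite scale0r addr0 addr0.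
  by rewrite [h *: 1]mulr1 [x + _]addrC.
move=> [dh Dh]; split.
  by move: dh; rewrite /derivable /= e.
by move: Dh; rewrite /derive /= e.
Qed.

Lemma phase_line m (j : 'I_d) x (h : R) :
  phase m (x + h *: delta_mx 0 j) = phase m x + (2 * pi * (m ord0 j)%:~R) * h.
Proof.
rewrite /phase (eq_bigr (fun i => intv R m 0 i * x 0 i + intv R m 0 i * (h * (i == j)%:R))); last first.
  by move=> i _; rewrite !mxE eqxx/= mulrDr.
rewrite big_split/= mulrDr; congr (_ + _).
rewrite (bigD1 j)//= big1 ?addr0 => [|i /negbTE ->]; last by rewrite !mulr0.
by rewrite eqxx mulr1 !mxE; ring.
Qed.

Definition dcoef j a : Z -> C := fun m => dsym j m * a m.

Lemma is_derive_tp n a j x :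
  is_derive x (delta_mx 0 j) (fun x => complex.Re (tp n a x)) (complex.Re (tp n (dcoef j a) x)).
Proof.
apply: is_derive_line.
pose w m : R := 2 * pi * (m ord0 j)%:~R.
pose A m := complex.Re (a m); pose B m := complex.Im (a m).
have e h : complex.Re (tp n a (x + h *: delta_mx 0 j)) =
    \sum_(m <- cube n) (A m * cos (phase m x + w m * h) - B m * sin (phase m x + w m * h)).
  rewrite Re_sum; apply: eq_bigr => m _; rewrite fexpE phase_line.
  by rewrite /A /B /w; case: (a m).
rewrite (_ : (fun h => _) = (fun h => \sum_(m <- cube n) (A m * cos (phase m x + w m * h) - B m * sin (phase m x + w m * h)))); last exact/funext.
have -> : complex.Re (tp n (dcoef j a) x) =
    \sum_(m <- cube n) (A m * (- sin (phase m x) * w m) - B m * (cos (phase m x) * w m)).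
  rewrite Re_sum; apply: eq_bigr => m _; rewrite fexpE /dcoef /dsym -/(w m) /A /B.
  by case: (a m) => p q /=; ring.
elim: (cube n) => [|m r ih].
  rewrite big_nil; under eq_fun do rewrite big_nil; exact: is_derive_cst.
rewrite big_cons; under eq_fun do rewrite big_cons.
apply: is_deriveD.
have dl : is_derive (0 : R) (1 : R) (fun h => phase m x + w m * h) (w m).
  have := is_deriveD (is_derive_cst (phase m x) (0 : R) (1 : R)) (is_deriveZ (w m) (is_derive_id (0 : R) (1 : R))).
  by rewrite /GRing.scale/= mulr1 add0r.
have e0 : phase m x + w m * 0 = phase m x by rewrite mulr0 addr0.
have dc : is_derive (0 : R) (1 : R) (fun h => cos (phase m x + w m * h)) (- sin (phase m x) * w m).
  have := @is_derive1_comp _ (@cos R) (fun h => phase m x + w m * h) 0 _ _ (is_derive_cos _) dl.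
  by rewrite /GRing.scale/= e0.
have ds : is_derive (0 : R) (1 : R) (fun h => sin (phase m x + w m * h)) (cos (phase m x) * w m).
  have := @is_derive1_comp _ (@sin R) (fun h => phase m x + w m * h) 0 _ _ (is_derive_sin _) dl.
  by rewrite /GRing.scale/= e0.
exact: is_deriveB (is_deriveZ (A m) dc) (is_deriveZ (B m) ds).
Qed.

Lemma pderiv_tp n a j :
  pderiv j (fun x => complex.Re (tp n a x)) = (fun x => complex.Re (tp n (dcoef j a) x)).
Proof.
by apply/funext => x; rewrite /pderiv; have [_ ->] := is_derive_tp n a j x.
Qed.

Lemma cvg_sum_seq (T : Type) (Fl : set_system T) {FF : Filter Fl} (I : Type) (r : seq I)
    (F : I -> T -> R) (l : I -> R) :
  (forall i, F i t @[t --> Fl] --> l i) ->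
  \sum_(i <- r) F i t @[t --> Fl] --> \sum_(i <- r) l i.
Proof.
move=> Fcv; elim: r => [|i r ih].
  by under eq_fun do rewrite big_nil; rewrite big_nil; exact: cvg_cst.
by under eq_fun do rewrite big_cons; rewrite big_cons; apply: cvgD => //; exact: Fcv.
Qed.

Lemma cvg_Re_tp (F : set_system V) {FF : Filter F} n a (x : V) :
  (forall i, (fun y : V => y 0 i) y @[y --> F] --> x 0 i) ->
  complex.Re (tp n a y) @[y --> F] --> complex.Re (tp n a x).
Proof.
move=> Fx.
have cph m : phase m y @[y --> F] --> phase m x.
  apply: cvgM; first exact: cvg_cst.
  by apply: cvg_sum_seq => i; apply: cvgM; [exact: cvg_cst|exact: Fx].
rewrite (_ : (fun x => _) = (fun x => \sum_(m <- cube n)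
  (complex.Re (a m) * cos (phase m x) - complex.Im (a m) * sin (phase m x)))); last first.
  by apply/funext => y; rewrite Re_sum; apply: eq_bigr => m _; rewrite fexpE; case: (a m).
rewrite Re_sum (eq_bigr (fun m => complex.Re (a m) * cos (phase m x) - complex.Im (a m) * sin (phase m x))); last first.
  by move=> m _; rewrite fexpE; case: (a m).
apply: cvg_sum_seq => m; apply: cvgB; (apply: cvgM; first exact: cvg_cst).
  by apply: continuous_cvg; [exact: continuous_cos|exact: cph].
by apply: continuous_cvg; [exact: continuous_sin|exact: cph].
Qed.

Lemma continuous_Re_tp n a : continuous (fun x : V => complex.Re (tp n a x)).
Proof.
move=> x; apply: (@cvg_Re_tp (nbhs x) (nbhs_filter x)) => i.
exact: coord_continuous.
Qed.

Lemma smooth_Re_tp n a : smooth (fun x : V => complex.Re (tp n a x)).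
Proof.
move=> s g.
have [b gE] : exists b, g = (fun x => complex.Re (tp n b x)).
  rewrite /g; elim: s {g} => [|j s [b ih]]; first by exists a.
  by exists (dcoef j b); rewrite /= ih pderiv_tp.
rewrite gE; split; first exact: continuous_Re_tp.
by move=> j x; have [] := is_derive_tp n b j x.
Qed.

End smooth_trigonometric.

(** * The weak formulation on Fourier coefficients *)

Section weak_solution.
Context {R : realType} {d : nat}.
Local Notation C := R[i].
Local Notation Z := 'rV[int]_d.
Local Notation V := 'rV[R]_d.
Local Notation T := (torus_prob R d).
Local Notation I f := (Rintegral T setT f).
Variables (alpha : R) (u : V -> V).

Definition ucoef (i : 'I_d) : Z -> C := rcoef (vcomp u i).

Lemma in_L2_sqi : in_L2 u -> forall i, sqi T (vcomp u i).
Proof.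
move=> uL i; have := uL i => ui; split; last exact: Lfun2_integrable_sqr.
by have := set_mem (sub_Lfun_mfun ui).
Qed.

Hypothesis uL2 : forall i, sqi T (vcomp u i).

Let u_itg i : itg T (vcomp u i). Proof. exact: sqi_itg. Qed.

Lemma ucoefN i m : ucoef i (- m) = conjc (ucoef i m).
Proof. exact: rcoefN. Qed.

Let itg_mul (f g : V -> R) : itg T f -> measurable_fun setT g -> (forall x, `|g x| <= 1) ->
  itg T (fun x => f x * g x).
Proof.
move=> fi mg g1; apply: (@itg_le _ _ _ _ _ (fun x => `|f x|)).
- by apply: measurable_funM => //; exact: (itg_measurable fi).
- by move=> x; rewrite normrM ler_piMr.
- exact: integrable_norm.
Qed.

Let ucos i m : itg T (fun x => vcomp u i x * cos (phase m x)).
Proof.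
by apply: itg_mul => // [|x]; [exact: measurable_cos_phase|exact: norm_cos_le1].
Qed.

Let usin i m : itg T (fun x => vcomp u i x * sin (phase m x)).
Proof.
by apply: itg_mul => // [|x]; [exact: measurable_sin_phase|exact: norm_sin_le1].
Qed.

Lemma ucoefE i m : ucoef i m =
  Complex (I (fun x => vcomp u i x * cos (phase m x))) (- I (fun x => vcomp u i x * sin (phase m x))).
Proof.
rewrite -[ucoef i m]conjcI -ucoefN /ucoef /rcoef /fcoef /cintegral opprK /=.
congr (_ +i* - _); apply: eq_Rintegral => x _; rewrite /= -/(phase m x); ring.
Qed.

Lemma pderiv_cos_phase m j : pderiv j (fun x => cos (phase m x)) =
  (fun x => - (2 * pi * (m ord0 j)%:~R) * sin (phase m x)) :> (V -> R).
Proof.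
have [n mn] := cube_exists m.
have e : (fun x : V => cos (phase m x)) = (fun x => complex.Re (tp n (fun k => (k == m)%:R) x)).
  by apply/funext => x; rewrite tp_delta.
rewrite e pderiv_tp; apply/funext => x.
rewrite /tp (bigD1_seq m) ?uniq_cube//= big1 ?addr0; last first.
  by move=> k /negbTE km; rewrite /dcoef km mulr0 mul0r.
rewrite /dcoef eqxx mulr1 fexpE/dsym /=; ring.
Qed.

Lemma pderiv_sin_phase m j : pderiv j (fun x => sin (phase m x)) =
  (fun x => 2 * pi * (m ord0 j)%:~R * cos (phase m x)) :> (V -> R).
Proof.
have [n mn] := cube_exists m.
have e : (fun x : V => sin (phase m x)) = (fun x => complex.Re (tp n (fun k => Complex 0 (- 1) * (k == m)%:R) x)).
  by apply/funext => x; rewrite tpZ tp_delta// fexpE/=; ring.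
rewrite e pderiv_tp; apply/funext => x.
rewrite /tp (bigD1_seq m) ?uniq_cube//= big1 ?addr0; last first.
  by move=> k /negbTE km; rewrite /dcoef km !mulr0 mul0r.
rewrite /dcoef eqxx mulr1 fexpE/dsym /=; ring.
Qed.

Lemma Zperiodic_Re (F : V -> C) : Zperiodic F -> Zperiodic (fun x => complex.Re (F x)).
Proof. by move=> pF x k; rewrite pF. Qed.

Lemma Zperiodic_Im (F : V -> C) : Zperiodic F -> Zperiodic (fun x => complex.Im (F x)).
Proof. by move=> pF x k; rewrite pF. Qed.

Lemma smooth_fexp m : smooth (fun x : V => cos (phase m x)) /\ smooth (fun x : V => sin (phase m x)).
Proof.
have [n mn] := cube_exists m; split.
  rewrite (_ : (fun x => _) = (fun x => complex.Re (tp n (fun k => (k == m)%:R) x))).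
    exact: smooth_Re_tp.
  by apply/funext => x; rewrite tp_delta.
rewrite (_ : (fun x => _) = (fun x => complex.Re (tp n (fun k => Complex 0 (- 1) * (k == m)%:R) x))).
  exact: smooth_Re_tp.
by apply/funext => x; rewrite tpZ tp_delta// fexpE/=; ring.
Qed.

(** The real and imaginary parts of an exponential serve as test functions. *)
Lemma ucoef_divfree : weakly_divfree u -> forall m, \sum_j dsym j m * ucoef j m = 0.
Proof.
move=> udiv m; have [sc ss] := smooth_fexp m.
have pc := Zperiodic_Re (@Zperiodic_fexp R d m).
have ps := Zperiodic_Im (@Zperiodic_fexp R d m).
have e1 j : I (fun x => vcomp u j x * pderiv j (fun x => sin (phase m x)) x) =
    2 * pi * (m ord0 j)%:~R * I (fun x => vcomp u j x * cos (phase m x)).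
  rewrite pderiv_sin_phase -IZ//; apply: eq_Rintegral => x _; ring.
have e2 j : I (fun x => vcomp u j x * pderiv j (fun x => cos (phase m x)) x) =
    - (2 * pi * (m ord0 j)%:~R) * I (fun x => vcomp u j x * sin (phase m x)).
  rewrite pderiv_cos_phase -IZ//; apply: eq_Rintegral => x _; ring.
have h1 := udiv _ ps ss; rewrite (eq_bigr _ (fun j _ => e1 j)) in h1.
have h2 := udiv _ pc sc; rewrite (eq_bigr _ (fun j _ => e2 j)) in h2.
apply/eqP; rewrite eq_complex Re_sum Im_sum [complex.Re 0]/= [complex.Im 0]/=; apply/andP; split; apply/eqP.
  apply: oppr_inj; rewrite oppr0 -[RHS]h2 -sumrN; apply: eq_bigr => j _; rewrite ucoefE /dsym /=; ring.
rewrite -[RHS]h1; apply: eq_bigr => j _; rewrite ucoefE /dsym /=; ring.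
Qed.

Section test_function.
Variables (th : Z -> R) (N : nat).
Hypothesis thN : forall m, th (- m) = th m.
Hypothesis thS : supp N th.
Hypothesis udiv : forall m, \sum_j dsym j m * ucoef j m = 0.

Let a i m : C := (th m)%:C * ucoef i m.

(** The field [u] with the symbol [th] applied. It is real because [th] is even
    and divergence free because [u] is. *)
Definition test_fun (x : V) : V := \row_i complex.Re (tp N (a i) x).

Let suppa i : supp N (a i). Proof. by move=> m mN; rewrite /a thS// mul0r. Qed.

Let test_comp i : vcomp test_fun i = (fun x => complex.Re (tp N (a i) x)).
Proof. by apply/funext => x; rewrite /vcomp mxE. Qed.

Let aN i m : a i (- m) = conjc (a i m).
Proof.
rewrite /a thN ucoefN conjcM; congr (_ * _).
by apply/eqP; rewrite eq_complex/= oppr0 !eqxx.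
Qed.

Let real_tp (b : Z -> C) x : (forall m, b (- m) = conjc (b m)) ->
  (complex.Re (tp N b x))%:C = tp N b x.
Proof.
move=> bN; rewrite Re_halfD conj_tp -tpD -tpZ; apply: eq_tp => m.
rewrite bN conjcI; apply/eqP; rewrite eq_complex/=.
by case: (b m) => p q /=; apply/andP; split; apply/eqP; field.
Qed.

Lemma test_fun_divfree : divfree_test test_fun.
Proof.
split.
- move=> x k; apply/rowP => i; rewrite !mxE; congr complex.Re.
  exact: Zperiodic_tp.
- by move=> i; rewrite test_comp; exact: smooth_Re_tp.
- move=> x; under eq_bigr do rewrite test_comp pderiv_tp.
  rewrite -Re_sum -tp_sum (eq_tp N x (b := fun=> 0)).
    by rewrite /tp big1// => m _; rewrite mul0r.
  move=> m; rewrite (eq_bigr (fun j => (th m)%:C * (dsym j m * ucoef j m))).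
    by rewrite -mulr_sumr udiv mulr0.
  by move=> j _; rewrite /dcoef /a; ring.
Qed.

Lemma fcoef_tp n (b : Z -> C) m : supp n b -> fcoef (tp n b) m = b m.
Proof.
move=> bn; have [k mk] := cube_exists m.
rewrite /fcoef (eq_cintegral (G := tp (n + k) (cv n b (fun l => (l == - m)%:R)))); last first.
  move=> x; rewrite tp_cv ?tp_delta ?cubeN//.
  by apply: supp_delta; rewrite cubeN.
rewrite cintegral_tp /cv.
have [mn|mn] := boolP (m \in cube n).
  rewrite (bigD1_seq m) ?uniq_cube//= sub0r eqxx mulr1 big1 ?addr0// => l lm.
  by rewrite sub0r eqr_opp (negbTE lm) mulr0.
rewrite bn// big_seq big1// => l ln; rewrite sub0r eqr_opp.
by case: eqP => [lm|]; rewrite ?mulr0//; rewrite -lm ln in mn.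
Qed.

Lemma zsum_finite (F : Z -> C) n : supp n F -> zsum F = \sum_(m <- cube n) F m.
Proof.
move=> Fn; rewrite /zsum.
pose S k := \sum_(m \in [set m : Z | forall i, (absz (m ord0 i) <= k)%N]) F m.
have SE k : (n <= k)%N -> S k = \sum_(m <- cube n) F m.
  move=> nk; rewrite -(sum_cube_le nk Fn) /S (fsbig_seq _ _ (uniq_cube k)).
  apply: eq_fsbigl; apply/seteqP; split => m /=; first by move=> h; apply/cubeP.
  by move/cubeP.
have e (g : C -> R) : limn (fun k => g (S k)) = g (\sum_(m <- cube n) F m).
  apply/cvg_lim => //; apply: cvg_near_cst; exists n => // k /= nk.
  by rewrite SE.
by rewrite (e (@complex.Re R)) (e (@complex.Im R)); case: (\sum_(m <- _) _).
Qed.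

Lemma fraclap_test i : fraclap alpha (cvcomp test_fun i) =
  tp N (fun m => (lap alpha m)%:C * a i m).
Proof.
apply/funext => x.
have -> : cvcomp test_fun i = tp N (a i).
  by apply/funext => y; rewrite /cvcomp mxE real_tp.
rewrite /fraclap (@zsum_finite _ N).
  by rewrite /tp; apply: eq_bigr => m _; rewrite fcoef_tp.
by move=> m mN; rewrite fcoef_tp// suppa// mulr0 mul0r.
Qed.

(** Against [test_fun] the fractional Laplacian yields a sum of squares. *)
Lemma weak_balance : stationary_solution alpha u ->
  \sum_i \sum_j I (fun x => vcomp u i x * vcomp u j x * complex.Re (tp N (dcoef j (a i)) x)) =
  \sum_i \sum_(m <- cube N) th m * lap alpha m * nc (ucoef i m) ^+ 2.
Proof.
move=> [_ _ _ _ /(_ _ test_fun_divfree)].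
under [X in - X%:C]eq_bigr do under eq_bigr do rewrite test_comp pderiv_tp.
move=> h.
have QE : \sum_i cintegral (fun x => cvcomp u i x * fraclap alpha (cvcomp test_fun i) x) =
    (\sum_i \sum_(m <- cube N) th m * lap alpha m * nc (ucoef i m) ^+ 2)%:C.
  rewrite [RHS]realc_sum; apply: eq_bigr => i _; rewrite fraclap_test.
  rewrite (@cintegral_mul_tp _ _ (vcomp u i) N _ (u_itg i)) [RHS]realc_sum; apply: eq_bigr => m _.
  rewrite -/(ucoef i) ucoefN /a realcM -mul_conj realcM; ring.
move/eqP: h; rewrite QE addrC subr_eq0 => /eqP/complexI h; exact: esym.
Qed.

Let dcoefN i j m : dcoef j (a i) (- m) = conjc (dcoef j (a i) m).
Proof.
have e : - dsym j m = conjc (dsym j m) :> C.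
  by apply/eqP; rewrite eq_complex/= oppr0 !eqxx.
by rewrite /dcoef aN dsymN e -conjcM.
Qed.

(** The energy balance of [weak_balance], with the velocity replaced by its
    partial Fourier sums in the quadratic term. *)
Lemma weak_balance_fsum e S0 : stationary_solution alpha u -> 0 < e ->
  exists S, (S0 <= S)%N /\ (N <= S)%N /\
  \sum_i \sum_(m <- cube N) th m * lap alpha m * nc (ucoef i m) ^+ 2 <=
  nc (\sum_i \sum_j cintegral (fun x => tp S (ucoef i) x * tp S (ucoef j) x * tp S (dcoef j (a i)) x)) + e.
Proof.
move=> sol e0; rewrite -(weak_balance sol).
pose e' := e / (d%:R * d%:R + 1).
have D0 : 0 < d%:R * d%:R + 1 :> R by rewrite ltr_wpDl// mulr_ge0.
have e'0 : 0 < e' by rewrite divr_gt0.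
have conv (p : 'I_d * 'I_d) : exists N0, forall S, (N0 <= S)%N ->
    `|I (fun x => vcomp u p.1 x * vcomp u p.2 x * complex.Re (tp N (dcoef p.2 (a p.1)) x)) -
      I (fun x => fsum S (vcomp u p.1) x * fsum S (vcomp u p.2) x * complex.Re (tp N (dcoef p.2 (a p.1)) x))| < e'.
  apply: (@I_trilinear_fsum _ _ _ _ _ (\sum_(m <- cube N) nc (dcoef p.2 (a p.1) m))) => //.
    exact: (measurable_tp N _).1.
  by move=> x; rewrite (le_trans (nc_Re _))// nc_tp_le.
have [N0 hN0] := choice conv.
pose S := (S0 + N + \sum_p N0 p)%N.
exists S; split; first by rewrite /S -addnA leq_addr.
have NS : (N <= S)%N by rewrite /S addnAC leq_addl.
split => //.
have cE i j : cintegral (fun x => tp S (ucoef i) x * tp S (ucoef j) x * tp S (dcoef j (a i)) x) =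
    (I (fun x => fsum S (vcomp u i) x * fsum S (vcomp u j) x * complex.Re (tp N (dcoef j (a i)) x)))%:C.
  rewrite -cintegral_real; apply: eq_cintegral => x.
  rewrite !realcM !fsumE// real_tp; last exact: dcoefN.
  have dS : supp N (dcoef j (a i)) by move=> m mN; rewrite /dcoef suppa// mulr0.
  by rewrite (tp_le x NS dS).
under [X in nc X]eq_bigr do under eq_bigr do rewrite cE.
under [X in nc X]eq_bigr do rewrite -realc_sum.
rewrite -realc_sum nc_real.
rewrite (le_trans _ (lerD (ler_norm _) (lexx _)))//.
rewrite -lerBlDl -sumrB.
rewrite (@le_trans _ _ (\sum_(i < d) \sum_(j < d) e'))//.
  apply: ler_sum => i _; rewrite -sumrB; apply: ler_sum => j _.
  rewrite (le_trans (ler_norm _))// ltW// (hN0 (i, j))// /S.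
  by rewrite (bigD1 (i, j))//= addnCA leq_addr.
rewrite !sumr_const !card_ord -mulrnA -mulr_natr natrM /e' mulrAC ler_pdivrMr//.
by rewrite ler_wpM2l ?(ltW e0)// lerDl.
Qed.

End test_function.

Lemma tri_cintegral q S (f h g : Z -> C) : (3 * S <= q)%N -> supp S h -> supp S g ->
  tri q S f h g = cintegral (fun x => tp S f x * tp S h x * tp S g x).
Proof.
move=> Sq hS gS.
have e x : tp S f x * tp S h x * tp S g x = tp (S + S + S) (cv (S + S) (cv S f h) g) x.
  by rewrite tp_cv// tp_cv.
rewrite /tri (eq_avg q e) (eq_cintegral e) avg_tp ?cintegral_tp//; lia.
Qed.

(** For the symbol [theta (8 * n)], the integrals of [weak_balance_fsum] are
    grid averages of polynomials, and add up to the flux. *)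
Lemma solution_balance n e S0 : stationary_solution alpha u -> (0 < n)%N -> 0 < e ->
  exists S, (S0 <= S)%N /\ dissip alpha n ucoef <= nc (flux n S (trunc S ucoef)) + e.
Proof.
move=> sol n0 e0; have n80 : (0 < 8 * n)%N by lia.
have udiv : forall m, \sum_j dsym j m * ucoef j m = 0.
  by case: sol => _ _ _ /ucoef_divfree.
have thS : supp (32 * n) (theta (8 * n) : Z -> R).
  by have := supp_theta n80 (R := R) (d := d); rewrite mulnA.
have [S [S0S [NS bal]]] := weak_balance_fsum (@thetaN R d (8 * n)) thS udiv S0 sol e0.
exists S; split => //; apply: (le_trans bal); rewrite lerD2r.
rewrite le_eqVlt; apply/orP; left; apply/eqP; congr nc.
apply: eq_bigr => i _; apply: eq_bigr => j _.
rewrite /flux tri_cintegral; first last.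
- by move=> m mS; rewrite /trunc (negbTE mS) !mulr0.
- by move=> m mS; rewrite /trunc (negbTE mS).
- by lia.
apply: eq_cintegral => x; congr (_ * _ * _); rewrite /tp big_seq [RHS]big_seq;
  apply: eq_bigr => m mS; rewrite /trunc mS//.
by rewrite /dcoef thetaCE.
Qed.

End weak_solution.

(** * Bernstein's inequality *)

Section bernstein.
Context {R : realType} {d : nat}.
Local Notation C := R[i].
Local Notation Z := 'rV[int]_d.
Local Notation V := 'rV[R]_d.
Local Notation T := (torus_prob R d).
Local Notation I f := (Rintegral T setT f).
Implicit Types (a b : Z -> C).

Lemma nc_le_ReIm (z : C) : nc z <= `|complex.Re z| + `|complex.Im z|.
Proof.
have i1 : nc (Complex 0 1 : C) = 1 by rewrite /= expr0n add0r expr1n sqrtr1.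
have e : z = (complex.Re z)%:C + Complex 0 1 * (complex.Im z)%:C.
  case: z => p q; apply/eqP.
  by rewrite eq_complex/=; apply/andP; split; apply/eqP; ring.
by rewrite {1}e (le_trans (ncD _ _))// ncM !nc_real i1 mul1r.
Qed.

(** The factor 2 pays for treating real and imaginary parts separately. *)
Lemma nc_cintegral_le (F : V -> C) (h : V -> R) : citg F -> itg T h ->
  (forall x, nc (F x) <= h x) -> nc (cintegral F) <= 2 * I h.
Proof.
move=> [F1 F2] hi Fh; rewrite (le_trans (nc_le_ReIm _))//= mulr_natl mulr2n.
by apply: lerD; rewrite (le_trans (norm_I _))//; apply: le_I => //;
  [exact: integrable_norm| |exact: integrable_norm|] => x;
  rewrite (le_trans _ (Fh x))// ?nc_Re ?nc_Im.
Qed.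

Lemma measurable_nc_tp n a : measurable_fun setT (fun x : V => nc (tp n a x)).
Proof.
have [m1 m2] := measurable_tp n a.
rewrite (_ : (fun x => _) = (fun x => Num.sqrt (complex.Re (tp n a x) ^+ 2 + complex.Im (tp n a x) ^+ 2))).
  apply: measurableT_comp; first by apply: continuous_measurable_fun; exact: sqrt_continuous.
  by apply: measurable_funD; exact: measurable_funX.
by apply/funext => x; case: (tp n a x).
Qed.

Lemma sqi_nc_tp n a : sqi T (fun x => nc (tp n a x)).
Proof.
apply: (@sqi_bounded _ _ _ _ _ (\sum_(m <- cube n) nc (a m))); first exact: measurable_nc_tp.
by move=> x; rewrite ger0_norm ?nc_ge0// nc_tp_le.
Qed.

Lemma cintegral_tp_mul n k a b : supp k b ->
  cintegral (fun x => tp n a x * tp k b x) = \sum_(m <- cube n) a m * b (- m).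
Proof.
move=> bk; rewrite (eq_cintegral (G := tp (n + k) (cv n a b))).
  by rewrite cintegral_tp; apply: eq_bigr => m _; rewrite sub0r.
by move=> x; rewrite tp_cv.
Qed.

Lemma torus_parseval n a : I (fun x => nc (tp n a x) ^+ 2) = l2 n a ^+ 2.
Proof.
rewrite /l2 sqr_sqrtr; last by apply: sumr_ge0 => m _; exact: sqr_ge0.
apply: complexI; rewrite -cintegral_real realc_sum.
rewrite (eq_cintegral (G := fun x => tp n a x * tp n (fun m => conjc (cutoff n a (- m))) x)).
  rewrite cintegral_tp_mul.
    rewrite big_seq [RHS]big_seq; apply: eq_bigr => m mn.
    by rewrite opprK /cutoff mn mul_conj.
  by move=> m mn; rewrite /cutoff cubeN (negbTE mn) conjc0.
by move=> x; rewrite -conj_tp tp_cutoff mul_conj.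
Qed.

Lemma I_tp_mul_le n k a b :
  I (fun x => nc (tp n a x) * nc (tp k b x)) <= l2 n a * l2 k b.
Proof.
rewrite (le_trans (ler_norm _))// (le_trans (I_cauchy_schwarz (sqi_nc_tp _ _) (sqi_nc_tp _ _)))//.
by rewrite !torus_parseval !sqrtr_sqr !ger0_norm ?l2_ge0.
Qed.

(** A function of frequency at most [n] reproduces itself against the kernel of
    the cutoff. That kernel has bounded mass and height at most [(9 * n) ^ d]:
    the part of the function below the level [l] is paid for with the mass, the
    excess over [l] with the height. *)
Lemma sup_le_level_excess n b (l : R) x : (0 < n)%N -> supp n b -> 0 <= l ->
  nc (tp n b x) <=
  2 * (l * kcst (d := d) + (9 * n)%:R ^+ d * I (fun y => Num.max 0 (nc (tp n b y) - l))).
Proof.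
move=> n0 bn l0.
pose A (m : Z) : C := (plateau n m)%:C; pose B (m : Z) : C := (mollifier n m)%:C.
pose Ax m := A m * fexp (- m) x; pose Bx m := B m * fexp (- m) x.
have suppBx : supp n Bx by move=> m mn; rewrite /Bx /B (supp_mollifier n0 mn) mul0r.
have ncAx m : nc (Ax m) = nc (A m) by rewrite ncM nc_fexp mulr1.
have ncBx m : nc (Bx m) = nc (B m) by rewrite ncM nc_fexp mulr1.
have l2Ax k : l2 k Ax = l2 k A by congr Num.sqrt; apply: eq_bigr => m _; rewrite ncAx.
have l2Bx k : l2 k Bx = l2 k B by congr Num.sqrt; apply: eq_bigr => m _; rewrite ncBx.
have kernelE m : cv (3 * n) Ax Bx m = thetaC n m * fexp (- m) x.
  rewrite /thetaC /cv mulr_suml; apply: eq_bigr => k _; rewrite /Ax /Bx.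
  rewrite (_ : fexp (- m) x = fexp (- k) x * fexp (- (m - k)) x).
    by rewrite /A /B; ring.
  by rewrite -fexpDl opprB addKr.
have suppK : supp (3 * n + n) (cv (3 * n) Ax Bx) by exact: cv_supp.
pose F y := tp n b y; pose K y := nc (tp (3 * n) Ax y) * nc (tp n Bx y).
have reproduce : tp n b x = cintegral (fun y => F y * tp (3 * n + n) (cv (3 * n) Ax Bx) y).
  rewrite cintegral_tp_mul; last exact: cv_supp.
  rewrite /tp big_seq [RHS]big_seq; apply: eq_bigr => m mn.
  by rewrite kernelE opprK thetaCE thetaN theta1// mul1r.
pose E y := Num.max 0 (nc (F y) - l).
have mE : measurable_fun setT E.
  apply: measurable_maxr => //; apply: measurable_funB => //; exact: measurable_nc_tp.
have E0 y : 0 <= E y by rewrite le_max lexx.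
have FlE y : nc (F y) <= l + E y by rewrite -lerBlDl le_max lexx orbT.
have iE : itg T E.
  apply: (itg_le mE _ (sqi_itg (sqi_nc_tp n b))) => y.
  by rewrite ger0_norm// ge_max nc_ge0 lerBlDr lerDl.
have iK : itg T K by apply: sqiM; exact: sqi_nc_tp.
pose H : R := (9 * n)%:R ^+ d.
have KH y : K y <= H.
  rewrite -[H]mulr1; apply: ler_pM; rewrite ?nc_ge0//; apply: (le_trans (nc_tp_le _ _ _)).
    rewrite (le_trans (y := \sum_(m <- (cube (3 * n) : seq Z)) 1))//.
      apply: ler_sum => m _; rewrite ncAx nc_real ger0_norm ?plateau_ge0//.
      exact: plateau_le1.
    rewrite big_const_seq count_predT size_cube iter_addr_0 /H natrX.
    by rewrite lerXn2r ?nnegrE ?ler0n// ler_nat -addnn; lia.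
  rewrite -(@sum_mollifier R d n n0) le_eqVlt; apply/orP; left; apply/eqP; apply: eq_bigr => m _.
  by rewrite ncBx nc_real ger0_norm// mollifier_ge0.
rewrite reproduce (le_trans (nc_cintegral_le (h := fun y => l * K y + H * E y) _ _ _))//.
- rewrite (_ : (fun y => _) = tp (n + (3 * n + n)) (cv n b (cv (3 * n) Ax Bx))); first exact: citg_tp.
  by apply/funext => y; rewrite (tp_cv n b y suppK).
- by apply: itgD; exact: itgZ.
- move=> y; rewrite ncM (tp_cv _ _ y suppBx) ncM -/(K y).
  have K0 : 0 <= K y by rewrite mulr_ge0 ?nc_ge0.
  rewrite (le_trans (ler_wpM2r K0 (FlE y)))// mulrDl lerD2l mulrC.
  by rewrite ler_wpM2r.
rewrite ID; [|exact: itgZ..].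
rewrite !IZ// ler_wpM2l// lerD2r ler_wpM2l// (le_trans (I_tp_mul_le _ _ _ _))//.
by rewrite l2Ax l2Bx l2_plateau_mollifier.
Qed.

Lemma I_ae0 (f : V -> R) : measurable_fun setT f -> {ae T, forall x, f x = 0} -> I f = 0.
Proof.
move=> mf f0; have e : (\int[T]_x (f x)%:E = \int[T]_x (cst 0 x))%E.
  apply: ae_eq_integral => //; first exact/measurable_EFinP.
  by apply: filterS f0 => x /= ->.
by rewrite /Rintegral e integral0.
Qed.

Let excess_measurable n b (l : R) :
  measurable_fun setT (fun y : V => Num.max 0 (nc (tp n b y) - l)).
Proof.
apply: measurable_maxr => //; apply: measurable_funB => //; exact: measurable_nc_tp.
Qed.

Definition bernstein_cst : R := 2 * (kcst (d := d) + 9 ^+ d).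

Lemma bernstein_cst_gt0 : 0 < bernstein_cst.
Proof. by rewrite mulr_gt0// ltr_wpDl ?kcst_ge0// exprn_gt0. Qed.

(** At the level of the essential supremum there is no excess. *)
Lemma bernstein_ess_sup n b x : (0 < n)%N -> supp n b ->
  (Lnorm T +oo%E (fun y => (nc (tp n b y))%:E) < +oo)%E ->
  nc (tp n b x) <= bernstein_cst * fine (Lnorm T +oo%E (fun y => (nc (tp n b y))%:E)).
Proof.
move=> n0 bn fin; set N := Lnorm _ _ _ in fin *.
have N0 : (0 <= N)%E by exact: Lnorm_ge0.
have NE : N = (fine N)%:E by rewrite fineK// ge0_fin_numE.
have fN0 : 0 <= fine N by exact: fine_ge0.
have T1 : (0 < T setT)%E by rewrite probability_setT.
rewrite (le_trans (sup_le_level_excess x n0 bn fN0))//.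
rewrite I_ae0.
- rewrite mulr0 addr0 /bernstein_cst -mulrA ler_wpM2l// [fine N * _]mulrC ler_wpM2r//.
  by rewrite lerDl exprn_ge0.
- exact: excess_measurable.
- have := ess_sup_ge T (abse \o (fun y : V => (nc (tp n b y))%:E)).
  rewrite [ess_sup _ _](_ : _ = N); last by rewrite /N unlock /Lnorm T1.
  apply: filterS => y /=; rewrite NE lee_fin ger0_norm ?nc_ge0// => h.
  by rewrite max_l// subr_le0.
Qed.

(** Where [s] exceeds the level, [(s / l) ^ (r - 1)] exceeds 1. *)
Lemma excess_le_powR (r l s : R) : 1 < r -> 0 < l -> 0 <= s ->
  Num.max 0 (s - l) <= l `^ (1 - r) * s `^ r.
Proof.
move=> r1 l0 s0; have p0 : 0 <= l `^ (1 - r) * s `^ r by rewrite mulr_ge0 ?powR_ge0.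
rewrite ge_max p0/=; have [sl|ls] := leP s l.
  by rewrite (le_trans _ p0)// subr_le0.
have s0' : 0 < s := lt_trans l0 ls.
rewrite (@le_trans _ _ s)//; first by rewrite gerBl ltW.
have {1}-> : s = s `^ (1 - r) * s `^ r.
  by rewrite -powRD ?subrK ?powRr1// (gt_eqF s0') implybT.
rewrite ler_wpM2r ?powR_ge0// -(opprB r 1) !powRN lef_pV2 ?posrE ?powR_gt0//.
by rewrite ge0_ler_powR ?nnegrE ?subr_ge0 ?(ltW r1) ?(ltW l0) ?(ltW ls).
Qed.

(** With [N] the [L^r] norm, at the level [l = N * n ^ (d / r)] the height of
    the kernel, [n ^ d], times the bound [l ^ (1 - r) * N ^ r] on the excess is
    [l] again. *)
Lemma bernstein_powR n b (r : R) x : (0 < n)%N -> supp n b -> 1 < r ->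
  (Lnorm T r%:E (fun y => (nc (tp n b y))%:E) < +oo)%E ->
  nc (tp n b x) <= bernstein_cst * n%:R `^ (d%:R / r) *
    fine (Lnorm T r%:E (fun y => (nc (tp n b y))%:E)).
Proof.
move=> n0 bn r1 fin; set N := Lnorm _ _ _ in fin *.
have r0 : 0 < r := lt_trans ltr01 r1.
have N0 : (0 <= N)%E by exact: Lnorm_ge0.
have NE : N = (fine N)%:E by rewrite fineK// ge0_fin_numE.
have fN0 : 0 <= fine N by exact: fine_ge0.
set nu := n%:R `^ (d%:R / r).
have nu0 : 0 < nu by apply: powR_gt0; rewrite ltr0n.
have nur : nu `^ r = n%:R ^+ d.
  by rewrite /nu -powRrM divfK ?gt_eqF// powR_mulrn.
have IN : I (fun y => nc (tp n b y) `^ r) = fine N `^ r.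
  have := @powR_Lnorm _ _ _ T (fun y => (nc (tp n b y))%:E) r (lt0r_neq0 r0).
  rewrite -/N NE poweR_EFin /Rintegral => h.
  rewrite -[fine N `^ r]/(fine ((fine N `^ r)%:E)) h; congr fine.
  apply: eq_integral => y _ /=; rewrite ger0_norm ?nc_ge0//.
have mr : measurable_fun setT (fun y : V => nc (tp n b y) `^ r).
  apply: (measurableT_comp (measurable_powR _)); exact: measurable_nc_tp.
have ir : itg T (fun y => nc (tp n b y) `^ r).
  apply: (@itg_bounded _ _ _ _ _ ((\sum_(m <- cube n) nc (b m)) `^ r) mr) => y.
  rewrite ger0_norm ?powR_ge0// ge0_ler_powR ?nnegrE ?nc_ge0 ?(ltW r0) ?nc_tp_le//.
  by apply: sumr_ge0 => m _; exact: nc_ge0.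
(* A norm [N' > N] is used since the level must be positive. *)
have key N' : fine N < N' -> nc (tp n b x) <= bernstein_cst * nu * N'.
  move=> NN'; have N'0 : 0 < N' := le_lt_trans fN0 NN'.
  pose l := N' * nu; have l0 : 0 < l by rewrite mulr_gt0.
  rewrite (le_trans (sup_le_level_excess x n0 bn (ltW l0)))//.
  rewrite (_ : bernstein_cst * nu * N' = 2 * (l * kcst (d := d) + 9 ^+ d * l)); last first.
    by rewrite /bernstein_cst /l; ring.
  rewrite ler_wpM2l// lerD2l natrM exprMn -mulrA ler_wpM2l ?exprn_ge0//.
  have iE : itg T (fun y => Num.max 0 (nc (tp n b y) - l)).
    apply: (itg_le (excess_measurable _ _ _) _ (itgZ (l `^ (1 - r)) ir)) => y.
    rewrite ger0_norm; last by rewrite le_max lexx.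
    by apply: excess_le_powR; rewrite ?nc_ge0.
  rewrite (@le_trans _ _ (n%:R ^+ d * (l `^ (1 - r) * N' `^ r)))//.
    rewrite ler_wpM2l ?exprn_ge0// (le_trans (le_I iE (itgZ (l `^ (1 - r)) ir) _))//.
      by move=> y; apply: excess_le_powR; rewrite ?nc_ge0.
    rewrite (IZ _ ir) IN ler_wpM2l ?powR_ge0// ge0_ler_powR ?nnegrE ?(ltW r0) ?(ltW N'0) ?(ltW NN')//.
  rewrite -nur mulrCA -[nu `^ r * _]mulrC -powRM ?(ltW N'0) ?(ltW nu0)// -/l.
  rewrite -powRD; last by rewrite (gt_eqF l0) implybT.
  by rewrite subrK powRr1 ?(ltW l0).
have C0 : 0 < bernstein_cst * nu by rewrite mulr_gt0 ?bernstein_cst_gt0.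
apply/ler_addgt0Pr => e e0.
have := key (fine N + e / (bernstein_cst * nu)) _; rewrite ltrDl divr_gt0// => /(_ isT).
by rewrite mulrDr [_ * (e / _)]mulrC divfK ?gt_eqF.
Qed.

End bernstein.

(** * Frequency blocks of a solution *)

Section blocks.
Context {R : realType} {d : nat}.
Local Notation C := R[i].
Local Notation Z := 'rV[int]_d.
Local Notation V := 'rV[R]_d.
Local Notation T := (torus_prob R d).
Local Notation I f := (Rintegral T setT f).
Implicit Types (sg : nat -> Z -> R) (c : Z -> C).

(** The blocks of an arbitrary exhausting family of symbols, so that smooth and
    sharp truncations in frequency are treated alike. *)
Definition block sg k c m : C :=
  (if k is j.+1 then sg k m - sg j m else sg 0%N m)%:C * c m.

Lemma sum_block sg n c m : \sum_(k < n.+1) block sg k c m = (sg n m)%:C * c m.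
Proof.
elim: n => [|n ih]; first by rewrite big_ord1.
by rewrite big_ord_recr/= ih /block -mulrDl -realcD addrC subrK.
Qed.

Lemma supp_block sg k c : (forall k, supp (2 ^ k) (sg k)) -> supp (2 ^ k) (block sg k c).
Proof.
move=> sgS m mk; rewrite /block; case: k mk => [|k] mk; first by rewrite sgS// mul0r.
have mk' : m \notin cube (2 ^ k) by apply: contra mk; apply: cube_le; rewrite leq_exp2l.
by rewrite !sgS// subrr mul0r.
Qed.

Lemma ae0_of_coef (f : V -> R) : sqi T f -> (forall m, rcoef f m = 0) ->
  {ae T, forall x, f x = 0}.
Proof.
move=> sf f0; have If := rcoef0_sqr0 sf f0.
pose g x := f x ^+ 2; have mg : measurable_fun setT (EFin \o g).
  by apply/measurable_EFinP; apply: measurable_funX; case: sf.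
have i0 : (\int[T]_x `|(EFin \o g) x| = 0)%E.
  have -> : (\int[T]_x `|(EFin \o g) x| = \int[T]_x (EFin \o g) x)%E.
    by apply: eq_integral => x _ /=; rewrite ger0_norm// sqr_ge0.
  rewrite -[LHS]fineK; first by congr EFin.
  by apply: integrable_fin_num => //; case: sf.
have := (ae_eq_integral_abs T measurableT mg).1 i0.
apply: filterS => x /(_ Logic.I) /= [] /eqP.
by rewrite sqrf_eq0 => /eqP.
Qed.

Section solution.
Variables (alpha : R) (u : V -> V).
Hypothesis alpha0 : 0 < alpha.
Hypothesis sol : stationary_solution alpha u.

Let uL2 : forall i, sqi T (vcomp u i).
Proof. by case: sol => _ /in_L2_sqi. Qed.

Definition L2_mass : R := \sum_i I (fun x => vcomp u i x ^+ 2).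

Lemma coef_mass i n : \sum_(m <- cube n) nc (ucoef u i m) ^+ 2 <= L2_mass.
Proof.
rewrite /L2_mass (bigD1 i)//= (fsum_defect n (uL2 i)) -[leLHS]addr0 lerD//.
  by rewrite lerDr I_ge0// => x; exact: sqr_ge0.
by apply: sumr_ge0 => j _; rewrite I_ge0// => x; exact: sqr_ge0.
Qed.

Lemma energy_mass n : energy (ucoef u) n <= L2_mass.
Proof.
apply: ler_sum => i _; rewrite (fsum_defect n (uL2 i)).
by rewrite lerDr I_ge0// => x; exact: sqr_ge0.
Qed.

(** All that an integrability assumption has to provide: blocks that are
    bounded uniformly in space, with a convergent weighted series. *)
Lemma solution_trivial sg (p : nat -> R) (B2 : R) K0 :
  (forall k, supp (2 ^ k) (sg k)) ->
  (forall K m, m \in cube (2 ^ K) -> sg (K + K0)%N m = 1) ->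
  (forall k i x, nc (tp (2 ^ k) (block sg k (ucoef u i)) x) <= p k) ->
  (forall N, \sum_(k < N) (2 ^ k)%:R `^ (1 - 2 * alpha) * p k <= B2) ->
  {ae T, forall x, u x = 0}.
Proof.
move=> sgS sg1 fp pB.
have [_ _ u0 udiv _] := sol.
have c0 i m : ucoef u i m = 0.
  apply: (@coefficients_vanish R d alpha (ucoef u) L2_mass B2
    (fun k i => block sg k (ucoef u i)) p K0.+1) => //.
  - exact: ucoef_divfree.
  - exact: energy_mass.
  - by move=> k j; exact: supp_block.
  - by move=> K j k kK; rewrite addnS sum_block sg1// mul1r.
  - by move=> n e S0 n0 e0; exact: solution_balance.
have h i := ae0_of_coef (uL2 i) (c0 i).
have : {ae T, forall x, forall i, vcomp u i x = 0} by apply: filter_forall.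
apply: filterS => x ux.
by apply/rowP => i; rewrite mxE; exact: ux.
Qed.

End solution.

End blocks.

(** * Littlewood-Paley blocks *)

Section littlewood_paley.
Context {R : realType} {d : nat}.
Local Notation C := R[i].
Local Notation Z := 'rV[int]_d.
Local Notation V := 'rV[R]_d.
Local Notation T := (torus_prob R d).
Variable chi : V -> R.
Hypothesis chiP : lp_bump chi.

Definition lp_symbol (k : nat) (m : Z) : R := chi ((2 ^ k)%:R^-1 *: intv R m).

Lemma enormZ (t : R) (x : V) : 0 <= t -> enorm (t *: x) = t * enorm x.
Proof.
move=> t0; rewrite /enorm -{2}(ger0_norm t0) -sqrtr_sqr -sqrtrM ?sqr_ge0// mulr_sumr.
by congr Num.sqrt; apply: eq_bigr => i _; rewrite mxE exprMn.
Qed.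

Lemma enorm_cube_le n (m : Z) : m \in cube n -> enorm (intv R m) <= d%:R * n%:R.
Proof.
move=> /cubeP mn; rewrite -[leRHS]ger0_norm ?mulr_ge0// -sqrtr_sqr; apply: ler_wsqrtr.
rewrite (@le_trans _ _ (\sum_(i < d) (n%:R : R) ^+ 2))//.
  apply: ler_sum => i _; rewrite mxE -(real_normK (num_real _)) lerXn2r ?nnegrE//.
  by rewrite -intr_norm -[n%:R]/(n%:Z%:~R) ler_int; exact: mn.
rewrite sumr_const card_ord -[leLHS]mulr_natl exprMn ler_wpM2r ?sqr_ge0//.
by rewrite -natrX ler_nat; nia.
Qed.

Lemma supp_lp_symbol k : supp (2 ^ k) (lp_symbol k).
Proof.
move=> m /(enorm_cubeN (R := R)) mk; apply/eqP; apply: contraTT isT => chi0.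
have [_ _ /(_ ((2 ^ k)%:R^-1 *: intv R m)) h _] := chiP.
have := h (@subset_closure _ [set x | chi x != 0] _ chi0) => /=.
by rewrite enormZ ?invr_ge0// mulrC ltr_pdivrMr ?ltr0n ?expn_gt0// mul1r ltNge mk.
Qed.

(** The shift [d.+1] absorbs the ratio [d] between the Euclidean norm and the
    maximum of the coordinates, with a factor 2 to stay below [9 / 10]. *)
Lemma lp_symbol1 K m : m \in cube (2 ^ K) -> lp_symbol (K + d.+1) m = 1.
Proof.
move=> mK; have [_ _ _ h9] := chiP; rewrite /lp_symbol h9// enormZ ?invr_ge0// mulrC.
rewrite ltr_pdivrMr ?ltr0n ?expn_gt0// (le_lt_trans (enorm_cube_le mK))//.
have h : (2 * (d * 2 ^ K) <= 2 ^ (K + d.+1))%N.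
  have dd : (d <= 2 ^ d)%N by exact: ltnW (ltn_expl d (ltnSn 1)).
  by rewrite addnS expnS expnD [(d * _)%N]mulnC; exact: leq_mul (leqnn 2) (leq_mul (leqnn _) dd).
have p0 : 0 < (2 ^ (K + d.+1))%:R :> R by rewrite ltr0n expn_gt0.
by move: h; rewrite -(ler_nat R) natrM natrM => h; lra.
Qed.

Lemma lp_leE k (f : V -> C) x :
  lp_le chi (2 ^ k) f x = tp (2 ^ k) (fun m => (lp_symbol k m)%:C * fcoef f m) x.
Proof.
rewrite /lp_le -(@fsbig_widen _ _ _ _ [set` cube (2 ^ k)]) -?(fsbig_seq _ _ (uniq_cube _))//.
by move=> m /= [_ /negP mk]; rewrite -/(lp_symbol k m) supp_lp_symbol// !mul0r.
Qed.

Lemma lp_projE k (u : V -> V) i x :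
  lp_proj chi k (cvcomp u i) x = tp (2 ^ k) (block lp_symbol k (ucoef u i)) x.
Proof.
rewrite /lp_proj; case: k => [|k]; first by rewrite (lp_leE 0).
have sk : supp (2 ^ k) (fun m => (lp_symbol k m)%:C * fcoef (cvcomp u i) m).
  by move=> m mk; rewrite supp_lp_symbol// mul0r.
have kk : (2 ^ k <= 2 ^ k.+1)%N by rewrite leq_exp2l.
rewrite (lp_leE k.+1) (lp_leE k) -(tp_le x kk sk) -tpB; apply: eq_tp => m.
by rewrite /block realcB mulrBl.
Qed.

Lemma besov_sums (L : nat -> \bar R) (s : R) : (forall k, (0 <= L k)%E) ->
  ((\sum_(0 <= k <oo) (((2 ^ k)%:R : R) `^ (s * 1))%:E * (L k) `^ 1) `^ 1^-1 < +oo)%E ->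
  (forall k, (L k < +oo)%E) /\
  exists B, forall N, \sum_(k < N) (2 ^ k)%:R `^ s * fine (L k) <= B.
Proof.
move=> L0.
have w0 k : 0 < (2 ^ k)%:R `^ s :> R by rewrite powR_gt0// ltr0n expn_gt0.
rewrite invr1 mulr1; under eq_eseriesr do rewrite poweRe1//.
set S := (X in (X `^ 1 < _)%E).
have t0 k : (0 <= ((2 ^ k)%:R `^ s)%:E * L k)%E by rewrite mule_ge0// lee_fin powR_ge0.
have S0 : (0 <= S)%E by apply: nneseries_ge0.
rewrite poweRe1// => Soo.
have part N : (\sum_(0 <= k < N) ((2 ^ k)%:R `^ s)%:E * L k <= S)%E.
  exact: nneseries_lim_ge.
have Loo k : (L k < +oo)%E.
  have := le_lt_trans (part k.+1) Soo; rewrite big_nat_recr//=.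
  rewrite ltNge => /negP h; rewrite ltNge; apply/negP => Lk; apply: h.
  move: Lk; rewrite leye_eq => /eqP ->; rewrite gt0_muley ?lte_fin//.
  by rewrite addey// -ltNye (lt_le_trans (ltNyr 0))// sume_ge0.
split => //; exists (fine S) => N.
have SE : S = (fine S)%:E by rewrite fineK// ge0_fin_numE.
rewrite -lee_fin -SE -sumEFin (le_trans _ (part N))// big_mkord.
apply: lee_sum => k _; rewrite EFinM fineK// ge0_fin_numE//.
Qed.

(** Bernstein's inequality trades the [L^q] norm for [L^oo] at the cost [t]
    derivatives; the regularity [s] and the cost [t] only enter through the
    scaling relation between them. *)
Lemma besov_solution_trivial (alpha s t : R) (q : \bar R) (u : V -> V) :
  (forall n b x, (0 < n)%N -> supp n b ->
    (Lnorm T q (fun y => (nc (tp n b y))%:E) < +oo)%E ->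
    nc (tp n b x) <= bernstein_cst (R := R) (d := d) * n%:R `^ t *
      fine (Lnorm T q (fun y => (nc (tp n b y))%:E))) ->
  s = 1 - 2 * alpha + t -> 0 < alpha -> stationary_solution alpha u ->
  in_besov chi s q 1 u -> {ae T, forall x, u x = 0}.
Proof.
move=> bern sE alpha0 sol bes.
pose L i k := Lnorm T q (fun x => (nc (lp_proj chi k (cvcomp u i) x))%:E).
have L0 i k : (0 <= L i k)%E by exact: Lnorm_ge0.
have Lsum i := besov_sums (L0 i) (bes i).
have Loo i k := (Lsum i).1 k.
have [B BL] := choice (fun i => (Lsum i).2).
pose cst := bernstein_cst (R := R) (d := d).
have cst0 : 0 < cst := bernstein_cst_gt0.
have LE i k : L i k = Lnorm T q (fun x => (nc (tp (2 ^ k) (block lp_symbol k (ucoef u i)) x))%:E).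
  by apply: eq_Lnorm => x; rewrite lp_projE.
have fL0 i k : 0 <= fine (L i k) by exact: fine_ge0.
pose p k := \sum_i cst * (2 ^ k)%:R `^ t * fine (L i k).
apply: (solution_trivial alpha0 sol supp_lp_symbol lp_symbol1 (p := p) (B2 := cst * \sum_i B i)).
  move=> k i x; rewrite (le_trans (bern _ _ _ _ (supp_block _ supp_lp_symbol) _))//.
  - by rewrite expn_gt0.
  - by rewrite -LE.
  rewrite -LE -/cst /p (bigD1 i)//= lerDl; apply: sumr_ge0 => j _.
  by apply: mulr_ge0 => //; apply: mulr_ge0; [exact: ltW|exact: powR_ge0].
move=> N; rewrite (eq_bigr (fun k : 'I_N => \sum_i cst * ((2 ^ k)%:R `^ s * fine (L i k)))).
  rewrite exchange_big/= mulr_sumr; apply: ler_sum => i _.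
  by rewrite -mulr_sumr; apply: ler_wpM2l; [exact: ltW|exact: BL].
move=> k _; rewrite /p mulr_sumr; apply: eq_bigr => i _.
have n0 : (2 ^ k)%:R != 0 :> R by rewrite pnatr_eq0 expn_eq0.
by rewrite sE (@powRD _ _ (1 - 2 * alpha)) ?n0 ?implybT//; ring.
Qed.

End littlewood_paley.

(** * Solutions of finite energy *)

Section finite_energy.
Context {R : realType} {d : nat}.
Local Notation C := R[i].
Local Notation Z := 'rV[int]_d.
Local Notation V := 'rV[R]_d.
Local Notation T := (torus_prob R d).

Lemma geometric_sum_le (r : R) N : 0 <= r < 1 -> \sum_(k < N) r ^+ k <= (1 - r)^-1.
Proof.
move=> /andP[r0 r1]; have D : 0 < 1 - r by rewrite subr_gt0.
rewrite -div1r ler_pdivlMr// mulrC -opprB mulNr -subrX1 opprB.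
by rewrite gerBl exprn_ge0.
Qed.

Definition sharp_symbol (k : nat) (m : Z) : R := (m \in cube (2 ^ k))%:R.

Lemma nc_block_sharp k (c : Z -> C) m : nc (block sharp_symbol k c m) <= nc (c m).
Proof.
rewrite /block ncM nc_real ler_piMl ?nc_ge0// /sharp_symbol.
case: k => [|k]; first by case: (_ \in _); rewrite ?normr1 ?normr0.
by case: (_ \in _); case: (_ \in _); rewrite ?subr0 ?subrr ?sub0r ?normrN ?normr1 ?normr0.
Qed.

(** By Cauchy-Schwarz over the [O(2 ^ (k * d))] frequencies of a block,
    [p k = O(2 ^ (k * d / 2))], and [1 - 2 * alpha + d / 2 < 0]. *)
Lemma L2_solution_trivial (alpha : R) (u : V -> V) : 0 < alpha ->
  (d%:R + 2) / 4 < alpha -> stationary_solution alpha u -> {ae T, forall x, u x = 0}.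
Proof.
move=> alpha0 alphad sol.
pose g := 1 - 2 * alpha + d%:R / 2.
have g0 : g < 0 by rewrite /g; lra.
pose r := 2 `^ g : R.
have r01 : 0 <= r < 1.
  rewrite powR_ge0/= /r -(opprK g) powRN invf_lt1 ?powR_gt0//.
  have e1 : 1 = 1 `^ (- g) :> R by rewrite powR1.
  by rewrite {1}e1 gt0_ltr_powR ?oppr_gt0 ?nnegrE// ltr1n.
pose A := Num.sqrt (3 ^+ d * L2_mass u) : R.
have mass0 : 0 <= L2_mass u.
  by apply: sumr_ge0 => i _; apply: I_ge0 => x; exact: sqr_ge0.
have sgS k : supp (2 ^ k) (sharp_symbol k).
  by move=> m /negbTE mk; rewrite /sharp_symbol mk.
have sg1 K m : m \in cube (2 ^ K) -> sharp_symbol (K + 0) m = 1.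
  by move=> mK; rewrite addn0 /sharp_symbol mK.
apply: (solution_trivial alpha0 sol sgS sg1 (p := fun k => (2 ^ k)%:R `^ (d%:R / 2) * A)
  (B2 := A * (1 - r)^-1)).
  move=> k i x; rewrite (le_trans (nc_tp_le _ _ _))//.
  rewrite (le_trans (ler_sum _ (fun m _ => nc_block_sharp _ _ _)))//.
  have -> : (2 ^ k)%:R `^ (d%:R / 2) = Num.sqrt ((2 ^ k)%:R ^+ d) :> R.
    by rewrite powRrM powR_mulrn// powR12_sqrt// exprn_ge0.
  rewrite /A -sqrtrM ?exprn_ge0// -[leLHS]ger0_norm; last first.
    by apply: sumr_ge0 => m _; exact: nc_ge0.
  rewrite -sqrtr_sqr; apply: ler_wsqrtr.
  have := sum_cauchy_schwarz (cube (2 ^ k)) (fun=> 1) (fun m => nc (ucoef u i m)).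
  under eq_bigr do rewrite mul1r.
  move=> /le_trans; apply; rewrite mulrA ler_pM//.
  - by apply: sumr_ge0 => m _; exact: sqr_ge0.
  - by apply: sumr_ge0 => m _; exact: sqr_ge0.
  - rewrite expr1n big_const_seq count_predT size_cube iter_addr_0 -exprMn -natrM [leLHS]natrX.
    rewrite lerXn2r ?nnegrE// ler_nat -addnn.
    have := expn_gt0 2 k; lia.
  - exact: (coef_mass sol i (2 ^ k)).
move=> N; rewrite (eq_bigr (fun k : 'I_N => A * r ^+ k)).
  by rewrite -mulr_sumr ler_wpM2l ?sqrtr_ge0// geometric_sum_le.
move=> k _; have n0 : (2 ^ k)%:R != 0 :> R by rewrite pnatr_eq0 expn_eq0.
by rewrite mulrA mulrC -powRD ?n0 ?implybT// powR_exprn.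
Qed.

End finite_energy.

(** * Triviality of stationary solutions *)

Local Close Scope complex_scope.

Theorem theorem1p10 (R : realType) (d : nat) (alpha : R)
    (chi : 'rV[R]_d -> R) :
  (2 <= d)%N -> 0 < alpha -> lp_bump chi ->
  ~ exists u : 'rV[R]_d -> 'rV[R]_d,
      [/\ stationary_solution alpha u,
          nontrivial u &
          [\/ [/\ 0 < alpha <= 1,
                  in_L2 u &
                  in_besov chi (1 - 2 * alpha) +oo%E 1 u],
              [/\ 1 <= alpha <= (d%:R + 2) / 4,
                  in_L2 u &
                  in_besov chi (- 1)
                    (if alpha == 1 then +oo%E
                     else (d%:R / (2 * alpha - 2))%:E) 1 u] |
              (d%:R + 2) / 4 < alpha /\ in_L2 u]].
Proof.
move=> d2 alpha0 chiP [u [sol ntu hyp]]; apply: ntu.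
have bernoo s : s = 1 - 2 * alpha + 0 -> in_besov chi s +oo%E 1 u ->
    {ae torus_prob R d, forall x, u x = 0}.
  move=> sE; apply: (besov_solution_trivial chiP _ sE alpha0 sol) => n b x n0 bn fin.
  by rewrite powRr0 mulr1; exact: bernstein_ess_sup.
case: hyp => [[_ _]|[/andP[a1 ad] _]|[ad _]].
- by apply: bernoo; rewrite addr0.
- case: eqVneq => [a1E|aN1]; first by apply: bernoo; rewrite a1E; ring.
  have a1' : 1 < alpha by rewrite lt_neqAle eq_sym aN1.
  have d0 : 0 < d%:R :> R by rewrite ltr0n (leq_trans _ d2).
  have D0 : 0 < 2 * alpha - 2 by lra.
  (* Bernstein's inequality costs [d / r = 2 * alpha - 2] derivatives. *)
  pose r : R := d%:R / (2 * alpha - 2).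
  have r1 : 1 < r by rewrite /r ltr_pdivlMr// mul1r; lra.
  have sE : -1 = 1 - 2 * alpha + d%:R / r.
    by rewrite /r; field; rewrite !gt_eqF.
  apply: (besov_solution_trivial chiP _ sE alpha0 sol) => n b x n0 bn.
  exact: bernstein_powR.
- exact: (L2_solution_trivial alpha0 ad sol).
Qed.
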